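(* Let $A(x)=(a^{i,j}(x))_{i,j}$ be a (non negative definite) $d\times d$ matrix-valued function on the torus $\mathbb{T}^d$, let $V:\mathbb{T}^d\to\mathbb{R}$ be continuous, let $g:\mathbb{R}\to\mathbb{R}$, let $\bar H\in\mathbb{R}$ and set $V_{\bar H}=V-\bar H$. Suppose that there exist $\theta_0,\theta_1>0$ with $\theta_0|z|^2\leq zA(x)z^T\leq\theta_1|z|^2$ for all $(x,z)\in\mathbb{T}^d\times\mathbb{R}^d$, and that $g$ is locally Lipschitz continuous and satisfies $g(s)\,\mathrm{sign}(s)\geq C_g|s|-\frac1{C_g}$ for all $s\in\mathbb{R}$, for some constant $C_g>0$. Then there exists $u\in H^1(\mathbb{T}^d)\cap L^\infty(\mathbb{T}^d)$ solving $$-\operatorname{div}(A\,Du^T)+\tfrac12 Du\,A\,Du^T+V_{\bar H}(x)-g(-u)=0\quad\text{on }\mathbb{T}^d$$ in the sense of distributions.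
   Context: Gradients are row vectors and ${}^T$ denotes transposition. A function $u\in H^1(\mathbb{T}^d)\cap L^\infty(\mathbb{T}^d)$ solves the equation in the sense of distributions if $$\int_{\mathbb{T}^d}Dv\,A\,Du^T+\Big(\tfrac12Du\,A\,Du^T+V_{\bar H}(x)-g(-u)\Big)v\,dx=0$$ for all smooth $v$ on $\mathbb{T}^d$ (equivalently, by density, for all $v\in H^1(\mathbb{T}^d)\cap L^\infty(\mathbb{T}^d)$). *)

(* Defs.v *)
From HB Require Import structures.
From mathcomp Require Import all_boot all_order all_algebra.
From mathcomp Require Import all_classical all_reals all_analysis.
From mathcomp Require Import ring lra.

Set Implicit Arguments.
Unset Strict Implicit.
Unset Printing Implicit Defensive.

Import Order.TTheory GRing.Theory Num.Theory.
Import numFieldNormedType.Exports.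

Local Open Scope classical_set_scope.
Local Open Scope ring_scope.

(** Functions on the torus T^d = R^d / Z^d are the Z^d-periodic functions on
    R^d = 'rV[R]_d, and integration over T^d is integration over the unit
    cube.  Beware that [`|z|] on 'rV[R]_d is the sup norm; the Euclidean square
    norm is written [(z *m z^T) 0 0]. *)

Section cube_measure.
Variable R : realType.
Local Notation mR := (measurableTypeR R).

Definition cube_cons n (p : mR * n.-tuple mR) : n.+1.-tuple mR :=
  [tuple of p.1 :: p.2].

Lemma measurable_cube_cons n :
  measurable_fun [set: mR * n.-tuple mR] (@cube_cons n).
Proof. exact: measurable_cons measurable_fst measurable_snd. Qed.

HB.instance Definition _ n :=
  isMeasurableFun.Build _ _ _ _ (@cube_cons n)
    (@measurable_cube_cons n).

(** The [n]-fold product of the Lebesgue measure of [0, 1], i.e. the Lebesgue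
    measure of the unit cube [0, 1]^n, as a measure on R^n. *)
Fixpoint cube_measure n : probability (n.-tuple mR) R :=
  match n with
  | 0 => \d_ [tuple]
  | m.+1 => distribution (uniform_prob (@ltr01 R) \x cube_measure m)%E
                         [the {mfun _ >-> _} of @cube_cons m]
  end.

End cube_measure.

Section torus.
Context {R : realType} {d : nat}.
Implicit Types (f u v phi : 'rV[R]_d -> R) (p : 'rV[R]_d -> 'rV[R]_d).

Definition cube_point (t : d.-tuple (measurableTypeR R)) : 'rV[R]_d := \row_i tnth t i.

Definition torus_periodic {U : Type} (f : 'rV[R]_d -> U) :=
  forall (i : 'I_d) x, f (x + delta_mx 0 i) = f x.

Definition torus_int f : R :=
  (\int[cube_measure R d]_t f (cube_point t))%R.

Definition torus_measurable f :=
  torus_periodic f /\ measurable_fun setT (f \o cube_point).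

Definition torus_Lp (q : \bar R) f :=
  torus_periodic f /\ f \o cube_point \in Lfun (cube_measure R d) q.

Definition partial (i : 'I_d) f : 'rV[R]_d -> R := 'D_(delta_mx 0 i) f.

Definition gradient f : 'rV[R]_d -> 'rV[R]_d := fun x => \row_i partial i f x.

Definition torus_smooth f :=
  torus_periodic f /\
  forall s : seq 'I_d,
    (forall i x, derivable (foldr partial f s) x (delta_mx 0 i)) /\
    continuous (foldr partial f s).

Definition weak_gradient u p :=
  [/\ torus_periodic p,
      forall i, torus_Lp 2%:E (fun x => p x 0 i) &
      forall phi, torus_smooth phi -> forall i,
        torus_int (fun x => u x * partial i phi x) =
        - torus_int (fun x => p x 0 i * phi x)].

Definition sobolev_H1 u :=
  torus_Lp 2%:E u /\ exists p, weak_gradient u p.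

Definition mxform (M : 'M[R]_d) (z w : 'rV[R]_d) : R := (z *m M *m w^T) 0 0.

(** [u] solves - div (A Du^T) + 1/2 Du A Du^T + W(x) - g(-u) = 0 on T^d in the
    sense of distributions; the weak gradient [p] of [u] is unique up to a.e.
    equality. *)
Definition distributional_solution (A : 'rV[R]_d -> 'M[R]_d)
    (W : 'rV[R]_d -> R) (g : R -> R) u :=
  exists2 p, weak_gradient u p &
    forall v, torus_smooth v ->
      torus_int (fun x =>
        mxform (A x) (gradient v x) (p x) +
        (2^-1 * mxform (A x) (p x) (p x) + W x - g (- u x)) * v x) = 0.

End torus.

Definition locally_lipschitz (R : realType) (g : R -> R) :=
  forall s : R, exists2 U, nbhs s U & [lipschitz g t | t in U].

(** For symmetric matrices a bound on the quadratic form bounds the entries; an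
    antisymmetric part, however, is invisible to the quadratic form. *)
Lemma sym_form_bounded (R : realType) (d : nat) (M : 'M[R]_d) (theta : R) :
  M^T = M ->
  (forall z : 'rV[R]_d, 0 <= mxform M z z <= theta * (z *m z^T) 0 0) ->
  forall i j, `|M i j| <= theta.
Proof.
move=> symM hM i j.
pose e k : 'rV[R]_d := delta_mx 0 k.
have formE N k l : mxform N (e k) (e l) = N k l.
  rewrite /mxform -rowE mxE (bigD1 l)//= big1 ?addr0 => [|m /negPf ml].
    by rewrite !mxE !eqxx mulr1.
  by rewrite !mxE eqxx ml mulr0.
have formP N (c : R) : N^T = N -> mxform N (e i + c *: e j) (e i + c *: e j) =
    N i i + 2 * c * N i j + c ^+ 2 * N j j.
  move=> symN; have Nji : N j i = N i j by rewrite -[in LHS]symN mxE.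
  rewrite -!formE in Nji *; rewrite /mxform in Nji *.
  rewrite linearD linearZ/= !(mulmxDl, mulmxDr) -!(scalemxAl, scalemxAr) !mxE.
  rewrite !mxE in Nji; rewrite Nji; ring.
have dotE z : (z *m z^T) 0 0 = mxform 1%:M z z by rewrite /mxform mulmx1.
have := hM (e i + (-1) *: e j); have := hM (e i + 1 *: e j).
have := hM (e j); have := hM (e i).
rewrite !dotE !formP ?trmx1// !formE !mxE !eqxx ler_norml.
have [<-|ij] /= := eqVneq i j => /andP[a b] /andP[c d'] /andP[h k] /andP[l m].
  by apply/andP; split; lra.
by apply/andP; split; lra.
Qed.

(* Main.v *)
(** With [w = exp (- u / 2)], and the test function [v / w] in place of [v], the
    equation becomes the semilinear one
      - div (A Dw^T) + 1/2 w (g (2 ln w) - W) = 0,   W = V - Hbar,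
    whatever the antisymmetric part of [A].  By the growth of [g] the zero order
    term is nonpositive at a small constant [m] and nonnegative at a large
    constant [M], so these are a sub- and a supersolution.  Between [m] and [M] this
    term is Lipschitz in [w], and one can iterate monotonically, starting from
    [m], the linear problems given by the Lax-Milgram theorem and the weak
    maximum principle.  The iterates increase and are bounded, hence converge
    in L^2, hence in H^1 by the energy estimate; no compactness is needed.
    Then [u = - 2 ln w] is bounded.

    H^1 is taken to be the closure of the C^1 periodic functions, paired with
    their gradients, in L^2, so that chain rules are obtained by passing to the
    limit. *)

From HB Require Import structures.
Require Import Defs.
From mathcomp Require Import all_boot all_order all_algebra.
From mathcomp Require Import all_classical all_reals all_analysis.
From mathcomp Require Import measurable_realfun ess_sup_inf.
From mathcomp Require Import ring lra.

Set Implicit Arguments.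
Unset Strict Implicit.
Unset Printing Implicit Defensive.

Import Order.TTheory GRing.Theory Num.Theory.
Import numFieldNormedType.Exports.

Local Open Scope classical_set_scope.
Local Open Scope ring_scope.

(** * Degenerate inner product spaces *)

(** The factor [1/2] makes the substitution exact. For [u = - 2 ln w] one has [Du = - 2 Dw / w], so
    the term [- 2 Dw A Dw^T / w^2] produced by the divergence cancels [1/2 Du A Du^T]; both involve
    [A] only through its quadratic form. The obstacle is that [v / w] and the truncations of [w] are
    not known to be admissible test functions. They are replaced by [v h(phi_n)] and [h(phi_n)],
    where [phi_n] are C^1 approximations of [w] and [h] is a globally C^{1,1} substitute for the
    inverse or the positive part. In the limit, [h'(phi_n) D phi_n] is split into
    [h'(phi_n) (D phi_n - Dw)], which tends to 0 in L^2, and [h'(phi_n) Dw], where only a bounded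
    factor varies. This analysis takes place over an arbitrary probability space, where a function
    and its formal gradient form one family of L^2 functions. The torus enters only to exhibit a
    test space, to bound [V], to integrate by parts, and to turn functions on the cube into periodic
    ones that agree with them a.e. *)

Section SemiHilbert.
Context {R : realType} {E : lmodType R}.

Definition cauchy_for (N : E -> R) (s : nat -> E) :=
  forall e, 0 < e -> exists K, forall m n, (K <= m)%N -> (K <= n)%N ->
    N (s m - s n) <= e.

Definition cvg_for (N : E -> R) (s : nat -> E) (l : E) :=
  forall e, 0 < e -> exists K, forall n, (K <= n)%N -> N (s n - l) <= e.

(** [dot] is a possibly degenerate inner product on the subspace [H] of [E],
    which is complete for the corresponding seminorm. *)
Record semi_hilbert (H : E -> Prop) (dot : E -> E -> R) : Prop := SemiHilbert {
  sh0 : H 0;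
  sh_lin : forall a x y, H x -> H y -> H (a *: x + y);
  sh_sym : forall x y, H x -> H y -> dot x y = dot y x;
  sh_dot : forall a x y z, H x -> H y -> H z ->
    dot (a *: x + y) z = a * dot x z + dot y z;
  sh_ge0 : forall x, H x -> 0 <= dot x x;
  sh_complete : forall s, (forall n, H (s n)) ->
    cauchy_for (fun x => dot x x) s ->
    exists2 l, H l & cvg_for (fun x => dot x x) s l }.

(** For [c > 0] evaluate at the vertex; for [c = 0] a nonzero [b] would make the affine function
    negative somewhere. Common source of both Cauchy-Schwarz inequalities and of the first-order
    condition in [riesz]. *)
Lemma quadratic_ge0_discr (a b c : R) :
  (forall t, 0 <= a + 2 * t * b + t ^+ 2 * c) -> b ^+ 2 <= a * c.
Proof.
move=> h.
have [c0|c0|c0] := ltgtP c 0.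
- have a0 : 0 <= a by have := h 0; lra.
  have /(_ _)/negP : forall t, ~~ (a + 2 * t * b + t ^+ 2 * c < 0).
    by move=> t; rewrite -leNgt.
  (* This [t] is at least 1 and makes [- c * t] exceed [a + 2 |b|], so the quadratic is negative at
     [t]. *)
  pose t := (a + 1 + 2 * `|b|) / - c + 1.
  have t1 : 1 <= t.
    by rewrite lerDr divr_ge0 ?oppr_ge0 ?(ltW c0)// !addr_ge0 ?mulr_ge0.
  have tc : - c * t = a + 1 + 2 * `|b| - c.
    by rewrite /t mulrDr mulr1 mulrCA divff ?mulr1// oppr_eq0 lt_eqF.
  have := h t.
  have -> : t ^+ 2 * c = - (t * (- c * t)) by ring.
  rewrite tc => h1; exfalso.
  have := ler_norm b; nra.
- have := h (- b / c).
  have -> : a + 2 * (- b / c) * b + (- b / c) ^+ 2 * c = (a * c - b ^+ 2) / c.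
    by field; rewrite gt_eqF.
  by rewrite pmulr_lge0 ?invr_gt0// subr_ge0.
- subst c; rewrite mulr0.
  have [->|b0] := eqVneq b 0; first by rewrite expr0n.
  have := h (- (a + 1) / (2 * b)).
  have -> : a + 2 * (- (a + 1) / (2 * b)) * b + (- (a + 1) / (2 * b)) ^+ 2 * 0
    = - 1 by field.
  lra.
Qed.

Variables (H : E -> Prop) (dot : E -> E -> R).
Hypothesis SH : semi_hilbert H dot.
Local Notation nrm x := (dot x x).

Lemma shD x y : H x -> H y -> H (x + y).
Proof. by move=> hx hy; rewrite -[x]scale1r; exact: (sh_lin SH). Qed.

Lemma shZ a x : H x -> H (a *: x).
Proof. by move=> hx; rewrite -[_ *: _]addr0; apply: (sh_lin SH) => //; exact: sh0 SH. Qed.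

Lemma shB x y : H x -> H y -> H (x - y).
Proof. by move=> hx hy; rewrite addrC -scaleN1r; exact: (sh_lin SH). Qed.

Lemma sh_dotr a x y z : H x -> H y -> H z ->
  dot z (a *: x + y) = a * dot z x + dot z y.
Proof.
move=> hx hy hz; rewrite (sh_sym SH) ?(sh_dot SH)//; last exact: (sh_lin SH).
by rewrite (sh_sym SH hx hz) (sh_sym SH hy hz).
Qed.

Lemma sh_dotBZ a x y z : H x -> H y -> H z ->
  dot (x - a *: y) z = dot x z - a * dot y z.
Proof. by move=> *; rewrite addrC -scaleNr (sh_dot SH)//; ring. Qed.

Lemma sh_nrm_lin a x y : H x -> H y ->
  nrm (a *: x + y) = a ^+ 2 * nrm x + 2 * a * dot x y + nrm y.
Proof.
move=> hx hy; have hl := sh_lin SH a hx hy.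
rewrite (sh_dot SH)// !sh_dotr// (sh_sym SH hy hx); ring.
Qed.

Lemma sh_nrmB x y : H x -> H y -> nrm (x - y) = nrm x - 2 * dot x y + nrm y.
Proof.
move=> hx hy; rewrite addrC -scaleN1r sh_nrm_lin// (sh_sym SH hy hx); ring.
Qed.

Lemma sh_nrmD x y : H x -> H y -> nrm (x + y) = nrm x + 2 * dot x y + nrm y.
Proof. by move=> hx hy; rewrite -[x]scale1r sh_nrm_lin// scale1r; ring. Qed.

Lemma sh_nrmZ a x : H x -> nrm (a *: x) = a ^+ 2 * nrm x.
Proof.
move=> hx; have h0 := sh0 SH.
have d0 z : H z -> dot z 0 = 0.
  move=> hz; have := @sh_dotr 1 0 0 z h0 h0 hz.
  by rewrite scale1r addr0 mul1r => /eqP; rewrite eq_sym -subr_eq0 addrK => /eqP.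
by rewrite -[a *: x]addr0 sh_nrm_lin// !d0//; ring.
Qed.

Lemma sh_cauchy_schwarz x y : H x -> H y -> dot x y ^+ 2 <= nrm x * nrm y.
Proof.
move=> hx hy; rewrite mulrC; apply: quadratic_ge0_discr => t.
have := sh_ge0 SH (sh_lin SH t hx hy); rewrite sh_nrm_lin//; lra.
Qed.

Lemma sh_nrmB_le x y : H x -> H y -> nrm (x - y) <= 2 * nrm x + 2 * nrm y.
Proof.
move=> hx hy; rewrite sh_nrmB//.
by have := sh_ge0 SH (shD hx hy); rewrite sh_nrmD//; lra.
Qed.

Record bounded_functional (l : E -> R) : Prop := BoundedFunctional {
  bf_lin : forall a x y, H x -> H y -> l (a *: x + y) = a * l x + l y;
  bf_bound : exists K : R, forall x, H x -> l x ^+ 2 <= K * nrm x }.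

Lemma bfD l x y : bounded_functional l -> H x -> H y -> l (x + y) = l x + l y.
Proof. by move=> [llin _] hx hy; rewrite -[x]scale1r llin// mul1r scale1r. Qed.

Lemma bfZ l a x : bounded_functional l -> H x -> l (a *: x) = a * l x.
Proof.
move=> lbf hx; have h0 := sh0 SH.
have l0 : l 0 = 0.
  by have := bfD lbf h0 h0; rewrite addr0 => /eqP; rewrite eq_sym -subr_eq0 addrK => /eqP.
by rewrite -[_ *: _]addr0 (bf_lin lbf)// l0 addr0.
Qed.

(** Direct minimisation of [J x = |x|^2 - 2 l x]: the parallelogram law makes a minimising sequence
    Cauchy, and its limit satisfies the Euler equation. *)
Lemma riesz l : bounded_functional l ->
  exists2 r, H r & forall x, H x -> dot r x = l x.
Proof.
move=> lbf; have [llin [K lb]] := lbf.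
pose J x := nrm x - 2 * l x.
(* With [k = |K|], the bound [2 l x <= |x|^2 + k] follows by comparing squares:
   [4 (l x)^2 <= 4 k |x|^2 <= (|x|^2 + k)^2]. *)
have JK x : H x -> - `|K| <= J x.
  move=> hx; have := lb x hx; have n0 := sh_ge0 SH hx.
  have : K * nrm x <= `|K| * nrm x by rewrite ler_wpM2r// ler_norm.
  rewrite /J; have := normr_ge0 K; move: (`|K|) => k k0 h1 h2.
  have : (l x) ^+ 2 <= k * nrm x by lra.
  have := sqr_ge0 (nrm x - k); rewrite !expr2 => ? ?.
  rewrite lerBrDr; have [l0|l0] := leP (l x) 0; first by lra.
  rewrite leNgt; apply/negP => ?.
  have : (nrm x + k) ^+ 2 < (2 * l x) ^+ 2 by rewrite ltrXn2r//; lra.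
  by rewrite !expr2; nra.
pose S := [set J x | x in H].
have Slb : has_inf S.
  split; first by exists (J 0), 0 => //; exact: sh0 SH.
  by exists (- `|K|) => _ [x hx <-]; exact: JK.
pose i := inf S.
have iJ x : H x -> i <= J x.
  by move=> hx; apply: ge_inf; [exact: Slb.2|exists x].
have /choice[s hs] : forall n : nat, exists x, H x /\ J x <= i + n.+1%:R^-1.
  move=> n; have [_ [x hx <-] hlt] :=
    @inf_adherent _ S n.+1%:R^-1 ltac:(by rewrite invr_gt0 ltr0n) Slb.
  by exists x; split => //; exact: ltW.
have Hs n : H (s n) by have [] := hs n.
(* [J] at the midpoint is at least [i]; the parallelogram law turns this into a bound on
   [|x - y|^2]. *)
have mid x y : H x -> H y -> nrm (x - y) <= 2 * (J x - i) + 2 * (J y - i).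
  move=> hx hy.
  have hm : H (2^-1 *: (x + y)) by exact/shZ/shD.
  have := iJ _ hm; rewrite /J sh_nrmZ ?bfZ//; try exact: shD.
  by rewrite sh_nrmD// sh_nrmB// (bfD lbf hx hy); lra.
have [e e0|r hr hsr] := sh_complete SH Hs.
  have [k hk] : exists k : nat, 4 * k.+1%:R^-1 <= e.
    exists (Num.truncn (4 / e)); rewrite ler_pdivrMr ?ltr0n// mulrC -ler_pdivrMr//.
    exact/ltW/Num.Theory.truncnS_gt.
  exists k => m n km kn; apply: le_trans (mid _ _ (Hs m) (Hs n)) (le_trans _ hk).
  have le_inv j : (k <= j)%N -> j.+1%:R^-1 <= k.+1%:R^-1 :> R.
    by move=> kj; rewrite lef_pV2 ?posrE ?ltr0n// ler_nat ltnS.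
  have := (hs m).2; have := (hs n).2; have := le_inv _ km; have := le_inv _ kn.
  move: (m.+1%:R^-1) (n.+1%:R^-1) (k.+1%:R^-1) => a b c; lra.
(* [J (t v + x) - i] is a nonnegative quadratic in [t]. Its discriminant gives the Euler equation up
   to an error controlled by [J x - i], so that [J] need not be evaluated at the limit. *)
have hdot v : H v -> forall x, H x -> (dot x v - l v) ^+ 2 <= (J x - i) * nrm v.
  move=> hv x hx; apply: quadratic_ge0_discr => t.
  have := iJ _ (sh_lin SH t hv hx); rewrite /J sh_nrm_lin// llin//.
  rewrite (sh_sym SH hv hx); lra.
exists r => // v hv; apply/eqP; rewrite -subr_eq0 -sqrf_eq0 eq_le sqr_ge0 andbT.
apply/ler_addgt0Pl => e e0; rewrite addr0.
have nv := sh_ge0 SH hv.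
have n1 : 0 < nrm v + 1 by lra.
have [k hk] := hsr (e / (4 * (nrm v + 1))) ltac:(by rewrite divr_gt0// mulr_gt0).
pose j := maxn k (Num.truncn (4 * (nrm v + 1) / e)).
have hj := hk j (leq_maxl _ _).
have h1 := hdot v hv (s j) (Hs j).
have h2 : J (s j) - i <= e / (4 * (nrm v + 1)).
  apply: le_trans (_ : j.+1%:R^-1 <= _); first by rewrite lerBlDl; exact: (hs j).2.
  rewrite -[leRHS]invf_div lef_pV2 ?posrE ?ltr0n ?divr_gt0// ?mulr_gt0//.
  apply: le_trans (ltW (Num.Theory.truncnS_gt _)) _; rewrite ler_nat ltnS; exact: leq_maxr.
have h3 := sh_cauchy_schwarz (shB (Hs j) hr) hv.
have h4 : dot (s j - r) v = dot (s j) v - dot r v.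
  by rewrite addrC -scaleN1r (sh_dot SH)//; ring.
have h5 : e / (4 * (nrm v + 1)) * nrm v <= e / 4.
  rewrite invfM mulrA -mulrA ler_piMr ?divr_ge0 ?(ltW e0)//.
  by rewrite mulrC ler_pdivrMr//; lra.
have h6 : (dot (s j) v - l v) ^+ 2 <= e / 4.
  by apply: le_trans h1 (le_trans _ h5); rewrite ler_wpM2r.
have h7 : (dot (s j) v - dot r v) ^+ 2 <= e / 4.
  by rewrite -h4; apply: le_trans h3 (le_trans _ h5); rewrite ler_wpM2r.
have : (dot r v - l v) ^+ 2 <=
    2 * (dot (s j) v - dot r v) ^+ 2 + 2 * (dot (s j) v - l v) ^+ 2.
  by have := sqr_ge0 (dot (s j) v - dot r v + (dot (s j) v - l v)); rewrite !expr2; lra.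
lra.
Qed.

Record coercive_form (B : E -> E -> R) : Prop := CoerciveForm {
  cf_linl : forall a x y z, H x -> H y -> H z ->
    B (a *: x + y) z = a * B x z + B y z;
  cf_linr : forall a x y z, H x -> H y -> H z ->
    B z (a *: x + y) = a * B z x + B z y;
  cf_bound : exists K : R, forall x y, H x -> H y -> B x y ^+ 2 <= K * nrm x * nrm y;
  cf_coercive : exists2 c : R, 0 < c & forall x, H x -> c * nrm x <= B x x }.

(* The residual [T x], i.e. the Riesz representative of [B x _ - l], satisfies
   [|T (x - rho T x)|^2 <= theta |T x|^2] for small [rho], hence its infimum is
   [0]; and [c |x - y| <= |T x - T y|], so that a minimizing sequence is
   Cauchy. *)
Lemma lax_milgram B l : coercive_form B -> bounded_functional l ->
  exists2 w, H w & forall v, H v -> B w v = l v.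
Proof.
move=> [Bl Br [K0 BK0] [c c0 Bc]] lbf.
(* Adding [c ^+ 2] to the bound ensures [c ^+ 2 / K <= 1], hence [0 <= th] below. *)
pose K : R := `|K0| + c ^+ 2.
have K_gt0 : 0 < K by rewrite ltr_wpDl// exprn_gt0.
have BK x y : H x -> H y -> B x y ^+ 2 <= K * nrm x * nrm y.
  move=> hx hy; apply: le_trans (BK0 _ _ hx hy) _.
  have := sh_ge0 SH hx; have := sh_ge0 SH hy => ny nx.
  by rewrite ler_wpM2r// ler_wpM2r// (le_trans (ler_norm _))// lerDl sqr_ge0.
have BB x y z : H x -> H y -> H z -> B (x - y) z = B x z - B y z.
  by move=> *; rewrite addrC -scaleN1r Bl//; ring.
have bB x : H x -> bounded_functional (B x).
  move=> hx; split=> [a y z hy hz|]; first exact: Br.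
  by exists (K * nrm x) => y hy; exact: BK.
have [r hr rl] := riesz lbf.
have /choice[S hS] : forall x, exists y, H x -> H y /\ forall v, H v -> dot y v = B x v.
  move=> x; have [hx|hx] := pselect (H x); last by exists 0.
  by have [y hy yE] := riesz (bB x hx); exists y.
pose T x := S x - r.
have HS x : H x -> H (S x) by move=> /hS[].
have SE x v : H x -> H v -> dot (S x) v = B x v by move=> /hS[_]; exact.
have HT x : H x -> H (T x) by move=> hx; exact/shB/hr/HS.
have TE x v : H x -> H v -> dot (T x) v = B x v - l v.
  move=> hx hv; rewrite /T addrC -scaleN1r (sh_dot SH) ?rl ?SE//; last exact: HS.
  by ring.
have SK x : H x -> nrm (S x) <= K * nrm x.
  move=> hx; have := BK _ _ hx (HS _ hx); rewrite -(SE x (S x))//; last exact: HS.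
  have := sh_ge0 SH (HS _ hx); have := sh_ge0 SH hx => n1.
  rewrite le0r => /orP[/eqP -> _|n2]; first by rewrite mulr_ge0// ltW.
  by rewrite expr2 ler_pM2r.
(* Elements with the same pairings may differ by a null vector of [dot], so the chosen [S] need not
   be linear. Identities between its values are only used inside the seminorm. *)
have nrm_ext x y : H x -> H y -> (forall v, H v -> dot x v = dot y v) -> nrm x = nrm y.
  by move=> hx hy h; rewrite h// (sh_sym SH)// h.
(* [rho] minimises [1 - 2 rho c + rho^2 K], an upper bound for the factor by which a step multiplies
   the squared residual; [th] is the minimum. *)
pose rho : R := c / K.
pose th : R := 1 - c ^+ 2 / K.
have step x : H x -> nrm (T (x - rho *: T x)) <= th * nrm (T x).
  move=> hx; have hTx := HT _ hx; have hSTx := HS _ hTx.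
  have hy : H (x - rho *: T x) by apply/shB/shZ.
  rewrite (@nrm_ext _ (T x - rho *: S (T x))); last 3 first.
  - exact: HT.
  - exact/shB/shZ.
  - move=> v hv; rewrite TE//.
    rewrite sh_dotBZ// TE// SE//.
    by rewrite [x - _]addrC -scaleNr Bl//; ring.
  rewrite addrC -scaleNr sh_nrm_lin// (SE (T x) (T x))//.
  have := SK _ hTx; have := Bc _ hTx; set n := nrm (T x) => h1 h2.
  have rho0 : 0 < rho by rewrite divr_gt0.
  have h3 : rho ^+ 2 * nrm (S (T x)) <= rho ^+ 2 * (K * n).
    by rewrite ler_wpM2l// sqr_ge0.
  have h4 : rho * (c * n) <= rho * B (T x) (T x) by rewrite ler_wpM2l// ltW.
  have : rho ^+ 2 * (K * n) = c ^+ 2 / K * n by rewrite /rho; field; rewrite gt_eqF.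
  have : rho * (c * n) = c ^+ 2 / K * n by rewrite /rho; field; rewrite gt_eqF.
  rewrite sqrrN /th; lra.
have th_lt1 : th < 1 by rewrite ltrBlDr ltrDl divr_gt0// exprn_gt0.
have th_ge0 : 0 <= th.
  by rewrite subr_ge0 ler_pdivrMr// mul1r /K lerDr.
pose s n := iter n (fun x => x - rho *: T x) 0.
have Hs n : H (s n).
  elim: n => [|n IH]; first exact: sh0 SH.
  by apply: shB => //; apply/shZ/HT.
have snT n : nrm (T (s n)) <= th ^+ n * nrm (T 0).
  elim: n => [|n IH]; first by rewrite expr0 mul1r.
  apply: le_trans (step _ (Hs n)) _.
  by rewrite exprS -mulrA ler_wpM2l.
have T0 : 0 <= nrm (T 0) by apply: (sh_ge0 SH); apply/HT; exact: sh0 SH.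
have T_small (e : R) : 0 < e -> exists K, forall n, (K <= n)%N -> nrm (T (s n)) <= e.
  move=> e0.
  have /cvgrPdist_le/(_ (e / (nrm (T 0) + 1))) : th ^+ n @[n --> \oo] --> (0 : R).
    by apply: cvg_expr; rewrite ger0_norm.
  rewrite divr_gt0 ?ltr_wpDl// => /(_ isT)[N _ hN].
  exists N => n Nn; have := hN n Nn; rewrite /= sub0r normrN ger0_norm ?exprn_ge0//.
  rewrite ler_pdivlMr ?ltr_wpDl// => h; apply: le_trans (snT n) (le_trans _ h).
  by rewrite ler_wpM2l ?exprn_ge0// lerDl.
have TB x y : H x -> H y -> c ^+ 2 * nrm (x - y) <= nrm (T x - T y).
  move=> hx hy; have hxy := shB hx hy.
  have hT := shB (HT _ hx) (HT _ hy).
  have E1 : dot (T x - T y) (x - y) = B (x - y) (x - y).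
    rewrite -[T y]scale1r sh_dotBZ; [|exact: HT..|by []].
    by rewrite !TE// BB//; ring.
  have := sh_cauchy_schwarz hT hxy; rewrite E1.
  have := Bc _ hxy; have := sh_ge0 SH hxy; have := sh_ge0 SH hT.
  move: (nrm (x - y)) (nrm (T x - T y)) (B _ _) => a b z b0 a0 h1 h2.
  have [->|a_neq] := eqVneq a 0; first by rewrite mulr0.
  have a_gt0 : 0 < a by rewrite lt_def a_neq.
  have : (c * a) ^+ 2 <= z ^+ 2 by rewrite lerXn2r ?nnegrE// ?mulr_ge0 ?(ltW c0)// (le_trans _ h1)// mulr_ge0// ltW.
  move=> h3; rewrite -(ler_pM2r a_gt0); have := le_trans h3 h2.
  by rewrite exprMn [a ^+ 2]expr2 mulrA.
have [e e0|w hw hsw] := sh_complete SH Hs.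
  have [N hN] := T_small (c ^+ 2 * e / 4) ltac:(by rewrite divr_gt0// mulr_gt0// exprn_gt0).
  exists N => m n Nm Nn.
  have := TB _ _ (Hs m) (Hs n).
  have := sh_nrmB_le (HT _ (Hs m)) (HT _ (Hs n)).
  have := hN _ Nm; have := hN _ Nn => h1 h2 h3 h4.
  have : c ^+ 2 * nrm (s m - s n) <= c ^+ 2 * e by lra.
  by rewrite ler_pM2l// exprn_gt0.
exists w => // v hv.
(* Only the seminorm of the residual can be shown to vanish; Cauchy-Schwarz then makes every pairing
   [B w v - l v] zero. *)
suff Tw : nrm (T w) <= 0.
  have := sh_cauchy_schwarz (HT _ hw) hv.
  have -> : nrm (T w) = 0 by apply/eqP; rewrite eq_le Tw; exact/(sh_ge0 SH)/HT.
  rewrite mul0r TE// => h; apply/eqP; rewrite -subr_eq0 -sqrf_eq0 eq_le h.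
  exact: sqr_ge0.
apply/ler_addgt0Pl => e e0; rewrite addr0.
have [N1 hN1] := T_small (e / 4) ltac:(by rewrite divr_gt0).
have [N2 hN2] := hsw (e / (4 * K)) ltac:(by rewrite divr_gt0// mulr_gt0).
pose n := maxn N1 N2.
have h1 := hN1 n (leq_maxl _ _); have h2 := hN2 n (leq_maxr _ _).
have hn := Hs n.
have hT := HT _ hn; have hTw := HT _ hw.
have E1 : nrm (T (s n) - T w) = nrm (S (s n - w)).
  apply: nrm_ext; [exact: shB|exact/HS/shB|move=> v' hv'].
  rewrite SE//; last exact: shB.
  rewrite -[T w]scale1r sh_dotBZ; [|exact: HT..|by []].
  by rewrite !TE// BB//; ring.
have h3 : nrm (S (s n - w)) <= e / 4.
  apply: le_trans (SK _ (shB hn hw)) _; apply: le_trans (_ : K * (e / (4 * K)) <= _).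
    by rewrite ler_pM2l.
  by rewrite le_eqVlt; apply/orP; left; apply/eqP; field; rewrite gt_eqF.
have -> : nrm (T w) = nrm (T (s n) - (T (s n) - T w)).
  by rewrite opprB addrCA subrr addr0.
have := sh_nrmB_le hT (shB hT hTw); rewrite E1; lra.
Qed.

End SemiHilbert.

(** * Square integrable functions *)

Section Integrable.
Context {d} {T : measurableType d} {R : realType}.
Variable mu : probability T R.
Implicit Types (f g h : T -> R).

Local Notation int f := (Rintegral mu setT f).

Definition intg f := mu.-integrable setT (EFin \o f).

Lemma intg_measurable f : intg f -> measurable_fun setT f.
Proof. by move=> /measurable_int/measurable_EFinP. Qed.

Lemma intgD f g : intg f -> intg g -> intg (fun x => f x + g x).
Proof. by move=> hf hg; exact: (integrableD measurableT hf hg). Qed.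

Lemma intgZ a f : intg f -> intg (fun x => a * f x).
Proof. by move=> hf; exact: (integrableZl measurableT a hf). Qed.

Lemma intgB f g : intg f -> intg g -> intg (fun x => f x - g x).
Proof. by move=> hf hg; exact: (integrableB measurableT hf hg). Qed.

Lemma intg_norm f : intg f -> intg (fun x => `|f x|).
Proof. by move=> hf; exact: integrable_norm. Qed.

Lemma intg_le f g : measurable_fun setT f -> (forall x, `|f x| <= g x) ->
  intg g -> intg f.
Proof.
move=> mf fg ig; apply: le_integrable ig => //; first exact/measurable_EFinP.
by move=> x _; rewrite lee_fin (le_trans (fg x))// ler_norm.
Qed.

Lemma intg_cst a : intg (fun=> a).
Proof. exact: finite_measure_integrable_cst. Qed.

Lemma intg_bounded f M : measurable_fun setT f -> (forall x, `|f x| <= M) -> intg f.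
Proof. by move=> mf fM; apply: intg_le mf fM _; exact: intg_cst. Qed.

Lemma intg_mul_bounded f g M : measurable_fun setT f -> (forall x, `|f x| <= M) ->
  intg g -> intg (fun x => f x * g x).
Proof.
move=> mf fM ig.
apply: (@intg_le _ (fun x => M * `|g x|)); last exact/intgZ/intg_norm.
  by apply: measurable_funM => //; exact: intg_measurable.
by move=> x; rewrite normrM ler_wpM2r.
Qed.

Lemma intg_sum (J : finType) (F : J -> T -> R) : (forall j, intg (F j)) ->
  intg (fun x => \sum_j F j x).
Proof.
move=> hF; rewrite /intg (_ : _ \o _ = fun x => (\sum_j (F j x)%:E)%E); last first.
  by apply/funext => x /=; rewrite sumEFin.
by apply: integrable_sum => // i _; exact: hF.
Qed.

Lemma intD f g : intg f -> intg g -> int (fun x => f x + g x) = int f + int g.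
Proof. by move=> *; rewrite RintegralD. Qed.

Lemma intB f g : intg f -> intg g -> int (fun x => f x - g x) = int f - int g.
Proof. by move=> *; rewrite RintegralB. Qed.

Lemma intZ a f : intg f -> int (fun x => a * f x) = a * int f.
Proof. by move=> *; rewrite RintegralZl. Qed.

Lemma int_cst a : int (fun=> a) = a.
Proof. by rewrite Rintegral_cst// -[X in _ * X]/(fine (mu setT)) probability_setT mulr1. Qed.

Lemma int_sum (J : finType) (F : J -> T -> R) : (forall j, intg (F j)) ->
  int (fun x => \sum_j F j x) = \sum_j int (F j).
Proof.
move=> hF; rewrite unlock; elim: (index_enum J) => [|j s IH] /=.
  exact: int_cst.
rewrite -IH -intD//.
elim: s {IH} => [|i s IH] /=; first exact: intg_cst.
by apply: intgD.
Qed.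

Lemma int_ge0 f : (forall x, 0 <= f x) -> 0 <= int f.
Proof. by move=> f0; exact: Rintegral_ge0. Qed.

Lemma int_le f g : intg f -> intg g -> (forall x, f x <= g x) -> int f <= int g.
Proof. by move=> *; exact: le_Rintegral. Qed.

Lemma int_normr_le f : intg f -> `|int f| <= int (fun x => `|f x|).
Proof. by move=> ?; exact: le_normr_Rintegral. Qed.

Lemma eq_int f g : f =1 g -> int f = int g.
Proof. by move=> fg; apply: eq_Rintegral => x _; exact: fg. Qed.

Lemma ae_eq_int f g : measurable_fun setT f -> measurable_fun setT g ->
  {ae mu, forall x, f x = g x} -> int f = int g.
Proof.
move=> mf mg fg; congr fine; apply: ae_eq_integral => //.
- exact/measurable_EFinP.
- exact/measurable_EFinP.
- by apply: filterS fg => x /= ->.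
Qed.

(** The minimum of [f] and [g] is a.e. equal to [f] and everywhere below [g], which reduces the
    claim to a pointwise comparison. *)
Lemma ae_int_le f g : intg f -> intg g -> {ae mu, forall x, f x <= g x} ->
  int f <= int g.
Proof.
move=> hf hg fg.
have mf := intg_measurable hf; have mg := intg_measurable hg.
have mm : measurable_fun setT (fun x => Num.min (f x) (g x)).
  exact: measurable_minr.
rewrite (@ae_eq_int f (fun x => Num.min (f x) (g x)))//; last first.
  by apply: filterS fg => x fg; rewrite min_l.
apply: int_le => // [|x]; last by rewrite ge_min lexx orbT.
apply: (@intg_le _ (fun x => `|f x| + `|g x|)) => //.
  move=> x; rewrite /Num.min; case: ifP => _; rewrite ?lerDl ?lerDr//.
by apply: intgD; exact: intg_norm.
Qed.

Lemma ae_int_eq0 f : intg f -> (forall x, 0 <= f x) -> int f <= 0 ->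
  {ae mu, forall x, f x = 0}.
Proof.
move=> hf f0 if0.
have : (\int[mu]_x `|(EFin \o f) x|)%E = 0.
  under eq_integral do rewrite /= ger0_norm//.
  have := integrable_fin_num measurableT hf => /fineK <-.
  congr EFin; apply/eqP; rewrite eq_le if0/=; exact: int_ge0.
move/ae_eq_integral_abs => /(_ measurableT (measurable_int _ hf)).
by apply: filterS => x /= /(_ I)[].
Qed.

Lemma ae_int_bound f (M : R) : intg f -> {ae mu, forall x, f x <= M} -> int f <= M.
Proof.
move=> hf fM; rewrite -[leRHS]int_cst; apply: ae_int_le => //; exact: intg_cst.
Qed.

(* Dominated convergence, applied to the truncations of [f] at level [n]. *)
Lemma intg_tail f e : intg f -> 0 < e ->
  exists2 K : R, 0 < K & int (fun x => `|f x - (if `|f x| <= K then f x else 0)|) <= e.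
Proof.
move=> hf e0; have mf := intg_measurable hf.
pose t (n : nat) x := if `|f x| <= n.+1%:R then f x else 0.
have mt n : measurable_fun setT (t n).
  apply: measurable_fun_ifT => //.
  apply: measurable_fun_ler => //; exact: measurableT_comp.
have [_ h _] := @dominated_convergence _ _ _ mu setT measurableT
  (fun n => EFin \o t n) (EFin \o f) (EFin \o (fun x => `|f x|))
  ltac:(by move=> n; exact/measurable_EFinP) ltac:(exact/measurable_EFinP)
  ltac:(apply: aeW => x _; apply: cvg_near_cst; exists (Num.truncn `|f x|) => // n /= kn;
        rewrite /t ifT// ; apply: le_trans (ltW (Num.Theory.truncnS_gt _)) _; by rewrite ler_nat ltnS)
  (intg_norm hf)
  ltac:(by apply: aeW => x n _ /=; rewrite lee_fin /t; case: ifP; rewrite ?normr0).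
have /fine_cvgP[_ /cvgrPdist_le/(_ e e0)[N _ hN]] := h.
exists N.+1%:R; first by rewrite ltr0n.
have := hN N (leqnn N); rewrite /= sub0r normrN => /(le_trans (ler_norm _)).
apply: le_trans; rewrite le_eqVlt; apply/orP; left; apply/eqP; congr fine.
by apply: eq_integral => x _ /=; rewrite distrC.
Qed.

End Integrable.

Section SquareIntegrable.
Context {d} {T : measurableType d} {R : realType}.
Variable mu : probability T R.
Implicit Types (f g h : T -> R).

Local Notation int f := (Rintegral mu setT f).

(** Genuine functions, not classes modulo a.e. equality; null functions are the reason for allowing
    degenerate inner products. *)
Definition L2 f := measurable_fun setT f /\ intg mu (fun x => f x ^+ 2).

Lemma L2_intgM f g : L2 f -> L2 g -> intg mu (fun x => f x * g x).
Proof.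
move=> [mf hf] [mg hg]; apply: (intg_le _ _ (intgD hf hg)).
  exact: measurable_funM.
move=> x; rewrite normrM -[f x ^+ 2]real_normK ?num_real// -[g x ^+ 2]real_normK ?num_real//.
have := sqr_ge0 (`|f x| - `|g x|); have := sqr_ge0 (`|f x| + `|g x|).
by rewrite !expr2; lra.
Qed.

Lemma L2_bounded f M : measurable_fun setT f -> (forall x, `|f x| <= M) -> L2 f.
Proof.
move=> mf fM; split=> //; apply: (@intg_bounded _ _ _ _ _ (M ^+ 2)).
  exact: measurable_funX.
by move=> x; rewrite normrX lerXn2r ?nnegrE// (le_trans _ (fM x)).
Qed.

Lemma L2_cst a : L2 (fun=> a).
Proof. by apply: (@L2_bounded _ `|a|). Qed.

Lemma L2_intg f : L2 f -> intg mu f.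
Proof.
move=> hf; have := L2_intgM hf (L2_cst 1).
by under eq_fun do rewrite mulr1.
Qed.

Lemma L2_lin a f g : L2 f -> L2 g -> L2 (fun x => a * f x + g x).
Proof.
move=> hf hg; split.
  by apply: measurable_funD; [apply: measurable_funM => //; exact: hf.1|exact: hg.1].
have := intgD (intgD (intgZ (a ^+ 2) hf.2) (intgZ (2 * a) (L2_intgM hf hg))) hg.2.
by congr (intg mu _); apply/funext => x; ring.
Qed.

Lemma L2Z a f : L2 f -> L2 (fun x => a * f x).
Proof.
by move=> hf; have := L2_lin a hf (L2_cst 0); under eq_fun do rewrite addr0.
Qed.

Lemma L2D f g : L2 f -> L2 g -> L2 (fun x => f x + g x).
Proof.
by move=> hf hg; have := L2_lin 1 hf hg; under eq_fun do rewrite mul1r.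
Qed.

Lemma L2B f g : L2 f -> L2 g -> L2 (fun x => f x - g x).
Proof.
move=> hf hg; have := L2_lin (-1) hg hf.
by under eq_fun do rewrite mulN1r addrC.
Qed.

Lemma L2_mul_bounded f g M : measurable_fun setT f -> (forall x, `|f x| <= M) ->
  L2 g -> L2 (fun x => f x * g x).
Proof.
move=> mf fM [mg hg]; split; first exact: measurable_funM.
have [mf2 fM2] := (measurable_funX 2 mf, fun x => lerXn2r 2 (normr_ge0 (f x))
   (le_trans (normr_ge0 _) (fM x)) (fM x)).
under eq_fun do rewrite exprMn.
by apply: (@intg_mul_bounded _ _ _ _ _ _ (M ^+ 2)) => // x; rewrite normrX.
Qed.

Lemma L2_le f g : measurable_fun setT f -> (forall x, `|f x| <= `|g x|) ->
  L2 g -> L2 f.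
Proof.
move=> mf fg [mg hg]; split => //; apply: intg_le hg; first exact: measurable_funX.
by move=> x; rewrite normrX -[leRHS]real_normK ?num_real// lerXn2r ?nnegrE.
Qed.

Lemma L2_cauchy_schwarz f g : L2 f -> L2 g ->
  int (fun x => f x * g x) ^+ 2 <= int (fun x => f x ^+ 2) * int (fun x => g x ^+ 2).
Proof.
move=> hf hg; apply: quadratic_ge0_discr => t.
have -> : int (fun x => f x ^+ 2) + 2 * t * int (fun x => f x * g x) +
   t ^+ 2 * int (fun x => g x ^+ 2) = int (fun x => (t * g x + f x) ^+ 2).
  have fg := L2_intgM hf hg.
  rewrite -(intZ _ fg) -(intZ _ hg.2) -(intD hf.2 (intgZ _ fg)).
  rewrite -(intD (intgD hf.2 (intgZ _ fg)) (intgZ _ hg.2)).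
  by apply: eq_int => x; ring.
by apply: int_ge0 => x; exact: sqr_ge0.
Qed.

Definition L2cauchy (s : nat -> T -> R) := forall e : R, 0 < e ->
  exists K, forall m n, (K <= m)%N -> (K <= n)%N ->
    int (fun x => (s m x - s n x) ^+ 2) <= e.

Definition L2cvg (s : nat -> T -> R) f := forall e : R, 0 < e ->
  exists K, forall n, (K <= n)%N -> int (fun x => (s n x - f x) ^+ 2) <= e.

(* A subsequence with [|s_{k+1} - s_k|^2 <= 4^-k] converges a.e., since
   [|x| <= (2^-k + 2^k x^2) / 2] makes the increments summable in L^1; Fatou's
   lemma then gives the convergence in L^2. *)
Lemma L2_complete s : (forall n, L2 (s n)) -> L2cauchy s ->
  exists2 f, L2 f & L2cvg s f.
Proof.
move=> hs cs.
have /choice[N hN] : forall k : nat, exists K, forall m n, (K <= m)%N -> (K <= n)%N ->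
    int (fun x => (s m x - s n x) ^+ 2) <= (4 ^- k).
  by move=> k; apply: cs; rewrite invr_gt0 exprn_gt0.
pose n_ := fix n_ k := if k is k'.+1 then maxn (N k) (n_ k').+1 else N 0.
have n_N k : (N k <= n_ k)%N by case: k => [|k] //=; exact: leq_maxl.
have n_S k : (n_ k < n_ k.+1)%N by rewrite /=; exact: leq_maxr.
have n_ge k : (k <= n_ k)%N by elim: k => // k IH; exact: leq_ltn_trans (n_S k).
have n_le k j : (k <= j)%N -> (n_ k <= n_ j)%N.
  elim: j => [|j IH]; first by rewrite leqn0 => /eqP ->.
  rewrite leq_eqVlt => /predU1P[->//|]; rewrite ltnS => /IH /leq_trans; apply.
  exact: ltnW.
pose u k := s (n_ k).
have mu_ k : measurable_fun setT (u k) by have [] := hs (n_ k).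
pose g k x := `|u k.+1 x - u k x|.
have gL k : L2 (fun x => u k.+1 x - u k x) by exact: (L2B (hs _) (hs _)).
have mg k : measurable_fun setT (g k).
  by apply: measurableT_comp => //; exact: (gL k).1.
have g0 k x : (0 <= (g k x)%:E)%E by rewrite lee_fin; exact: normr_ge0.
have ig k : int (g k) <= 2 ^- k.
  have : int (fun x => 2^-1 * 2 ^- k + 2^-1 * 2 ^+ k * (u k.+1 x - u k x) ^+ 2)
      <= 2 ^- k.
    rewrite (intD (intg_cst mu _) (intgZ _ (gL k).2)) int_cst (intZ _ (gL k).2).
    have := hN k (n_ k.+1) (n_ k) (leq_trans (n_N k) (n_le _ _ (leqnSn k))) (n_N k).
    rewrite -(@ler_pM2l _ (2^-1 * 2 ^+ k)) ?mulr_gt0 ?exprn_gt0//.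
    have -> : 2^-1 * 2 ^+ k * 4 ^- k = 2^-1 * 2 ^- k :> R.
      have -> : 4 = 2 * 2 :> R by ring.
      by rewrite exprMn; field; rewrite expf_neq0.
    move: (2 ^- k) (_ * int _) => a b; lra.
  apply: le_trans; apply: int_le.
  - exact/intg_norm/L2_intg.
  - by apply: intgD; [exact: intg_cst|exact/intgZ/(gL k).2].
  - move=> x; rewrite /g -[(_ - _) ^+ 2]real_normK ?num_real//.
    move: (`|_|) => y; have p0 : 0 < 2 ^+ k :> R by rewrite exprn_gt0.
    rewrite -subr_ge0.
    have -> : 2^-1 / 2 ^+ k + 2^-1 * 2 ^+ k * y ^+ 2 - y =
       2^-1 * (2 ^+ k)^-1 * (1 - 2 ^+ k * y) ^+ 2 by field; rewrite gt_eqF.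
    by rewrite mulr_ge0 ?sqr_ge0// mulr_ge0// invr_ge0 ltW.
(* The series can be integrated term by term and is bounded by a geometric series, so it is
   integrable, hence finite a.e. *)
have sum_fin : {ae mu, forall x, (\sum_(k <oo) (g k x)%:E < +oo)%E}.
  have mS : measurable_fun setT (fun x => \sum_(k <oo) (g k x)%:E)%E.
    apply: (@ge0_emeasurable_sum _ _ _ setT (fun k x => (g k x)%:E) predT).
      by move=> k x _ _; rewrite lee_fin; exact: normr_ge0.
    move=> k _.
    exact/measurable_EFinP.
  have : mu.-integrable setT (fun x => \sum_(k <oo) (g k x)%:E)%E.
    apply/integrableP; split => //.
    under eq_integral do (rewrite gee0_abs; last by apply: nneseries_ge0 => *; exact: g0).
    rewrite (@integral_nneseries _ _ _ mu _ measurableT (fun k x => (g k x)%:E))//; last first.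
      by move=> k; exact/measurable_EFinP.
    apply: (@le_lt_trans _ _ (\sum_(k <oo) (2 ^- k)%:E)%E).
      apply: lee_nneseries => [k _ _|k _]; first by apply: integral_ge0.
      have gi : intg mu (g k) by exact/intg_norm/L2_intg.
      by rewrite -(fineK (integrable_fin_num measurableT gi)) lee_fin; exact: ig.
    have := @cvg_geometric_eseries_half R 2 0.
    rewrite [X in eseries X](_ : _ = fun k => (2 ^- k)%:E); last first.
      by apply/funext => k; rewrite natrX addn1 exprS invfM mulrA divff// mul1r.
    move=> /cvg_lim h; rewrite [ltLHS](_ : _ = (2 / 2 ^+ 0)%:E) ?ltry//.
    exact: h.
  move=> /(integrable_ae measurableT); apply: filterS => x /(_ I).
  by rewrite ge0_fin_numE//; apply: nneseries_ge0 => *; exact: g0.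
have u_cvg : {ae mu, forall x, cvgn (u ^~ x)}.
  apply: filterS sum_fin => x gx.
  have /normed_cvg : cvgn [normed series (telescope (u ^~ x))].
    apply: nondecreasing_is_cvgn.
      by apply: nondecreasing_series => k _ _; exact: normr_ge0.
    exists (fine (\sum_(k <oo) (g k x)%:E)%E) => _ [n _ <-].
    rewrite -lee_fin fineK; last first.
      by rewrite ge0_fin_numE//; apply: nneseries_ge0 => *; exact: g0.
    rewrite /series/= -sumEFin.
    by apply: (@nneseries_lim_ge _ (fun k => (g k x)%:E) predT 0 n) => k _ _; exact: g0.
  move=> /cvg_ex[l hl]; apply/cvg_ex; exists (u 0 x + l).
  rewrite (_ : u ^~ x = fun n => u 0 x + series (telescope (u ^~ x)) n).
    by apply: cvgD hl; exact: cvg_cst.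
  by apply/funext => n; rewrite -eq_sum_telescope.
(* The upper limit is measurable without any convergence, and [fine] gives it a real value on the
   exceptional null set. *)
pose f x := fine (limn_esup (fun k => (u k x)%:E)).
have mf : measurable_fun setT f.
  apply: measurableT_comp => //.
  by apply: measurable_fun_limn_esup => k; exact/measurable_EFinP.
have f_cvg : {ae mu, forall x, u ^~ x @ \oo --> f x}.
  apply: filterS u_cvg => x /[dup] cx /cvg_ex[l ul].
  suff -> : f x = l by [].
  have ul' : (u k x)%:E @[k --> \oo] --> l%:E by apply: cvg_EFin => //; exact: nearW.
  rewrite /f is_cvg_limn_esupE; last by apply/cvg_ex; exists l%:E.
  by move/cvg_lim : ul' => ->.
have main (e : R) : 0 < e -> exists K, forall n, (K <= n)%N ->
    (\int[mu]_x ((s n x - f x) ^+ 2)%:E <= e%:E)%E.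
  move=> e0; have [K hK] := cs e e0; exists K => n Kn.
  have h : {ae mu, forall x, limn_einf (fun k => ((s n x - u k x) ^+ 2)%:E) =
      ((s n x - f x) ^+ 2)%:E}.
    apply: filterS f_cvg => x ufx.
    have c : ((s n x - u k x) ^+ 2)%:E @[k --> \oo] --> ((s n x - f x) ^+ 2)%:E.
      apply: cvg_EFin; first exact: nearW.
      have h : s n x - u k x @[k --> \oo] --> s n x - f x.
        by apply: cvgB => //; exact: cvg_cst.
      exact: (cvgM h h).
    by rewrite is_cvg_limn_einfE; [exact/cvg_lim|apply/cvg_ex; eexists; exact: c].
  have mD k : measurable_fun setT (fun x => (s n x - u k x) ^+ 2).
    by apply: measurable_funX; apply: measurable_funB => //; exact: (hs _).1.
  rewrite -(@ae_eq_integral _ _ _ mu setT _ (fun x => limn_einf (fun k => ((s n x - u k x) ^+ 2)%:E)))//; first last.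
  - by apply: filterS h => x /= ->.
  - apply/measurable_EFinP; apply: measurable_funX; apply: measurable_funB => //.
    exact: (hs _).1.
  - rewrite (_ : (fun x => _) = fun x =>
        (- limn_esup (fun k => - ((s n x - u k x) ^+ 2)%:E))%E); last first.
      apply/funext => x; rewrite -limn_einfN; congr limn_einf.
      by apply/funext => k /=; rewrite opprK.
    apply: measurableT_comp => //; apply: measurable_fun_limn_esup => k.
    by apply: measurableT_comp => //; exact/measurable_EFinP.
  apply: (le_trans (@fatou _ _ _ mu setT measurableT
    (fun k x => ((s n x - u k x) ^+ 2)%:E) _ _)).
  - by move=> k; exact/measurable_EFinP.
  - by move=> k x _; rewrite lee_fin sqr_ge0.
  rewrite limn_einf_lim; apply: lime_le; first exact: is_cvg_einfs.
  (* The infimum over the indices from [k] on is bounded by the term at [maxn k K], to which the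
     Cauchy bound applies. *)
  apply: nearW => k; apply: ge_ereal_inf.
  eexists; first by exists (maxn k K) => //=; exact: leq_maxl.
  have h1 := hK n (n_ (maxn k K)) Kn (leq_trans (leq_maxr _ _) (n_ge _)).
  have h2 := (L2B (hs n) (hs (n_ (maxn k K)))).2.
  by rewrite -(fineK (integrable_fin_num measurableT h2)) lee_fin.
have hd n : L2 (fun x => s n x - f x) -> L2 f.
  move=> h; have := L2B (hs n) h.
  by congr L2; apply/funext => x; ring.
have mdiff n : measurable_fun setT (fun x => s n x - f x).
  by apply: measurable_funB => //; exact: (hs _).1.
have fL : L2 f.
  have [K hK] := main 1 ltr01; apply: (hd K); split=> //.
  apply/integrableP; split; first by apply/measurable_EFinP; exact: measurable_funX.
  under eq_integral do rewrite /= ger0_norm ?sqr_ge0//.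
  by apply: le_lt_trans (hK K (leqnn K)) _; rewrite ltry.
exists f => // e e0; have [K hK] := main e e0; exists K => n Kn.
have h := (L2B (hs n) fL).2.
rewrite -lee_fin fineK; first exact: hK.
exact: (integrable_fin_num measurableT h).
Qed.

End SquareIntegrable.

(** * One-variable functions *)

Section RealFunctions.
Context {R : realType}.
Implicit Types (f h k : R -> R) (a b s t m M : R).

(** At the joint, the Caratheodory slopes of the two pieces glue to a slope that is continuous
    because the derivatives agree there. Both pieces are differentiable in the two-sided sense up to
    and including [a], so no one-sided derivatives occur. *)
Lemma is_derive_glue f1 f2 f1' f2' a : f1 a = f2 a -> f1' a = f2' a ->
  (forall s, s <= a -> is_derive s 1 f1 (f1' s)) ->
  (forall s, a <= s -> is_derive s 1 f2 (f2' s)) ->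
  forall s, is_derive s (1 : R) (fun s => if s <= a then f1 s else f2 s)
                          (if s <= a then f1' s else f2' s).
Proof.
move=> e0 e1 d1 d2 s; have [sa|sa|->] := ltgtP s a.
- apply: near_eq_is_derive (d1 s (ltW sa)).
  near=> x; rewrite ifT//; apply: ltW; near: x; exact: lt_nbhsl.
- apply: near_eq_is_derive (d2 s (ltW sa)).
  near=> x; rewrite leNgt ifF//; apply/negbTE; rewrite negbK; near: x; exact: lt_nbhsr.
have /is_derive1_caratheodory[g1 [E1 c1 v1]] := d1 a (lexx a).
have /is_derive1_caratheodory[g2 [E2 c2 v2]] := d2 a (lexx a).
apply/is_derive1_caratheodory; exists (fun z => if z <= a then g1 z else g2 z); split.
- by move=> z; rewrite lexx; case: ifP => _; rewrite ?E1// e0 E2.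
- have g12 : g1 a = g2 a by rewrite v1 v2.
  apply/cvgrPdist_lt => e e_gt0; rewrite lexx.
  move/cvgrPdist_lt : c1 => /(_ e e_gt0) c1.
  move/cvgrPdist_lt : c2 => /(_ e e_gt0) c2.
  by near=> z; case: ifP => _; [near: z|rewrite g12; near: z].
- by rewrite lexx.
Unshelve. all: by end_near. Qed.

Lemma is_derive_affine (a b c s : R) :
  is_derive s (1 : R) (fun x => a + c * (x - b)) c.
Proof.
apply/is_derive1_caratheodory; exists (fun=> c); split => // [z|]; first by ring.
exact: cvg_cst.
Qed.

Lemma is_derive_continuous f (f' : R) s : is_derive s (1 : R) f f' -> {for s, continuous f}.
Proof.
by move=> [df _]; apply: differentiable_continuous; apply/derivable1_diffP.
Qed.

Lemma lipschitz_ge0 h C : (forall s t, `|h s - h t| <= C * `|s - t|) -> 0 <= C.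
Proof. by move=> /(_ 1 0); rewrite subr0 normr1 mulr1; exact: le_trans. Qed.

Lemma lipschitz_continuous h C : (forall s t, `|h s - h t| <= C * `|s - t|) ->
  continuous h.
Proof.
move=> hC s; have C0 := lipschitz_ge0 hC.
apply/cvgrPdist_le => e e0; near=> t.
have st : `|s - t| < e / (C + 1).
  by near: t; apply/nbhs_ballP; exists (e / (C + 1)) => //=; rewrite divr_gt0// ltr_wpDl.
apply: le_trans (hC s t) _; apply: le_trans (_ : (C + 1) * `|s - t| <= _).
  by rewrite ler_wpM2r// lerDl.
by rewrite mulrC -ler_pdivlMr ?ltr_wpDl// ltW.
Unshelve. all: by end_near. Qed.

Lemma is_derive_lipschitz f f' C : (forall s, is_derive s (1 : R) f (f' s)) ->
  (forall s, `|f' s| <= C) -> forall s t, `|f s - f t| <= C * `|s - t|.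
Proof.
move=> df fC.
suff le s t : s <= t -> `|f s - f t| <= C * `|s - t|.
  move=> s t; have [/le//|/ltW/le] := leP s t.
  by rewrite distrC [`|t - s|]distrC.
move=> st.
have fc : {within `[s, t], continuous f}.
  by apply: continuous_subspaceT => x; exact: is_derive_continuous (df x).
have [c _ E] := MVT_segment st (fun x _ => df x) fc.
by rewrite distrC E normrM [`|t - s|]distrC ler_wpM2r.
Qed.

(** What compositions in H^1 require: a bounded derivative makes [h] globally Lipschitz, so that
    [h(phi_n)] converges in L^2 along with [phi_n]; a Lipschitz derivative gives the same for
    [h'(phi_n)]. *)
Record C11 h h' := MkC11 {
  C11_derive : forall s, is_derive s (1 : R) h (h' s);
  C11_bound : exists C, forall s, `|h' s| <= C;
  C11_lip : exists C, forall s t, `|h' s - h' t| <= C * `|s - t| }.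

Lemma C11_lipschitz h h' : C11 h h' ->
  exists C, forall s t, `|h s - h t| <= C * `|s - t|.
Proof. by move=> [dh [C hC] _]; exists C; exact: is_derive_lipschitz dh hC. Qed.

Lemma C11_continuous h h' : C11 h h' -> continuous h.
Proof. by move=> /C11_lipschitz[C]; exact: lipschitz_continuous. Qed.

Lemma C11_continuous_der h h' : C11 h h' -> continuous h'.
Proof. by move=> [_ _ [C]]; exact: lipschitz_continuous. Qed.

Lemma maxr_lipschitz m s t : `|Num.max s m - Num.max t m| <= `|s - t|.
Proof.
have [hs|hs] := leP s m; have [ht|ht] := leP t m; rewrite ?subrr ?normr0//.
- have e1 : `|m - t| = t - m by rewrite distrC ger0_norm// subr_ge0 ltW.
  have e2 : `|s - t| = t - s by rewrite distrC ger0_norm// subr_ge0; lra.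
  by rewrite e1 e2; lra.
- have e1 : `|s - m| = s - m by rewrite ger0_norm// subr_ge0 ltW.
  have e2 : `|s - t| = s - t by rewrite ger0_norm// subr_ge0; lra.
  by rewrite e1 e2; lra.
Qed.

Lemma maxr_pos m s : 0 < m -> 0 < Num.max s m.
Proof. by move=> m0; rewrite lt_max m0 orbT. Qed.

Lemma inv_max_bounds m s : 0 < m -> 0 < (Num.max s m)^-1 <= m^-1.
Proof.
move=> m0; have M0 := maxr_pos s m0.
by rewrite invr_gt0 M0 lef_pV2// le_max lexx orbT.
Qed.

Lemma inv_max_lip m s t : 0 < m ->
  `|(Num.max s m)^-1 - (Num.max t m)^-1| <= m^-1 * m^-1 * `|s - t|.
Proof.
move=> m0; have s0 := maxr_pos s m0; have t0 := maxr_pos t m0.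
have -> : (Num.max s m)^-1 - (Num.max t m)^-1 =
  (Num.max s m)^-1 * (Num.max t m)^-1 * (Num.max t m - Num.max s m).
  by field; rewrite !gt_eqF.
rewrite normrM; have := maxr_lipschitz m t s; rewrite [`|t - s|]distrC => h.
have /andP[a0 a1] := inv_max_bounds s m0; have /andP[b0 b1] := inv_max_bounds t m0.
apply: ler_pM => //; rewrite ger0_norm ?mulr_ge0 ?(ltW a0) ?(ltW b0)//.
by apply: ler_pM => //; exact: ltW.
Qed.

(** The logarithm, continued below [m] by its tangent line at [m] so as to be globally C^{1,1}. As
    [w >= m], it can replace [ln] in compositions with [w]; [invx] plays the same part for the
    inverse. *)
Definition lnx m s := if s <= m then ln m + m^-1 * (s - m) else ln s.

Lemma C11_lnx m : 0 < m -> C11 (lnx m) (fun s => (Num.max s m)^-1).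
Proof.
move=> m0; split.
- move=> s.
  have -> : (Num.max s m)^-1 = if s <= m then m^-1 else s^-1.
    by rewrite maxEle; case: ifP.
  rewrite /lnx; refine (@is_derive_glue (fun s => ln m + m^-1 * (s - m)) (@ln R) (fun=> m^-1) (@GRing.inv R) m _ _ _ _ s) => //.
  + by rewrite subrr mulr0 addr0.
  + by move=> x _; exact: is_derive_affine.
  + by move=> x mx; apply: is_derive1_ln; exact: lt_le_trans mx.
- exists m^-1 => s; have /andP[a b] := inv_max_bounds s m0.
  by rewrite ger0_norm// ltW.
- by exists (m^-1 * m^-1) => s t; exact: inv_max_lip.
Qed.

Definition invx m s := if s <= m then m^-1 - m^-1 ^+ 2 * (s - m) else s^-1.

Lemma C11_invx m : 0 < m -> C11 (invx m) (fun s => - (Num.max s m)^-1 ^+ 2).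
Proof.
move=> m0; split.
- move=> s.
  have -> : - (Num.max s m)^-1 ^+ 2 = if s <= m then - m^-1 ^+ 2 else - s^-1 ^+ 2.
    by rewrite maxEle; case: ifP.
  refine (@is_derive_glue (fun s => m^-1 - m^-1 ^+ 2 * (s - m)) (@GRing.inv R)
    (fun=> - m^-1 ^+ 2) (fun s => - s^-1 ^+ 2) m _ _ _ _ s) => //.
  + by rewrite subrr mulr0 subr0.
  + move=> x _; under eq_fun do rewrite -mulNr; exact: is_derive_affine.
  + move=> x mx; apply: is_derive_eq.
      apply: (@is_deriveV _ id); rewrite gt_eqF//; exact: lt_le_trans mx.
    by rewrite /GRing.scale/= mulr1 exprVn.
- exists (m^-1 ^+ 2) => s; have /andP[a b] := inv_max_bounds s m0.
  rewrite normrN ger0_norm ?exprn_ge0 ?(ltW a)//.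
  by rewrite lerXn2r// nnegrE ltW// (lt_le_trans a).
- exists (m^-1 * m^-1 * (m^-1 + m^-1)) => s t.
  have -> : - (Num.max s m)^-1 ^+ 2 - - (Num.max t m)^-1 ^+ 2 =
    ((Num.max t m)^-1 - (Num.max s m)^-1) * ((Num.max t m)^-1 + (Num.max s m)^-1).
    by ring.
  rewrite normrM mulrAC; have := inv_max_lip t s m0; rewrite [`|t - s|]distrC => h.
  have /andP[a a'] := inv_max_bounds s m0; have /andP[b b'] := inv_max_bounds t m0.
  apply: ler_pM => //; rewrite ger0_norm ?addr_ge0 ?(ltW a) ?(ltW b)//.
  exact: lerD.
Qed.

(* A [C11] substitute for the positive part [(s - 1)^+], so that the comparison
   principle needs no chain rule for Lipschitz functions. *)
Definition pospart s := s - 1 - lnx 1 s.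

Lemma C11_pospart : C11 pospart (fun s => 1 - (Num.max s 1)^-1).
Proof.
have [d _ [C hC]] := C11_lnx (@ltr01 R); split.
- move=> s; have -> : pospart = (fun x => 0 + 1 * (x - 1)) - lnx 1.
    by apply/funext => x; rewrite /pospart !fctE add0r mul1r.
  by apply: is_deriveB => //; exact: is_derive_affine.
- exists 1 => s; have := inv_max_bounds s (@ltr01 R).
  by rewrite invr1 ler_norml => /andP[? ?]; apply/andP; split; lra.
- exists C => s t.
  rewrite (_ : 1 - _ - _ = (Num.max t 1)^-1 - (Num.max s 1)^-1); last by ring.
  by rewrite [`|s - t|]distrC; exact: hC.
Qed.

Lemma pospart_der_ge0 s : 0 <= 1 - (Num.max s 1)^-1.
Proof. by have := inv_max_bounds s (@ltr01 R); rewrite invr1 => /andP[]; lra. Qed.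

Lemma pospart_le1 s : s <= 1 -> pospart s = 0.
Proof. by move=> s1; rewrite /pospart /lnx s1 ln1 invr1 mul1r add0r subrr. Qed.

(** From the strict inequality [1 + x < expR x] at [x = ln s]. Strictness is what lets the
    comparison principle conclude [s <= 1] from [pospart s = 0]. *)
Lemma pospart_gt1 s : 1 < s -> 0 < pospart s.
Proof.
move=> s1; rewrite /pospart /lnx leNgt s1/= subr_gt0.
rewrite -subr_gt0.
have s0 : 0 < s by lra.
have e : expR (ln s) = s by rewrite lnK// posrE.
have := @expR_gt1Dx R (ln s); rewrite e => -/(_ _); rewrite ln_eq0// gt_eqF// => /(_ isT).
lra.
Qed.

Lemma pospart_ge0 s : 0 <= pospart s.
Proof. by have [/pospart_le1->//|/pospart_gt1/ltW] := leP s 1. Qed.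

(** Continuous induction: [S] collects the [x] such that [g] is Lipschitz on [[a, x]], and a
    neighbourhood of its supremum carries the property further, unless [b] is reached. Across a
    joint the constants are added. *)
Lemma locally_lipschitz_itv (g : R -> R) a b : a <= b -> locally_lipschitz g ->
  exists2 L, 0 < L & forall s t, a <= s <= b -> a <= t <= b ->
    `|g s - g t| <= L * `|s - t|.
Proof.
move=> ab hg.
pose lip u v L := forall s t, u <= s -> s <= t -> t <= v -> `|g s - g t| <= L * `|s - t|.
pose S := [set x | a <= x <= b /\ exists L, lip a x L].
have Sa : S a.
  split; first by rewrite lexx.
  exists 0 => s t s1 s2 s3; have -> : s = t by lra.
  by rewrite !subrr normr0 mulr0.
have hS : has_sup S by split; [exists a|exists b => x [/andP[]]].
have c_ub x : S x -> x <= sup S by move=> Sx; exact: (sup_upper_bound hS).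
have cb : sup S <= b by apply: ge_sup => [|x [/andP[]]//]; exists a.
pose c := sup S.
have [U Uc hU] := hg c.
have [e /= e0 ballU] : exists2 e : R, 0 < e & forall x, `|c - x| < e -> U x.
  by move/nbhs_ballP : Uc => [e /= e0 he]; exists e.
have [L0 hL0] : exists L, forall s t, U s -> U t -> `|g s - g t| <= L * `|s - t|.
  (* The Lipschitz notation asserts the bound for all large enough constants, those strictly above
     [L]. *)
  have [L [_ hL]] := hU; exists (L + 1) => s t Us Ut.
  by have := hL (L + 1) ltac:(by rewrite ltrDl) (s, t); apply; split.
have [x [xab [L1 hL1]] xc] : exists2 x, S x & c - e < x by exact: sup_adherent.
have xc' : x <= c by apply: c_ub; split => //; exists L1.
(* [y] is in [S], hence [y <= c]; since [c + e / 2] exceeds [c], this forces [y = b]. *)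
pose y := Num.min b (c + e / 2).
have yS : S y.
  split.
    have /andP[ax xb] := xab.
    rewrite ge_min lexx le_min ab/= andbT.
    have : a <= c by exact: le_trans xc'.
    lra.
  exists (`|L0| + `|L1|) => s t as_ st ty.
  have L0n := ler_norm L0; have L1n := ler_norm L1.
  have n0 := normr_ge0 L0; have n1 := normr_ge0 L1; have nst := normr_ge0 (s - t).
  have inU z : x <= z -> z <= t -> U z.
    move=> xz zt; apply: ballU; rewrite ltr_norml.
    have : z <= c + e / 2.
      by rewrite (le_trans zt)// (le_trans ty)// ge_min lexx orbT.
    by move=> ?; apply/andP; split; lra.
  have [tx|xt] := leP t x.
    apply: le_trans (hL1 s t as_ st tx) _; rewrite ler_wpM2r//; lra.
  have [xs|sx] := leP x s.
    apply: le_trans (hL0 s t (inU _ xs st) (inU _ (ltW xt) (lexx _))) _.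
    by rewrite ler_wpM2r//; lra.
  have h1 := hL1 s x as_ (ltW sx) (lexx x).
  have h2 := hL0 x t (inU _ (lexx x) (ltW xt)) (inU _ (ltW xt) (lexx _)).
  have h3 := ler_distD (g x) (g s) (g t).
  have e1 : `|s - x| = x - s by rewrite distrC ger0_norm// subr_ge0 ltW.
  have e2 : `|x - t| = t - x by rewrite distrC ger0_norm// subr_ge0 ltW.
  have e3 : `|s - t| = t - s by rewrite distrC ger0_norm// subr_ge0.
  rewrite e1 in h1; rewrite e2 in h2; rewrite e3.
  have h4 : L1 * (x - s) <= `|L1| * (t - s).
    by apply: le_trans (ler_wpM2r _ L1n) _; rewrite ?ler_wpM2l; lra.
  have h5 : L0 * (t - x) <= `|L0| * (t - s).
    by apply: le_trans (ler_wpM2r _ L0n) _; rewrite ?ler_wpM2l; lra.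
  lra.
have yc : y <= c := c_ub y yS.
have yb : y = b.
  rewrite /y; case: (leP b (c + e / 2)) => // h; move: yc; rewrite /y min_r ?(ltW h)//; lra.
have [_ [L hL]] := yS; rewrite yb in hL.
exists (`|L| + 1); first by rewrite ltr_wpDl.
suff le s t : a <= s -> s <= t -> t <= b -> `|g s - g t| <= (`|L| + 1) * `|s - t|.
  move=> s t /andP[s1 s2] /andP[t1 t2]; have [st|/ltW ts] := leP s t; first exact: le.
  by rewrite distrC [`|s - t|]distrC; exact: le.
move=> s1 st t1; apply: le_trans (hL s t s1 st t1) _; rewrite ler_wpM2r//.
by have := ler_norm L; lra.
Qed.

Lemma locally_lipschitz_continuous (g : R -> R) : locally_lipschitz g -> continuous g.
Proof.
move=> hg s; have [L L0 hL] := @locally_lipschitz_itv g (s - 1) (s + 1) ltac:(lra) hg.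
apply/cvgrPdist_le => e e0; near=> t.
have st : `|s - t| < 1 by near: t; apply/nbhs_ballP; exists 1 => /=.
have st' : `|s - t| < e / L by near: t; apply/nbhs_ballP; exists (e / L) => //=; exact: divr_gt0.
apply: le_trans (hL s t _ _) _; first by apply/andP; split; lra.
  by move: st; rewrite ltr_norml => /andP[? ?]; apply/andP; split; lra.
by rewrite mulrC -ler_pdivlMr// ltW.
Unshelve. all: by end_near. Qed.

(* The barriers [m = exp (- L)] and [M = exp L] come from the growth of [g] at
   infinity. *)
Lemma barriers (g : R -> R) (Cg K : R) : locally_lipschitz g -> 0 < Cg -> 0 <= K ->
  (forall s, Cg * `|s| - Cg^-1 <= g s * Num.sg s) ->
  exists m M lam : R, [/\ 0 < m, m < M, 0 < lam &
    forall W, `|W| <= K -> let F s := 2^-1 * s * (g (2 * ln s) - W) in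
    [/\ F m <= 0, 0 <= F M &
      forall s t, m <= s <= M -> m <= t <= M -> `|F s - F t| <= lam * `|s - t|]].
Proof.
move=> hg Cg0 K0 growth.
(* Chosen so that [Cg * (2 * L) - Cg^-1 >= K]: by the growth condition [g] then dominates [W] at
   [2 ln M = 2 L] and at [2 ln m = - 2 L]. *)
pose L := (K + Cg^-1) / (2 * Cg) + 1.
have iC : 0 < Cg^-1 by rewrite invr_gt0.
have L0 : 0 < L by rewrite ltr_wpDl// divr_ge0// ?addr_ge0 ?mulr_ge0// ltW.
have CL : K + Cg^-1 <= Cg * (2 * L).
  have -> : Cg * (2 * L) = K + Cg^-1 + 2 * Cg by rewrite /L; field; rewrite gt_eqF.
  lra.
pose m := expR (- L); pose M := expR L.
have m0 : 0 < m by exact: expR_gt0.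
have M0 : 0 < M by exact: expR_gt0.
have mM : m < M by rewrite ltr_expR; lra.
have gM : K <= g (2 * ln M).
  rewrite expRK; have := growth (2 * L); rewrite gtr0_sg ?mulr_gt0// gtr0_norm ?mulr_gt0//.
  by rewrite mulr1; lra.
have gm : g (2 * ln m) <= - K.
  rewrite expRK; have := growth (2 * - L).
  rewrite ltr0_sg; last by rewrite pmulr_rlt0// oppr_lt0.
  rewrite normrM normrN !gtr0_norm//; lra.
have [Lg Lg0 hLg] := @locally_lipschitz_itv g (2 * ln m) (2 * ln M)
  ltac:(by rewrite ler_pM2l// ler_ln ?posrE// ltW) hg.
have lnb s : m <= s <= M -> 2 * ln m <= 2 * ln s <= 2 * ln M.
  move=> /andP[ms sM]; have s0 := lt_le_trans m0 ms.
  by rewrite !ler_pM2l// !ler_ln ?posrE// ms.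
have lnlip s t : m <= s <= M -> m <= t <= M -> `|ln s - ln t| <= m^-1 * `|s - t|.
  move=> /andP[ms _] /andP[mt _].
  have lnE x : m <= x -> ln x = lnx m x.
    move=> mx; rewrite /lnx; case: ifP => // xm.
    have -> : x = m by apply/eqP; rewrite eq_le xm.
    by rewrite subrr mulr0 addr0.
  rewrite !lnE//; apply: is_derive_lipschitz; first exact: (C11_derive (C11_lnx m0)).
  by move=> x; have /andP[a b] := inv_max_bounds x m0; rewrite ger0_norm// ltW.
pose B := `|g (2 * ln m)| + Lg * (2 * (m^-1 * (M - m))).
have gB s : m <= s <= M -> `|g (2 * ln s)| <= B.
  move=> hs; have hm : m <= m <= M by rewrite lexx ltW.
  have h1 := hLg _ _ (lnb _ hs) (lnb _ hm).
  have h2 := lnlip _ _ hs hm.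
  have h3 : `|2 * ln s - 2 * ln m| <= 2 * (m^-1 * (M - m)).
    rewrite -mulrBr normrM gtr0_norm// ler_pM2l// (le_trans h2)// ler_pM2l ?invr_gt0//.
    by have /andP[? ?] := hs; rewrite ger0_norm; lra.
  have h5 : Lg * `|2 * ln s - 2 * ln m| <= Lg * (2 * (m^-1 * (M - m))) by rewrite ler_pM2l.
  have h6 : `|g (2 * ln s)| <= `|g (2 * ln s) - g (2 * ln m)| + `|g (2 * ln m)|.
    by rewrite -{1}(subrK (g (2 * ln m)) (g (2 * ln s))) ler_normD.
  rewrite /B; lra.
exists m, M, (2^-1 * (B + K) + 2^-1 * (M * (Lg * (2 * m^-1)))); split => //.
  apply: ltr_wpDl; last by rewrite !mulr_gt0// invr_gt0.
  rewrite mulr_ge0// addr_ge0//.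
  by apply: le_trans (normr_ge0 _) (gB m _); rewrite lexx ltW.
(* All constants were fixed before [W], which makes them uniform in the space variable when [W] is
   the value of the potential at a point. *)
move=> W WK F; have WK1 := ler_norm W; have WK2 := ler_norm (- W).
rewrite normrN in WK2; split.
- by rewrite /F mulr_ge0_le0 ?mulr_ge0 ?(ltW m0)//; lra.
- by rewrite /F !mulr_ge0 ?(ltW M0)//; lra.
move=> s t hs ht.
have -> : F s - F t = 2^-1 * ((g (2 * ln s) - W) * (s - t)) +
  2^-1 * (t * (g (2 * ln s) - g (2 * ln t))) by rewrite /F; ring.
have /andP[mt tM] := ht.
rewrite [leRHS]mulrDl; apply: le_trans (ler_normD _ _) _; apply: lerD.
  rewrite !normrM gtr0_norm// -[leRHS]mulrA ler_pM2l// ler_wpM2r//.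
  by apply: le_trans (ler_normB _ _) _; apply: lerD => //; exact: gB.
rewrite !normrM gtr0_norm// -[leRHS]mulrA ler_pM2l// (gtr0_norm (lt_le_trans m0 mt)).
rewrite -[leRHS]mulrA; apply: ler_pM => //; first exact: le_trans (ltW m0) mt.
apply: le_trans (hLg _ _ (lnb _ hs) (lnb _ ht)) _.
rewrite -[leRHS]mulrA ler_pM2l// -mulrBr normrM gtr0_norm// -[leRHS]mulrA ler_pM2l//.
exact: lnlip.
Qed.

End RealFunctions.

(** * Closure of a space of test functions *)

Section L2Limits.
Context {d} {T : measurableType d} {R : realType}.
Variable mu : probability T R.
Implicit Types (f g h G q : T -> R) (s : nat -> T -> R) (C : R).

Local Notation int f := (Rintegral mu setT f).
Local Notation L2 := (L2 mu).
Local Notation intg := (intg mu).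
Local Notation L2cvg := (L2cvg mu).

Lemma sqr_cvg0 (a b : nat -> R) C : (forall n, a n ^+ 2 <= C * b n) ->
  b n @[n --> \oo] --> 0 -> a n @[n --> \oo] --> 0.
Proof.
move=> ab b0; apply/cvgrPdist_le => e e0.
have C0 : 0 < `|C| + 1 by rewrite ltr_wpDl.
move/cvgrPdist_le : b0 => /(_ (e ^+ 2 / (`|C| + 1))).
rewrite divr_gt0 ?exprn_gt0// => /(_ isT); apply: filterS => n.
rewrite !sub0r !normrN => bn.
rewrite -(@ler_pXn2r _ 2)// ?nnegrE ?(ltW e0)// real_normK ?num_real//.
apply: le_trans (ab n) _.
have h : C * b n <= (`|C| + 1) * `|b n|.
  rewrite (le_trans (ler_norm _))// normrM ler_wpM2r// lerDl//.
by apply: le_trans h _; rewrite mulrC -ler_pdivlMr.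
Qed.

Lemma squeeze0 (a b : nat -> R) : (forall n, 0 <= a n <= b n) ->
  b n @[n --> \oo] --> 0 -> a n @[n --> \oo] --> 0.
Proof.
move=> ab /cvgrPdist_le b0; apply/cvgrPdist_le => e e0.
apply: filterS (b0 e e0) => n; have /andP[a0 anb] := ab n.
by rewrite !sub0r !normrN !ger0_norm ?(le_trans a0)//; exact: le_trans.
Qed.

Lemma L2cvgP s f : (forall n, L2 (s n)) -> L2 f ->
  L2cvg s f <-> int (fun x => (s n x - f x) ^+ 2) @[n --> \oo] --> 0.
Proof.
move=> hs hf.
have p0 n : 0 <= int (fun x => (s n x - f x) ^+ 2) by apply: int_ge0 => x; exact: sqr_ge0.
split => [h|/cvgrPdist_le h e e0].
  apply/cvgrPdist_le => e e0; have [K hK] := h e e0; exists K => // n /= Kn.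
  by rewrite sub0r normrN ger0_norm// hK.
by have [K _ hK] := h e e0; exists K => n Kn; have := hK n Kn;
  rewrite /= sub0r normrN ger0_norm.
Qed.

Lemma L2cvg_int s f q : (forall n, L2 (s n)) -> L2 f -> L2 q -> L2cvg s f ->
  int (fun x => s n x * q x) @[n --> \oo] --> int (fun x => f x * q x).
Proof.
move=> hs hf hq /(L2cvgP hs hf) h; apply/subr_cvg0.
apply: sqr_cvg0 h => n; rewrite mulrC.
rewrite -(intB (L2_intgM (hs n) hq) (L2_intgM hf hq)).
rewrite (_ : int _ = int (fun x => (s n x - f x) * q x)); last first.
  by apply: eq_int => x; ring.
exact: L2_cauchy_schwarz (L2B (hs n) hf) hq.
Qed.

Lemma L2cvg_dom s f s' f' C : (forall n, L2 (s n)) -> L2 f ->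
  (forall n, L2 (s' n)) -> L2 f' ->
  (forall n x, `|s' n x - f' x| <= C * `|s n x - f x|) ->
  L2cvg s f -> L2cvg s' f'.
Proof.
move=> hs hf hs' hf' dom /(L2cvgP hs hf) h; apply/(L2cvgP hs' hf').
apply: (@squeeze0 _ (fun n => C ^+ 2 * int (fun x => (s n x - f x) ^+ 2))).
- move=> n; apply/andP; split; first by apply: int_ge0 => x; exact: sqr_ge0.
  have hd := (L2B (hs n) hf).2.
  rewrite -intZ//; apply: int_le; [exact: (L2B (hs' n) hf').2|exact: intgZ|].
  move=> x; rewrite -exprMn -[leLHS]real_normK ?num_real// -[leRHS]real_normK ?num_real//.
  by rewrite lerXn2r ?nnegrE// (le_trans (dom n x))// normrM ler_wpM2r// ler_norm.
- by rewrite -(mulr0 (C ^+ 2)); exact: cvgMl_tmp h.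
Qed.

(** The factors [b n] need not converge. This disposes of remainders such as
    [h'(phi_n) (D phi_n - Dw)]. *)
Lemma L2cvg_mul_bounded s f (b : nat -> T -> R) C :
  (forall n, L2 (s n)) -> L2 f -> (forall n, measurable_fun setT (b n)) ->
  (forall n x, `|b n x| <= C) -> L2cvg s f ->
  L2cvg (fun n x => b n x * (s n x - f x)) (fun=> 0).
Proof.
move=> hs hf mb bC; apply: (L2cvg_dom (C := C)) => //.
- by move=> n; apply: L2_mul_bounded (bC n) _ => //; exact: L2B.
- exact: L2_cst.
- by move=> n x; rewrite subr0 normrM ler_wpM2r.
Qed.

Lemma L2_lipschitz (h : R -> R) C f :  (forall a b, `|h a - h b| <= C * `|a - b|) ->
  L2 f -> L2 (h \o f).
Proof.
move=> hC hf.
have C0 := lipschitz_ge0 hC.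
have ch := lipschitz_continuous hC.
have mh : measurable_fun setT (h \o f).
  by apply: measurableT_comp hf.1; exact: continuous_measurable_fun.
apply: (@L2_le _ _ _ _ _ (fun x => `|h 0| + C * `|f x|)) => //.
  move=> x /=; rewrite [leRHS]ger0_norm ?addr_ge0 ?mulr_ge0//.
  rewrite -(subrK (h 0) (h (f x))) addrC (le_trans (ler_normD _ _))// lerD2l.
  by rewrite (le_trans (hC _ _))// subr0.
apply: L2D; first exact: L2_cst.
apply: L2Z; apply: (L2_le _ _ hf); first exact: measurableT_comp hf.1.
by move=> x; rewrite normr_id.
Qed.

Lemma L2cvg_lipschitz (h : R -> R) C s f : (forall a b, `|h a - h b| <= C * `|a - b|) ->
  (forall n, L2 (s n)) -> L2 f ->
  L2cvg s f -> L2cvg (fun n => h \o s n) (h \o f).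
Proof.
move=> hC hs hf; apply: (L2cvg_dom (C := C)) => //.
- by move=> n; exact: L2_lipschitz (hs n).
- exact: L2_lipschitz hf.
- by move=> n x; exact: hC.
Qed.

(* [G] is split into a bounded part, handled by L^2 convergence, and a tail of
   small integral. *)
Lemma L2cvg_bounded_int s f G C : (forall n, measurable_fun setT (s n)) ->
  measurable_fun setT f -> (forall n x, `|s n x| <= C) -> (forall x, `|f x| <= C) ->
  intg G -> L2cvg s f ->
  int (fun x => s n x * G x) @[n --> \oo] --> int (fun x => f x * G x).
Proof.
move=> ms mf sC fC iG sf.
have hs n : L2 (s n) by exact: L2_bounded (sC n).
have hf : L2 f by exact: L2_bounded fC.
apply/cvgrPdist_le => e e0.
have C0 : 0 <= C by exact: le_trans (normr_ge0 _) (fC point).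
(* Each of the two tails is allotted [e / 4] and the truncated part [e / 2]; [C + 1] avoids a
   division by zero. *)
have C1 : 0 < 4 * (C + 1) by rewrite mulr_gt0// ltr_wpDl.
have [K K0 hK] := intg_tail iG (divr_gt0 e0 C1).
pose b x := if `|G x| <= K then G x else 0.
have mG := intg_measurable iG.
have mb : measurable_fun setT b.
  by apply: measurable_fun_ifT => //; apply: measurable_fun_ler => //; exact: measurableT_comp.
have bK x : `|b x| <= K by rewrite /b; case: ifP => // _; rewrite normr0 ltW.
have hb : L2 b by exact: L2_bounded bK.
have ib := L2_intg hb.
have /cvgrPdist_le/(_ _ (divr_gt0 e0 (ltr0n _ 2))) := L2cvg_int hs hf hb sf.
apply: filterS => n h.
have iGb : intg (fun x => `|G x - b x|) by exact/intg_norm/intgB.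
have tail q : measurable_fun setT q -> (forall x, `|q x| <= C) ->
    `|int (fun x => q x * G x) - int (fun x => q x * b x)| <= e / 4.
  move=> mq qC.
  have i1 := intg_mul_bounded mq qC iG; have i2 := intg_mul_bounded mq qC ib.
  rewrite -intB//; apply: le_trans (int_normr_le (intgB i1 i2)) _.
  apply: le_trans (_ : C * int (fun x => `|G x - b x|) <= _).
    rewrite -intZ//; apply: int_le => [||x]; [exact/intg_norm/intgB|exact: intgZ|].
    by rewrite -mulrBr normrM ler_wpM2r.
  apply: le_trans (_ : (C + 1) * (e / (4 * (C + 1))) <= _).
    apply: ler_pM => //; first by apply: int_ge0.
    by rewrite lerDl.
  rewrite le_eqVlt; apply/orP; left; apply/eqP; field.
  by rewrite gt_eqF// ltr_wpDl.
have h1 := tail _ (ms n) (sC n); have h2 := tail _ mf fC.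
move: h h1 h2; rewrite !ler_norml => /andP[? ?] /andP[? ?] /andP[? ?].
by apply/andP; split; lra.
Qed.

Lemma L2_ae_eq f g : L2 f -> measurable_fun setT g -> {ae mu, forall x, f x = g x} -> L2 g.
Proof.
move=> [mf hf] mg fg; split => //; apply/integrableP; split.
  by apply/measurable_EFinP; exact: measurable_funX.
have /integrableP[_] := hf; apply: le_lt_trans.
rewrite le_eqVlt; apply/orP; left; apply/eqP; apply: ae_eq_integral => //.
- by apply: measurableT_comp => //; apply/measurable_EFinP; exact: measurable_funX.
- by apply: measurableT_comp => //; apply/measurable_EFinP; exact: measurable_funX.
- by apply: filterS fg => x /= ->.
Qed.

End L2Limits.

(** * Formal gradients and the Sobolev space H^1 *)

Section TestSpaces.
Context {d} {T : measurableType d} {R : realType} {I : finType}.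
Variable mu : probability T R.

Local Notation int f := (Rintegral mu setT f).
Local Notation L2 := (L2 mu).
Local Notation intg := (intg mu).

(** [u None] is a function on [T] and [u (Some i)] its [i]-th partial
    derivative. *)
Definition jet := option I -> T -> R.

Implicit Types (u v w phi psi : jet).

Definition cst_jet (c : R) : jet := fun k => if k is None then fun=> c else fun=> 0.

Definition mul_jet phi psi : jet := fun k x =>
  if k is Some i then phi None x * psi (Some i) x + phi (Some i) x * psi None x
  else phi None x * psi None x.

Definition comp_jet (h h' : R -> R) phi : jet := fun k x =>
  if k is Some i then h' (phi None x) * phi (Some i) x else h (phi None x).

(** An algebra of bounded functions with formal gradients, stable under the Leibniz and chain rules.
    Nothing here forces the components to be derivatives; integration by parts is a separate
    hypothesis where it is used. *)
Record test_space (D : jet -> Prop) : Prop := TestSpace {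
  ts_lin : forall a phi psi, D phi -> D psi -> D (a *: phi + psi);
  ts_cst : forall c, D (cst_jet c);
  ts_meas : forall phi, D phi -> forall k, measurable_fun setT (phi k);
  ts_bdd : forall phi, D phi -> forall k, exists M, forall x, `|phi k x| <= M;
  ts_mul : forall phi psi, D phi -> D psi -> D (mul_jet phi psi);
  ts_comp : forall h h' phi, C11 h h' -> D phi -> D (comp_jet h h' phi) }.

Definition jdot u v := \sum_k int (fun x => u k x * v k x).
Definition jL2 u := forall k, L2 (u k).

Lemma int_sqr_le_jdot u k : jL2 u -> int (fun x => u k x ^+ 2) <= jdot u u.
Proof.
move=> hu; rewrite /jdot (bigD1 k)//=; apply: ler_wpDr.
  by apply: sumr_ge0 => j _; apply: int_ge0 => x; rewrite -expr2 sqr_ge0.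
by under [leRHS]eq_int do rewrite -expr2.
Qed.

Lemma jL2_semi_hilbert : semi_hilbert jL2 jdot.
Proof.
split.
- by move=> k; exact: L2_cst.
- by move=> a u v hu hv k; exact: L2_lin.
- by move=> u v _ _; apply: eq_bigr => k _; apply: eq_int => x; rewrite mulrC.
- move=> a u v w hu hv hw; rewrite mulr_sumr -big_split/=; apply: eq_bigr => k _.
  have i1 := L2_intgM (hu k) (hw k); have i2 := L2_intgM (hv k) (hw k).
  rewrite -(intZ _ i1) -(intD (intgZ a i1) i2); apply: eq_int => x.
  by rewrite mulrDl mulrA.
- move=> u hu; apply: sumr_ge0 => k _; apply: int_ge0 => x.
  by rewrite -expr2 sqr_ge0.
move=> s hs cs.
have /choice[l hl] : forall k, exists f, L2 f /\ L2cvg mu (fun n => s n k) f.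
  move=> k; have [e e0|f hf sf] := @L2_complete _ _ _ mu (fun n => s n k) (fun n => hs n k).
    have [K hK] := cs e e0; exists K => m n Km Kn.
    apply: le_trans (hK m n Km Kn).
    apply: (@int_sqr_le_jdot (s m - s n) k) => j.
    exact: (L2B (hs m j) (hs n j)).
  by exists f.
exists (fun k => l k) => [k|e e0]; first exact: (hl k).1.
have e'0 : 0 < e / #|{: option I}|%:R by rewrite divr_gt0// ltr0n card_option.
have /choice[N hN] : forall k, exists K, forall n, (K <= n)%N ->
    int (fun x => (s n k x - l k x) ^+ 2) <= e / #|{: option I}|%:R.
  by move=> k; exact: (hl k).2 e'0.
exists (\max_k N k)%N => n Nn.
apply: le_trans (_ : \sum_(k : option I) e / #|{: option I}|%:R <= _).
  apply: ler_sum => k _; under eq_int do rewrite -expr2.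
  by apply: hN; apply: leq_trans Nn; exact: leq_bigmax.
by rewrite sumr_const -[leLHS]mulr_natr divfK// pnatr_eq0 card_option.
Qed.

Variable D : jet -> Prop.
Hypothesis TD : test_space D.

Lemma ts_jL2 phi : D phi -> jL2 phi.
Proof.
move=> hphi k; have [M hM] := ts_bdd TD hphi k.
exact: L2_bounded (ts_meas TD hphi k) hM.
Qed.

(* Defining [H1] as a closure makes the chain rule a matter of passing to the
   limit, and avoids proving that smooth functions are dense. *)
Definition H1 u := jL2 u /\
  forall e : R, 0 < e -> exists2 phi, D phi & jdot (u - phi) (u - phi) <= e.

Lemma ts_H1 phi : D phi -> H1 phi.
Proof.
move=> hphi; split; first exact: ts_jL2.
move=> e e0; exists phi => //.
rewrite subrr /jdot big1 ?ltW// => k _.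
by apply: etrans (int_cst mu 0); apply: eq_int => x; exact: mulr0.
Qed.

Lemma H1_semi_hilbert : semi_hilbert H1 jdot.
Proof.
have S := jL2_semi_hilbert.
split.
- apply: ts_H1; have -> : (0 : jet) = cst_jet 0 by apply/funext => -[i|]; apply/funext.
  exact: (ts_cst TD).
- move=> a u v [hu au] [hv av]; split; first exact: (sh_lin S).
  move=> e e0.
  have a0 : 0 < 4 * (a ^+ 2 + 1) by rewrite mulr_gt0// ltr_wpDl// sqr_ge0.
  have [p dp ep] := au _ (divr_gt0 e0 a0).
  have [q dq eq] := av _ (divr_gt0 e0 (ltr0n _ 4)).
  exists (a *: p + q); first exact: (ts_lin TD).
  have hup := shB S hu (ts_jL2 dp); have hvq := shB S hv (ts_jL2 dq).
  have -> : a *: u + v - (a *: p + q) = a *: (u - p) - - (v - q).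
    by rewrite opprK scalerBr opprD addrACA.
  have hN : jL2 (- (v - q)) by rewrite -scaleN1r; exact: (shZ S).
  have hZ : jL2 (a *: (u - p)) by exact: (shZ S).
  apply: le_trans (sh_nrmB_le S hZ hN) _.
  rewrite -scaleN1r !(sh_nrmZ S)// sqrrN expr1n mul1r.
  have : a ^+ 2 * jdot (u - p) (u - p) <= e / 4.
    apply: le_trans (ler_wpM2l (sqr_ge0 a) ep) _.
    rewrite mulrA ler_pdivrMr// -subr_ge0.
    have -> : e / 4 * (4 * (a ^+ 2 + 1)) - a ^+ 2 * e = e by field.
    exact: ltW.
  lra.
- by move=> u v [hu _] [hv _]; exact: (sh_sym S).
- by move=> a u v w [hu _] [hv _] [hw _]; exact: (sh_dot S).
- by move=> u [hu _]; exact: (sh_ge0 S).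
move=> s hs cs.
have [//|l hl sl] := sh_complete S _ cs; first by move=> n; have [] := hs n.
exists l => //; split => // e e0.
have [K hK] := sl _ (divr_gt0 e0 (ltr0n _ 4)).
have [hsK /(_ _ (divr_gt0 e0 (ltr0n _ 4)))[p dp ep]] := hs K.
exists p => //; have hp := ts_jL2 dp.
have -> : l - p = (s K - p) - (s K - l) by rewrite opprB [RHS]addrC addrA subrK.
have := sh_nrmB_le S (shB S hsK hp) (shB S hsK hl).
have := hK K (leqnn K); lra.
Qed.

Lemma H1_approx u : H1 u -> exists phi : nat -> jet, (forall n, D (phi n)) /\
  forall k, L2cvg mu (fun n => phi n k) (u k).
Proof.
move=> [hu au].
have /choice[phi hphi] : forall n : nat, exists phi, D phi /\ jdot (u - phi) (u - phi) <= n.+1%:R^-1.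
  by move=> n; have [//|p dp ep] := au n.+1%:R^-1; exists p.
exists phi; split => [n|k]; first exact: (hphi n).1.
have hd n : jL2 (phi n) by exact/ts_jL2/(hphi n).1.
apply/(L2cvgP (fun n => hd n k) (hu k)).
apply: (@squeeze0 _ _ (fun n => n.+1%:R^-1)).
- move=> n; apply/andP; split; first by apply: int_ge0 => x; exact: sqr_ge0.
  apply: le_trans (hphi n).2.
  have huphi : jL2 (u - phi n) by exact: (shB jL2_semi_hilbert).
  apply: le_trans (int_sqr_le_jdot k huphi).
  rewrite le_eqVlt; apply/orP; left; apply/eqP; apply: eq_int => x.
  by rewrite -sqrrN opprB.
- exact: cvg_harmonic.
Qed.

End TestSpaces.

(** * Elliptic problems *)

Lemma big_option (R : nmodType) (I : finType) (F : option I -> R) :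
  \sum_k F k = F None + \sum_i F (Some i).
Proof.
rewrite (bigD1 None)//=; congr (_ + _).
rewrite (reindex_omap Some (fun k => k)) /=; last by case.
by apply: eq_bigl => i; rewrite eqxx.
Qed.

Section Elliptic.
Context {d} {T : measurableType d} {R : realType} {I : finType}.
Variable mu : probability T R.

Local Notation int f := (Rintegral mu setT f).
Local Notation L2 := (L2 mu).
Local Notation intg := (intg mu).
Local Notation jet := (@jet d T R I).
Implicit Types (u v w phi psi : jet) (P Q : I -> T -> R).

Variable D : jet -> Prop.
Hypothesis TD : test_space D.
Local Notation H1 := (H1 mu D).
Local Notation jdot := (jdot mu).

Variables (a : I -> I -> T -> R) (Ma theta : R).
Hypothesis a_meas : forall i j, measurable_fun setT (a i j).
Hypothesis a_bdd : forall i j x, `|a i j x| <= Ma.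
Hypothesis theta_gt0 : 0 < theta.

Definition aform (x : T) (p q : I -> R) := \sum_i \sum_j p i * a i j x * q j.

Hypothesis a_ell : forall x (z : I -> R), theta * (\sum_i z i ^+ 2) <= aform x z z.

Definition grad u (x : T) : I -> R := fun i => u (Some i) x.

Lemma form_lin_l x c (p p' q : I -> R) :
  aform x (fun i => c * p i + p' i) q = c * aform x p q + aform x p' q.
Proof.
rewrite mulr_sumr -big_split; apply: eq_bigr => i _ /=.
by rewrite mulr_sumr -big_split; apply: eq_bigr => j _ /=; ring.
Qed.

Lemma form_lin_r x c (p q q' : I -> R) :
  aform x p (fun i => c * q i + q' i) = c * aform x p q + aform x p q'.
Proof.
rewrite mulr_sumr -big_split; apply: eq_bigr => i _ /=.
by rewrite mulr_sumr -big_split; apply: eq_bigr => j _ /=; ring.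
Qed.

Lemma formZ_l x c (p q : I -> R) : aform x (fun i => c * p i) q = c * aform x p q.
Proof.
rewrite mulr_sumr; apply: eq_bigr => i _.
by rewrite mulr_sumr; apply: eq_bigr => j _; ring.
Qed.

Lemma formZ_r x c (p q : I -> R) : aform x p (fun i => c * q i) = c * aform x p q.
Proof.
rewrite mulr_sumr; apply: eq_bigr => i _.
by rewrite mulr_sumr; apply: eq_bigr => j _; ring.
Qed.

Lemma L2_coef i j f : L2 f -> L2 (fun x => a i j x * f x).
Proof. by move=> hf; apply: L2_mul_bounded (@a_bdd i j) hf. Qed.

Lemma form_term_intg P Q i j : L2 (P i) -> L2 (Q j) ->
  intg (fun x => P i x * a i j x * Q j x).
Proof.
move=> hP hQ; have := L2_intgM hP (L2_coef i j hQ).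
by under eq_fun do rewrite mulrA.
Qed.

Lemma form_intg P Q : (forall i, L2 (P i)) -> (forall i, L2 (Q i)) ->
  intg (fun x => aform x (P^~ x) (Q^~ x)).
Proof.
by move=> hP hQ; apply: intg_sum => i; apply: intg_sum => j; exact: form_term_intg.
Qed.

Lemma int_form P Q : (forall i, L2 (P i)) -> (forall i, L2 (Q i)) ->
  int (fun x => aform x (P^~ x) (Q^~ x)) =
  \sum_i \sum_j int (fun x => P i x * (a i j x * Q j x)).
Proof.
move=> hP hQ; rewrite int_sum => [|i]; last first.
  by apply: intg_sum => j; exact: form_term_intg.
apply: eq_bigr => i _; rewrite int_sum => [|j]; last exact: form_term_intg.
by apply: eq_bigr => j _; apply: eq_int => x; rewrite mulrA.
Qed.

Lemma int_form_cvg (P : nat -> I -> T -> R) P0 Q :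
  (forall n i, L2 (P n i)) -> (forall i, L2 (P0 i)) -> (forall i, L2 (Q i)) ->
  (forall i, L2cvg mu (fun n => P n i) (P0 i)) ->
  int (fun x => aform x ((P n)^~ x) (Q^~ x)) @[n --> \oo] -->
  int (fun x => aform x (P0^~ x) (Q^~ x)).
Proof.
move=> hP hP0 hQ cP; under eq_fun do rewrite int_form//; rewrite int_form//.
apply: cvg_big => [|i _]; first exact: add_continuous.
apply: cvg_big => [|j _]; first exact: add_continuous.
by apply: L2cvg_int (cP i) => //; exact: L2_coef.
Qed.

Variable lam : R.
Hypothesis lam_gt0 : 0 < lam.

(** The gradient of the test function stands to the left of [a], as in the weak formulation; the
    order matters since [a] may fail to be symmetric. The term in [lam] gives coercivity on
    constants. *)
Definition bform w v := int (fun x => aform x (grad v x) (grad w x)) +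
  lam * int (fun x => w None x * v None x).

Lemma H1_L2 u k : H1 u -> L2 (u k). Proof. by case=> + _; apply. Qed.

Lemma bform_lin_l c u v w : H1 u -> H1 v -> H1 w ->
  bform (c *: u + v) w = c * bform u w + bform v w.
Proof.
move=> hu hv hw.
have Lu k := H1_L2 k hu; have Lv k := H1_L2 k hv; have Lw k := H1_L2 k hw.
have i1 := form_intg (fun i => Lw (Some i)) (fun i => Lu (Some i)).
have i2 := form_intg (fun i => Lw (Some i)) (fun i => Lv (Some i)).
have j1 := L2_intgM (Lu None) (Lw None); have j2 := L2_intgM (Lv None) (Lw None).
rewrite /bform.
have -> : int (fun x => aform x (grad w x) (grad (c *: u + v) x)) =
    c * int (fun x => aform x (grad w x) (grad u x)) +
    int (fun x => aform x (grad w x) (grad v x)).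
  rewrite -(intZ _ i1) -(intD (intgZ c i1) i2); apply: eq_int => x.
  exact: form_lin_r.
have -> : int (fun x => (c *: u + v) None x * w None x) =
    c * int (fun x => u None x * w None x) + int (fun x => v None x * w None x).
  rewrite -(intZ _ j1) -(intD (intgZ c j1) j2); apply: eq_int => x.
  by rewrite mulrA -mulrDl.
ring.
Qed.

Lemma bform_lin_r c u v w : H1 u -> H1 v -> H1 w ->
  bform w (c *: u + v) = c * bform w u + bform w v.
Proof.
move=> hu hv hw.
have Lu k := H1_L2 k hu; have Lv k := H1_L2 k hv; have Lw k := H1_L2 k hw.
have i1 := form_intg (fun i => Lu (Some i)) (fun i => Lw (Some i)).
have i2 := form_intg (fun i => Lv (Some i)) (fun i => Lw (Some i)).
have j1 := L2_intgM (Lw None) (Lu None); have j2 := L2_intgM (Lw None) (Lv None).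
rewrite /bform.
have -> : int (fun x => aform x (grad (c *: u + v) x) (grad w x)) =
    c * int (fun x => aform x (grad u x) (grad w x)) +
    int (fun x => aform x (grad v x) (grad w x)).
  rewrite -(intZ _ i1) -(intD (intgZ c i1) i2); apply: eq_int => x.
  exact: form_lin_l.
have -> : int (fun x => w None x * (c *: u + v) None x) =
    c * int (fun x => w None x * u None x) + int (fun x => w None x * v None x).
  rewrite -(intZ _ j1) -(intD (intgZ c j1) j2); apply: eq_int => x.
  by rewrite [RHS]addrC mulrCA -mulrDr addrC.
ring.
Qed.

(** Continuity comes from the bound on the entries, which also controls the antisymmetric part;
    coercivity sees only the quadratic form and [lam]. *)
Lemma bform_coercive : coercive_form H1 jdot bform.
Proof.
have S := @jL2_semi_hilbert _ T R I mu.
split.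
- by move=> *; exact: bform_lin_l.
- by move=> *; exact: bform_lin_r.
- pose C := \sum_(i : I) \sum_(j : I) `|Ma| + lam; exists (C ^+ 2) => w v hw hv.
  have Lw k := H1_L2 k hw; have Lv k := H1_L2 k hv.
  have nw : 0 <= jdot w w by exact: (sh_ge0 S).
  have nv : 0 <= jdot v v by exact: (sh_ge0 S).
  pose r := Num.sqrt (jdot w w * jdot v v).
  have r2 : r ^+ 2 = jdot w w * jdot v v by rewrite sqr_sqrtr// mulr_ge0.
  have r0 : 0 <= r by exact: sqrtr_ge0.
  have cs f g M : L2 f -> L2 g -> 0 <= M ->
      int (fun x => f x ^+ 2) <= jdot v v ->
      int (fun x => g x ^+ 2) <= M ^+ 2 * jdot w w ->
      `|int (fun x => f x * g x)| <= M * r.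
    move=> hf hg M0 h1 h2.
    rewrite -(@ler_pXn2r _ 2)// ?nnegrE ?mulr_ge0// real_normK ?num_real//.
    apply: le_trans (L2_cauchy_schwarz hf hg) _.
    rewrite exprMn r2 mulrA [leRHS]mulrC.
    by apply: ler_pM => //; apply: int_ge0 => x; exact: sqr_ge0.
  have hB : `|bform w v| <= C * r.
    rewrite /bform /C mulrDl; apply: le_trans (ler_normD _ _) _; apply: lerD.
      rewrite int_form//; try by move=> i; apply: H1_L2.
      rewrite mulr_suml; apply: le_trans (ler_norm_sum _ _ _) _; apply: ler_sum => i _.
      rewrite mulr_suml; apply: le_trans (ler_norm_sum _ _ _) _; apply: ler_sum => j _.
      apply: cs => //; first exact: L2_coef.
        by apply: int_sqr_le_jdot; case: hv.
      apply: le_trans (_ : `|Ma| ^+ 2 * int (fun x => w (Some j) x ^+ 2) <= _); last first.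
        by rewrite ler_wpM2l ?sqr_ge0//; apply: int_sqr_le_jdot; case: hw.
      have hj := (Lw (Some j)).2.
      rewrite -(intZ _ hj); apply: int_le; [exact: (L2_coef i j (Lw (Some j))).2|exact: intgZ|].
      move=> x; rewrite /grad exprMn ler_wpM2r ?sqr_ge0// -[leLHS]real_normK ?num_real//.
      by rewrite lerXn2r ?nnegrE// (le_trans (a_bdd i j x))// ler_norm.
    rewrite normrM gtr0_norm// ler_pM2l// -[leRHS]mul1r.
    under eq_int do rewrite mulrC.
    apply: cs => //; first by apply: int_sqr_le_jdot; case: hv.
    by rewrite expr1n mul1r; apply: int_sqr_le_jdot; case: hw.
  rewrite -mulrA -r2 -exprMn -[leLHS]real_normK ?num_real//.
  by rewrite lerXn2r ?nnegrE// (le_trans _ hB).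
exists (Num.min theta lam); first by rewrite lt_min theta_gt0.
move=> w hw; have Lw k := H1_L2 k hw.
have h1 : theta * \sum_i int (fun x => w (Some i) x ^+ 2) <=
    int (fun x => aform x (grad w x) (grad w x)).
  have hs i := (Lw (Some i)).2.
  rewrite -(int_sum hs) -(intZ _ (intg_sum hs)).
  apply: int_le; [exact/intgZ/intg_sum|exact: form_intg|].
  by move=> x; exact: a_ell.
rewrite /jdot big_option /bform mulrDr addrC.
have n0 k : 0 <= int (fun x => w k x ^+ 2) by apply: int_ge0 => x; exact: sqr_ge0.
apply: lerD.
  apply: le_trans h1.
  under eq_bigr do under eq_int do rewrite -expr2.
  by rewrite ler_wpM2r ?sumr_ge0// ge_min lexx.
under eq_int do rewrite -expr2.
by rewrite ler_wpM2r// ge_min lexx orbT.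
Qed.

Definition weak_sol w f := forall v, H1 v -> bform w v = int (fun x => f x * v None x).

Lemma weak_sol_exists f : L2 f -> exists2 w, H1 w & weak_sol w f.
Proof.
move=> hf; apply: (lax_milgram (H1_semi_hilbert mu TD)); first exact: bform_coercive.
split=> [c u v hu hv|].
  have i1 := L2_intgM hf (H1_L2 None hu); have i2 := L2_intgM hf (H1_L2 None hv).
  rewrite -(intZ _ i1) -(intD (intgZ c i1) i2); apply: eq_int => x.
  by rewrite [in LHS]mulrDr mulrCA.
exists (int (fun x => f x ^+ 2)) => u hu.
apply: le_trans (L2_cauchy_schwarz hf (H1_L2 None hu)) _.
rewrite ler_wpM2l//; first by apply: int_ge0 => x; exact: sqr_ge0.
by apply: int_sqr_le_jdot; case: hu.
Qed.

Lemma cst_H1 c : H1 (cst_jet c).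
Proof. by apply: ts_H1 => //; exact: (ts_cst TD). Qed.

(** Subtracting these solutions moves the comparison principle from one level to another. *)
Lemma weak_sol_cst c : weak_sol (cst_jet c) (fun=> lam * c).
Proof.
move=> v hv; rewrite /bform (_ : int _ = 0) ?add0r; last first.
  apply: etrans (int_cst mu 0); apply: eq_int => x.
  by apply: big1 => i _; apply: big1 => j _; rewrite /grad /= mulr0.
rewrite -intZ; last exact: (L2_intgM (H1_L2 None (cst_H1 c)) (H1_L2 None hv)).
by apply: eq_int => x; rewrite mulrA.
Qed.

Lemma weak_solB w w' f f' : H1 w -> H1 w' -> L2 f -> L2 f' ->
  weak_sol w f -> weak_sol w' f' -> weak_sol (w - w') (fun x => f x - f' x).
Proof.
move=> hw hw' hf hf' sw sw' v hv.
rewrite addrC -scaleN1r bform_lin_l// sw// sw'// mulN1r addrC.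
rewrite -intB; [|exact: (L2_intgM hf (H1_L2 None hv))|exact: (L2_intgM hf' (H1_L2 None hv))].
by apply: eq_int => x; rewrite mulrBl.
Qed.

End Elliptic.

(** * Comparison principle and monotone iteration *)

Section MonotoneIteration.
Context {d} {T : measurableType d} {R : realType} {I : finType}.
Variable mu : probability T R.

Local Notation int f := (Rintegral mu setT f).
Local Notation L2 := (L2 mu).
Local Notation intg := (intg mu).
Local Notation jet := (@jet d T R I).
Implicit Types (u v w phi psi : jet) (P Q : I -> T -> R) (f : T -> R).

Variable D : jet -> Prop.
Hypothesis TD : test_space D.
Local Notation H1 := (H1 mu D).
Local Notation jdot := (jdot mu).

Variables (a : I -> I -> T -> R) (Ma theta lam : R).
Hypothesis a_meas : forall i j, measurable_fun setT (a i j).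
Hypothesis a_bdd : forall i j x, `|a i j x| <= Ma.
Hypothesis theta_gt0 : 0 < theta.
Hypothesis a_ell : forall x (z : I -> R), theta * (\sum_i z i ^+ 2) <= aform a x z z.
Hypothesis lam_gt0 : 0 < lam.
Local Notation bform := (bform mu a lam).
Local Notation weak_sol := (weak_sol mu D a lam).

Lemma C11_measurable (h h' : R -> R) : C11 h h' -> measurable_fun setT h.
Proof. by move=> /C11_continuous; exact: continuous_measurable_fun. Qed.

Lemma C11_measurable_der (h h' : R -> R) : C11 h h' -> measurable_fun setT h'.
Proof. by move=> /C11_continuous_der; exact: continuous_measurable_fun. Qed.

Lemma C11_L2 (h h' : R -> R) f : C11 h h' -> L2 f -> L2 (h \o f).
Proof. by move=> /C11_lipschitz[C hC]; exact: L2_lipschitz hC. Qed.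

Lemma C11_L2cvg (h h' : R -> R) s f : C11 h h' -> (forall n, L2 (s n)) -> L2 f ->
  L2cvg mu s f -> L2cvg mu (fun n => h \o s n) (h \o f).
Proof. by move=> /C11_lipschitz[C hC]; exact: L2cvg_lipschitz hC. Qed.

(* Test the equation with the truncation [pospart] of a sequence approximating
   [w]; only the sign of the derivative of [pospart] matters in the limit. *)
Lemma weak_comparison1 w f : H1 w -> L2 f -> weak_sol w f ->
  {ae mu, forall x, f x <= lam} -> {ae mu, forall x, w None x <= 1}.
Proof.
move=> hw hf sw f_le.
have Lw k := H1_L2 k hw.
have [phi [dphi cphi]] := H1_approx TD hw.
have Lphi n k : L2 (phi n k) := ts_jL2 mu TD (dphi n) k.
pose h := @pospart R; pose h' (s : R) := 1 - (Num.max s 1)^-1.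
have Ch : C11 h h' := C11_pospart.
pose v n := comp_jet h h' (phi n).
have dv n : D (v n) := ts_comp TD Ch (dphi n).
have h'_ge0 s : 0 <= h' s by exact: pospart_der_ge0.
have h'_le1 s : `|h' s| <= 1.
  rewrite ger0_norm// /h'; have := inv_max_bounds s (@ltr01 R).
  by move=> /andP[? _]; lra.
have mh' n : measurable_fun setT (h' \o phi n None).
  by apply: measurableT_comp (Lphi n None).1; exact: C11_measurable_der Ch.
(* [h'(phi_n) D phi_n] is split as [P n + h'(phi_n) Dw]. The first part vanishes in the limit; the
   second contributes [h'(phi_n) Dw A Dw^T], which is nonnegative. *)
pose P n i x := h' (phi n None x) * (phi n (Some i) x - w (Some i) x).
have LP n i : L2 (P n i).
  by apply: (L2_mul_bounded (mh' n) (fun x => h'_le1 _)); exact: (L2B (Lphi n _) (Lw _)).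
have cP i : L2cvg mu (fun n => P n i) (fun=> 0).
  exact: (L2cvg_mul_bounded (fun n => Lphi n (Some i)) (Lw (Some i)) mh'
    (fun n x => h'_le1 (phi n None x)) (cphi (Some i))).
have c1 := int_form_cvg a_meas a_bdd LP (fun i => L2_cst mu 0) (fun i => Lw (Some i)) cP.
rewrite [X in _ --> X](_ : _ = 0) in c1; last first.
  apply: etrans (int_cst mu 0); apply: eq_int => x.
  by apply: big1 => i _; apply: big1 => j _; rewrite !mul0r.
have chw := C11_L2cvg Ch (fun n => Lphi n None) (Lw None) (cphi None).
have Lh := C11_L2 Ch (Lw None).
have Lhn n : L2 (h \o phi n None) := C11_L2 Ch (Lphi n None).
have c2 := L2cvg_int Lhn Lh hf chw.
have c3 : lam * int (fun x => (h \o phi n None) x * w None x) @[n --> \oo] -->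
    lam * int (fun x => (h \o w None) x * w None x).
  by apply: cvgMl_tmp; exact: L2cvg_int.
have iww := form_intg a_meas a_bdd (fun i => Lw (Some i)) (fun i => Lw (Some i)).
(* Limit of the tested equation, the nonnegative elliptic term being dropped: [h(w) (f - lam w)] has
   a nonnegative integral. *)
have key : 0 <= int (fun x => h (w None x) * f x) - lam * int (fun x => h (w None x) * w None x).
  apply: (ler_cvg_to c1 (cvgB c2 c3)); apply: nearW => n.
  rewrite -[leRHS]/(int (fun x => h (phi n None x) * f x) -
    lam * int (fun x => h (phi n None x) * w None x)).
  have E := sw _ (ts_H1 mu TD (dv n)).
  have -> : int (fun x => h (phi n None x) * f x) -
      lam * int (fun x => h (phi n None x) * w None x) =
      int (fun x => aform a x (grad (v n) x) (grad w x)).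
    have -> : int (fun x => h (phi n None x) * f x) = bform w (v n).
      by rewrite E; apply: eq_int => x; rewrite mulrC.
    have -> : int (fun x => h (phi n None x) * w None x) = int (fun x => w None x * v n None x).
      by apply: eq_int => x; rewrite mulrC.
    by rewrite /bform addrK.
  have -> : int (fun x => aform a x (grad (v n) x) (grad w x)) =
      int (fun x => aform a x ((P n)^~ x) (grad w x)) +
      int (fun x => h' (phi n None x) * aform a x (grad w x) (grad w x)).
    rewrite -intD; first last.
    - exact: (intg_mul_bounded (mh' n) (fun x => h'_le1 _)).
    - exact: (form_intg a_meas a_bdd (LP n) (fun i => Lw (Some i))).
    apply: eq_int => x; rewrite -formZ_l -[in RHS](mul1r (aform a x ((P n)^~ x) _)).
    rewrite -form_lin_l; congr aform; apply/funext => i.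
    by rewrite /P /grad/= mul1r -mulrDr subrK.
  rewrite lerDl; apply: int_ge0 => x; rewrite mulr_ge0//.
  apply: le_trans (a_ell x (grad w x)).
  by rewrite mulr_ge0 ?(ltW theta_gt0)//; apply: sumr_ge0 => i _; exact: sqr_ge0.
(* Since [f <= lam] a.e., [key] bounds the integral of the nonnegative [q] by 0. Hence [q] vanishes
   a.e., and [h(w) = 0] means [w <= 1]. *)
pose q x := lam * ((w None x - 1) * h (w None x)).
have q0 x : 0 <= q x.
  rewrite /q pmulr_rge0//; have [w1|w1] := leP (w None x) 1.
    by rewrite /h pospart_le1// mulr0.
  by rewrite mulr_ge0 ?pospart_ge0// subr_ge0 ltW.
have i1 := L2_intgM Lh hf; have i2 := L2_intgM Lh (Lw None); have i3 := L2_intg Lh.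
have iq : intg q.
  have := intgZ lam (intgB i2 i3); congr intg; apply/funext => x; rewrite /q /=; ring.
have int_q : int q <= 0.
  have -> : int q = lam * int (fun x => h (w None x) * w None x) - lam * int (h \o w None).
    rewrite -mulrBr -intB// -intZ; last exact: intgB.
    by apply: eq_int => x; rewrite /q /=; ring.
  have : int (fun x => h (w None x) * f x) <= lam * int (h \o w None).
    rewrite -intZ//; apply: ae_int_le => //; first exact: intgZ.
    by apply: filterS f_le => x fx /=; rewrite mulrC ler_wpM2r// pospart_ge0.
  lra.
apply: filterS (ae_int_eq0 iq q0 int_q) => x /eqP; rewrite /q mulf_eq0 gt_eqF//=.
rewrite mulf_eq0 => /orP[|].
  by rewrite subr_eq0 => /eqP ->.
rewrite leNgt => /eqP hx; apply/negP => /pospart_gt1.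
by rewrite -/h hx ltxx.
Qed.

(** Subtracting the constant [c - 1] brings the level to 1, where [pospart] starts to be
    positive. *)
Lemma weak_comparison w f c : H1 w -> L2 f -> weak_sol w f ->
  {ae mu, forall x, f x <= lam * c} -> {ae mu, forall x, w None x <= c}.
Proof.
move=> hw hf sw f_le.
have hc := cst_H1 mu TD (c - 1).
have := @weak_comparison1 (w - cst_jet (c - 1)) (fun x => f x - lam * (c - 1)).
have hL := L2_cst mu (lam * (c - 1)).
move=> /(_ (shB (H1_semi_hilbert mu TD) hw hc) (L2B hf hL)).
move=> /(_ (weak_solB a_meas a_bdd hw hc hf hL sw (weak_sol_cst TD a lam _))).
have h1 : {ae mu, forall x, f x - lam * (c - 1) <= lam}.
  by apply: filterS f_le => x; lra.
move=> /(_ h1); apply: filterS => x.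
by rewrite -[(_ - _) None x]/(w None x - (c - 1)); lra.
Qed.

Lemma weak_comparison_ge w f c : H1 w -> L2 f -> weak_sol w f ->
  {ae mu, forall x, lam * c <= f x} -> {ae mu, forall x, c <= w None x}.
Proof.
move=> hw hf sw f_ge.
have hc := cst_H1 mu TD c.
have hL := L2_cst mu (lam * c).
have := @weak_comparison (cst_jet c - w) (fun x => lam * c - f x) 0.
move=> /(_ (shB (H1_semi_hilbert mu TD) hc hw) (L2B hL hf)).
move=> /(_ (weak_solB a_meas a_bdd hc hw hL hf (weak_sol_cst TD a lam _) sw)).
have h1 : {ae mu, forall x, lam * c - f x <= lam * 0}.
  by apply: filterS f_ge => x; rewrite mulr0 subr_le0.
move=> /(_ h1); apply: filterS => x.
by rewrite -[(_ - _) None x]/(c - w None x) subr_le0.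
Qed.

Variables (Phi : T -> R -> R) (m M L : R).
Hypothesis Phi_meas : forall f, measurable_fun setT f -> measurable_fun setT (fun x => Phi x (f x)).
Hypothesis Phi_mono : forall x s t, s <= t -> Phi x s <= Phi x t.
Hypothesis Phi_lip : forall x s t, `|Phi x s - Phi x t| <= L * `|s - t|.
Hypothesis Phi_bounds : forall x s, lam * m <= Phi x s <= lam * M.

Let Phi_L2 f : measurable_fun setT f -> L2 (fun x => Phi x (f x)).
Proof.
move=> mf; apply: (@L2_bounded _ _ _ _ _ (`|lam * m| + `|lam * M|)); first exact: Phi_meas.
move=> x; have /andP[p1 p2] := Phi_bounds x (f x).
have := ler_norm (lam * M); have := ler_norm (- (lam * m)); rewrite normrN.
have := normr_ge0 (lam * m); have := normr_ge0 (lam * M).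
by rewrite ler_norml => *; apply/andP; split; lra.
Qed.

(* Monotone iteration from the subsolution [m]; the monotone bounded sequence
   is Cauchy in L^2 because its integrals converge, hence in H^1 by the energy
   estimate. *)
Lemma semilinear_exists : exists w, [/\ H1 w,
  {ae mu, forall x, m <= w None x <= M} &
  weak_sol w (fun x => Phi x (w None x))].
Proof.
have SH := H1_semi_hilbert mu TD.
have CF := bform_coercive mu D a_meas a_bdd theta_gt0 a_ell lam_gt0.
(* Outside H^1 the value is arbitrary; it only makes [sol] a total map that can be iterated. *)
have /choice[sol hsol] : forall w, exists u, H1 w -> H1 u /\ weak_sol u (fun x => Phi x (w None x)).
  move=> w; have [hw|hw] := pselect (H1 w); last by exists w.
  have [u hu su] := weak_sol_exists TD a_meas a_bdd theta_gt0 a_ell lam_gt0 (Phi_L2 (H1_L2 None hw).1).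
  by exists u.
have [s [s0 hs ss]] : exists s : nat -> jet, [/\ s 0 = cst_jet m, forall n, H1 (s n) &
    forall n, weak_sol (s n.+1) (fun x => Phi x (s n None x))].
  have hs n : H1 (iter n sol (cst_jet m)).
    by elim: n => [|n /hsol[]//]; exact: cst_H1.
  by exists (fun n => iter n sol (cst_jet m)); split => // n; exact: (hsol _ (hs n)).2.
have ms n := (H1_L2 None (hs n)).1.
(* The right-hand side lies between [lam * m] and [lam * M], those of the constant solutions; the
   bounds at one step do not rely on the previous ones. *)
have s_le n : {ae mu, forall x, s n.+1 None x <= M}.
  apply: (weak_comparison (hs n.+1) (Phi_L2 (ms n)) (ss n)).
  by apply: aeW => x; have /andP[] := Phi_bounds x (s n None x).
have s_ge n : {ae mu, forall x, m <= s n.+1 None x}.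
  apply: (weak_comparison_ge (hs n.+1) (Phi_L2 (ms n)) (ss n)).
  by apply: aeW => x; have /andP[] := Phi_bounds x (s n None x).
have s_nd1 n : {ae mu, forall x, s n None x <= s n.+1 None x}.
  elim: n => [|n IH]; first by rewrite s0; exact: s_ge.
  have := weak_comparison (c := 0) (shB SH (hs n.+1) (hs n.+2))
    (L2B (Phi_L2 (ms n)) (Phi_L2 (ms n.+1)))
    (weak_solB a_meas a_bdd (hs n.+1) (hs n.+2) (Phi_L2 (ms n)) (Phi_L2 (ms n.+1)) (ss n) (ss n.+1)).
  have h1 : {ae mu, forall x, Phi x (s n None x) - Phi x (s n.+1 None x) <= lam * 0}.
    by apply: filterS IH => x h; rewrite mulr0 subr_le0; exact: Phi_mono.
  move=> /(_ h1); apply: filterS => x.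
  by rewrite -[(_ - _) None x]/(s n.+1 None x - s n.+2 None x) subr_le0.
have s_nd j k : (j <= k)%N -> {ae mu, forall x, s j None x <= s k None x}.
  elim: k => [|k IH]; first by rewrite leqn0 => /eqP ->; exact: aeW.
  rewrite leq_eqVlt => /predU1P[->|]; first exact: aeW.
  rewrite ltnS => /IH h; apply: filterS2 h (s_nd1 k) => x; exact: le_trans.
have Ls n := H1_L2 None (hs n).
pose A n := int (s n.+1 None).
have A_nd : {homo A : j k / (j <= k)%N >-> j <= k}.
  move=> j k jk; apply: ae_int_le; [exact: L2_intg|exact: L2_intg|exact: s_nd].
have A_cvg : cvgn A.
  apply: nondecreasing_is_cvgn => //; exists M => _ [n _ <-].
  by apply: ae_int_bound (s_le n); exact: L2_intg.
(* For [j <= k] and iterates in [[m, M]], [(s_k - s_j)^2 <= (M - m) (s_k - s_j)], so convergence of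
   the integrals is enough. *)
have L2c : L2cauchy mu (fun n => s n.+1 None).
  move=> e e0.
  have M0 : 0 < `|M - m| + 1 by rewrite ltr_wpDl.
  have e1 : 0 < e / (`|M - m| + 1) / 2 by rewrite !divr_gt0.
  move/cvg_ex : A_cvg => [l /cvgrPdist_le/(_ _ e1)[K _ hK]].
  exists K; suff le j k : (K <= j)%N -> (K <= k)%N -> (j <= k)%N ->
      int (fun x => (s k.+1 None x - s j.+1 None x) ^+ 2) <= e.
    move=> j k Kj Kk; have [jk|/ltnW kj] := leqP j k; last exact: le.
    apply: le_trans (le j k Kj Kk jk); rewrite le_eqVlt; apply/orP; left; apply/eqP.
    by apply: eq_int => x; rewrite -sqrrN opprB.
  move=> Kj Kk jk.
  have iB := L2_intg (L2B (Ls k.+1) (Ls j.+1)).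
  have h1 : int (fun x => (s k.+1 None x - s j.+1 None x) ^+ 2) <=
      `|M - m| * (A k - A j).
    rewrite -intB; [|exact: L2_intg|exact: L2_intg].
    rewrite -intZ//; apply: ae_int_le; [exact: (L2B (Ls _) (Ls _)).2|exact: intgZ|].
    apply: filterS3 (s_nd j.+1 k.+1 jk) (s_le k) (s_ge j) => x x1 x2 x3.
    rewrite expr2 ler_wpM2r ?subr_ge0//.
    by apply: le_trans (ler_norm _); lra.
  apply: le_trans h1 _.
  have h2 : A k - A j <= e / (`|M - m| + 1).
    have := hK j Kj; have := hK k Kk; rewrite /= !ler_norml => /andP[? ?] /andP[? ?].
    lra.
  have h3 : 0 <= A k - A j by rewrite subr_ge0; exact: A_nd.
  apply: le_trans (_ : (`|M - m| + 1) * (e / (`|M - m| + 1)) <= _).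
    by apply: ler_pM => //; rewrite lerDl.
  by rewrite mulrC divfK// gt_eqF.
have dPhi f g : L2 f -> L2 g ->
    int (fun x => (Phi x (f x) - Phi x (g x)) ^+ 2) <=
    L ^+ 2 * int (fun x => (f x - g x) ^+ 2).
  move=> hf hg; have hfg := (L2B hf hg).2.
  rewrite -intZ//; apply: int_le; [exact: (L2B (Phi_L2 hf.1) (Phi_L2 hg.1)).2|exact: intgZ|].
  move=> x; rewrite -exprMn -[leLHS]real_normK ?num_real// -[leRHS]real_normK ?num_real//.
  by rewrite lerXn2r ?nnegrE// (le_trans (Phi_lip x _ _))// normrM ler_wpM2r// ler_norm.
have [c c0 Bc] := cf_coercive CF.
(* With [z] a difference of iterates, [c |z|^2 <= bform z z], and the equation turns [bform z z]
   into the pairing of [z] with a difference of [Phi], which is Lipschitz in the preceding iterates.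
   Starting at [n.+2] puts these under [L2c]. *)
have Hc : cauchy_for (fun x => jdot x x) (fun n => s n.+2).
  move=> e e0.
  have L0 : 0 < L ^+ 2 + 1 by rewrite ltr_wpDl// sqr_ge0.
  have e1 : 0 < c ^+ 2 * e / (L ^+ 2 + 1) by rewrite divr_gt0// mulr_gt0// exprn_gt0.
  have [K hK] := L2c _ e1; exists K => j k Kj Kk.
  have hz := shB SH (hs j.+2) (hs k.+2).
  pose z := s j.+2 - s k.+2; rewrite -/z in hz *.
  have L1 := Phi_L2 (ms j.+1); have L2' := Phi_L2 (ms k.+1).
  have E := weak_solB a_meas a_bdd (hs j.+2) (hs k.+2) L1 L2' (ss j.+1) (ss k.+1) hz.
  have CS := L2_cauchy_schwarz (L2B L1 L2') (H1_L2 None hz).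
  rewrite -E in CS.
  have h1 := dPhi _ _ (Ls j.+1) (Ls k.+1); have h2 := hK j k Kj Kk.
  have h3 : int (fun x => z None x ^+ 2) <= jdot z z by apply: int_sqr_le_jdot; case: hz.
  have n0 := sh_ge0 SH hz.
  have h4 := Bc _ hz.
  have h5 : (c * jdot z z) ^+ 2 <= L ^+ 2 * (c ^+ 2 * e / (L ^+ 2 + 1)) * jdot z z.
    apply: le_trans (_ : bform z z ^+ 2 <= _).
      by rewrite lerXn2r ?nnegrE ?mulr_ge0 ?(ltW c0)// (le_trans _ h4)// mulr_ge0// ltW.
    apply: le_trans CS _; apply: ler_pM => //.
    - by apply: int_ge0 => x; exact: sqr_ge0.
    - by apply: int_ge0 => x; exact: sqr_ge0.
    - by apply: le_trans h1 _; rewrite ler_wpM2l// sqr_ge0.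
  have h6 : L ^+ 2 * (c ^+ 2 * e / (L ^+ 2 + 1)) <= c ^+ 2 * e.
    rewrite mulrCA ler_piMr//; first by rewrite ltW// mulr_gt0// exprn_gt0.
    by rewrite ler_pdivrMr// mul1r lerDl.
  have [->|z_neq] := eqVneq (jdot z z) 0; first exact: ltW.
  have z0 : 0 < jdot z z by rewrite lt_def z_neq.
  have c2 : 0 < c ^+ 2 by rewrite exprn_gt0.
  rewrite -(ler_pM2l c2) -(ler_pM2r z0).
  have -> : c ^+ 2 * jdot z z * jdot z z = (c * jdot z z) ^+ 2 by ring.
  by apply: le_trans h5 _; rewrite ler_wpM2r.
have [n|w hw sw] := sh_complete SH _ Hc; first exact: hs.
have mw := (H1_L2 None hw).1.
(* One index beyond the sequence [s n.+2]: the equation for [s n.+3] has [s n.+2] in its right-hand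
   side. *)
have nrm0 : jdot (s n.+3 - w) (s n.+3 - w) @[n --> \oo] --> 0.
  apply/cvgrPdist_le => e e0; have [K hK] := sw e e0; exists K => // n /= Kn.
  by rewrite sub0r normrN ger0_norm ?(sh_ge0 SH)//; [exact: (hK n.+1 (leqW Kn))|exact: (shB SH)].
have sL2 : L2cvg mu (fun n => s n.+2 None) (w None).
  move=> e e0; have [K hK] := sw e e0; exists K => n Kn.
  apply: le_trans (hK n Kn); have hz := shB SH (hs n.+2) hw.
  by apply: (int_sqr_le_jdot None); case: hz.
have wsol : weak_sol w (fun x => Phi x (w None x)).
  move=> v hv; have Lv := H1_L2 None hv.
  have c1 : bform (s n.+3) v @[n --> \oo] --> bform w v.
    apply/subr_cvg0; have [C hC] := cf_bound CF.
    apply: (@sqr_cvg0 _ _ _ (C * jdot v v)) nrm0 => n.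
    rewrite (_ : _ - _ = bform (s n.+3 - w) v); last first.
      rewrite [s _ - w]addrC -scaleN1r (cf_linl CF)//; ring.
    by apply: le_trans (hC _ _ (shB SH (hs _) hw) hv) _; rewrite mulrAC.
  have c2 : int (fun x => Phi x (s n.+2 None x) * v None x) @[n --> \oo] -->
      int (fun x => Phi x (w None x) * v None x).
    apply: (@L2cvg_int _ _ _ _ (fun n x => Phi x (s n.+2 None x)) (fun x => Phi x (w None x))) => //.
    - by move=> n; exact: (Phi_L2 (ms n.+2)).
    - exact: (Phi_L2 mw).
    - exact: (L2cvg_dom (fun n => Ls n.+2) (H1_L2 None hw) (fun n => Phi_L2 (ms n.+2))
        (Phi_L2 mw) (fun n x => Phi_lip x _ _) sL2).
  have E : (fun n => bform (s n.+3) v) = (fun n => int (fun x => Phi x (s n.+2 None x) * v None x)).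
    by apply/funext => n; exact: ss.
  by rewrite E in c1; exact: (cvg_unique _ c1 c2).
exists w; split => //.
(* The bounds on the limit come from comparison applied to its own equation rather than from those
   on the iterates. *)
have h1 : {ae mu, forall x, w None x <= M}.
  apply: (weak_comparison hw (Phi_L2 mw) wsol).
  by apply: aeW => x; have /andP[] := Phi_bounds x (w None x).
have h2 : {ae mu, forall x, m <= w None x}.
  apply: (weak_comparison_ge hw (Phi_L2 mw) wsol).
  by apply: aeW => x; have /andP[] := Phi_bounds x (w None x).
by apply: filterS2 h1 h2 => x -> ->.
Qed.

End MonotoneIteration.

Lemma eq_cvg_limit {R : realType} (u v : nat -> R) (a b : R) : u @ \oo --> a -> v @ \oo --> b ->
  (forall n, u n = v n) -> a = b.
Proof. by move=> ua vb /funext uv; rewrite uv in ua; exact: cvg_unique ua vb. Qed.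

(** * Chain rules and test functions of the form [v h(w)] *)

Section ChainRule.
Context {d} {T : measurableType d} {R : realType} {I : finType}.
Variable mu : probability T R.

Local Notation int f := (Rintegral mu setT f).
Local Notation L2 := (L2 mu).
Local Notation intg := (intg mu).
Local Notation jet := (@jet d T R I).
Implicit Types (u v w phi psi : jet) (P Q : I -> T -> R) (f : T -> R).

Variable D : jet -> Prop.
Hypothesis TD : test_space D.
Local Notation H1 := (H1 mu D).

Variables (h h' : R -> R).
Hypothesis Ch : C11 h h'.

Section Approximation.
Variables (w : jet) (phi : nat -> jet).
Hypothesis hw : H1 w.
Hypothesis dphi : forall n, D (phi n).
Hypothesis cphi : forall k, L2cvg mu (fun n => phi n k) (w k).

Let Lw k : L2 (w k). Proof. exact: (H1_L2 k hw). Qed.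
Let Lphi n k : L2 (phi n k). Proof. exact: (ts_jL2 mu TD (dphi n)). Qed.
Let mh' n : measurable_fun setT (h' \o phi n None).
Proof. exact: (measurableT_comp (C11_measurable_der Ch) (Lphi n None).1). Qed.
Let mh'w : measurable_fun setT (h' \o w None).
Proof. exact: (measurableT_comp (C11_measurable_der Ch) (Lw None).1). Qed.

(** [G] is merely integrable, for instance a quadratic expression in [Dw]; the boundedness of [h']
    compensates for this. *)
Lemma der_cvg G : intg G ->
  int (fun x => h' (phi n None x) * G x) @[n --> \oo] --> int (fun x => h' (w None x) * G x).
Proof.
move=> iG; have [_ [C hC] [K hK]] := Ch.
exact: (L2cvg_bounded_int mh' mh'w (fun n x => hC (phi n None x)) (fun x => hC (w None x)) iG
  (L2cvg_lipschitz hK (fun n => Lphi n None) (Lw None) (cphi None))).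
Qed.

Lemma der_remainder_L2 n i : L2 (fun x => h' (phi n None x) * (phi n (Some i) x - w (Some i) x)).
Proof.
have [_ [C hC] _] := Ch.
exact: (L2_mul_bounded (mh' n) (fun x => hC _) (L2B (Lphi n _) (Lw _))).
Qed.

Lemma der_remainder_cvg0 i :
  L2cvg mu (fun n x => h' (phi n None x) * (phi n (Some i) x - w (Some i) x)) (fun=> 0).
Proof.
have [_ [C hC] _] := Ch.
exact: (L2cvg_mul_bounded (fun n => Lphi n (Some i)) (Lw (Some i)) mh'
  (fun n x => hC (phi n None x)) (cphi (Some i))).
Qed.

End Approximation.

(** The identity holds for the test functions [h(phi_n)] and survives the limit. With [h = lnx m] it
    identifies [Dw / w] as the weak gradient of [ln w]. *)
Lemma H1_chain_rule w psi i : H1 w -> D psi ->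
  (forall phi, D phi -> int (fun x => phi None x * psi (Some i) x) =
                        - int (fun x => phi (Some i) x * psi None x)) ->
  int (fun x => h (w None x) * psi (Some i) x) =
  - int (fun x => h' (w None x) * w (Some i) x * psi None x).
Proof.
move=> hw dpsi ibp.
have [phi [dphi cphi]] := H1_approx TD hw.
have Lw k := H1_L2 k hw; have Lpsi k := ts_jL2 mu TD dpsi k.
have Lphi n k : L2 (phi n k) := ts_jL2 mu TD (dphi n) k.
have Lhn n : L2 (h \o phi n None) := C11_L2 Ch (Lphi n None).
have c1 := L2cvg_int Lhn (C11_L2 Ch (Lw None)) (Lpsi (Some i))
  (C11_L2cvg Ch (fun n => Lphi n None) (Lw None) (cphi None)).
have iG := L2_intgM (Lw (Some i)) (Lpsi None).
have c2 := der_cvg hw dphi cphi iG.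
have c3 := L2cvg_int (fun n => der_remainder_L2 hw dphi n i) (L2_cst mu 0) (Lpsi None)
  (der_remainder_cvg0 hw dphi cphi i).
have E n : int (fun x => (h \o phi n None) x * psi (Some i) x) =
  - (int (fun x => h' (phi n None x) * (phi n (Some i) x - w (Some i) x) * psi None x) +
     int (fun x => h' (phi n None x) * (w (Some i) x * psi None x))).
  rewrite (ibp _ (ts_comp TD Ch (dphi n))); congr (- _).
  have [_ [C hC] _] := Ch.
  rewrite -intD; first last.
  - apply: (intg_mul_bounded _ (fun x => hC _) iG).
    exact: (measurableT_comp (C11_measurable_der Ch) (Lphi n None).1).
  - exact: (L2_intgM (der_remainder_L2 hw dphi n i) (Lpsi None)).
  by apply: eq_int => x /=; ring.
rewrite (eq_cvg_limit c1 (cvgN (cvgD c3 c2)) E).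
congr (- _); rewrite [X in X + _](_ : _ = 0) ?add0r.
  by apply: eq_int => x; rewrite mulrA.
by apply: etrans (int_cst mu 0); apply: eq_int => x; rewrite mul0r.
Qed.

Variables (a : I -> I -> T -> R) (Ma : R).
Hypothesis a_meas : forall i j, measurable_fun setT (a i j).
Hypothesis a_bdd : forall i j x, `|a i j x| <= Ma.

(** Limit of the equation tested with [v h(phi_n)], which belongs to [D]. With [h = invx m] this
    amounts to testing with [v / w]. *)
Lemma weak_eq_mul_comp w F : H1 w -> L2 F ->
  (forall v, D v -> int (fun x => aform a x (grad v x) (grad w x)) +
                    int (fun x => F x * v None x) = 0) ->
  forall v, D v ->
    int (fun x => aform a x (fun i => h (w None x) * v (Some i) x) (grad w x)) +
    int (fun x => h' (w None x) * (v None x * aform a x (grad w x) (grad w x))) +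
    int (fun x => h (w None x) * (F x * v None x)) = 0.
Proof.
move=> hw hF weq v dv.
have [phi [dphi cphi]] := H1_approx TD hw.
have Lw k := H1_L2 k hw; have Lv k := ts_jL2 mu TD dv k.
have Lphi n k : L2 (phi n k) := ts_jL2 mu TD (dphi n) k.
have Lhn n : L2 (h \o phi n None) := C11_L2 Ch (Lphi n None).
have Lh := C11_L2 Ch (Lw None).
have chw := C11_L2cvg Ch (fun n => Lphi n None) (Lw None) (cphi None).
have mv k := ts_meas TD dv k.
have [M0 hM0] := ts_bdd TD dv None.
have LFv : L2 (fun x => F x * v None x).
  by under eq_fun do rewrite mulrC; exact: L2_mul_bounded (mv None) hM0 hF.
have c1 := L2cvg_int Lhn Lh LFv chw.
have iww := form_intg a_meas a_bdd (fun i => Lw (Some i)) (fun i => Lw (Some i)).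
have iG : intg (fun x => v None x * aform a x (grad w x) (grad w x)).
  exact: (intg_mul_bounded (mv None) hM0).
have c2 := der_cvg hw dphi cphi iG.
have LS f i : L2 f -> L2 (fun x => f x * v (Some i) x).
  move=> hf; have [M hM] := ts_bdd TD dv (Some i).
  by under eq_fun do rewrite mulrC; exact: L2_mul_bounded (mv _) hM hf.
have LSn n i := LS _ i (Lhn n); have LSw i := LS _ i Lh.
have cS i : L2cvg mu (fun n x => (h \o phi n None) x * v (Some i) x)
    (fun x => (h \o w None) x * v (Some i) x).
  have [M hM] := ts_bdd TD dv (Some i).
  apply: (L2cvg_dom (C := M)) chw => // n x.
  by rewrite -mulrBl normrM mulrC ler_wpM2r.
have c3 := int_form_cvg a_meas a_bdd LSn LSw (fun i => Lw (Some i)) cS.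
pose Q n i x := v None x * (h' (phi n None x) * (phi n (Some i) x - w (Some i) x)).
have LR n i := der_remainder_L2 hw dphi n i.
have LQ n i : L2 (Q n i) := L2_mul_bounded (mv None) hM0 (LR n i).
have cQ i : L2cvg mu (fun n => Q n i) (fun=> 0).
  apply: (L2cvg_dom (C := M0)) (der_remainder_cvg0 hw dphi cphi i) => //.
  - exact: L2_cst.
  - exact: L2_cst.
  - by move=> n x; rewrite !subr0 normrM ler_wpM2r.
have c4 := int_form_cvg a_meas a_bdd LQ (fun i => L2_cst mu 0) (fun i => Lw (Some i)) cQ.
(* The gradient of [v h(phi_n)] has three parts: [h(phi_n) Dv], [v h'(phi_n) Dw] and the remainder
   [Q n], which tends to 0 in L^2. *)
have E n : int (fun x => aform a x ((Q n)^~ x) (grad w x)) +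
    int (fun x => aform a x (fun i => (h \o phi n None) x * v (Some i) x) (grad w x)) +
    int (fun x => h' (phi n None x) * (v None x * aform a x (grad w x) (grad w x))) +
    int (fun x => (h \o phi n None) x * (F x * v None x)) = 0.
  rewrite -(weq _ (ts_mul TD dv (ts_comp TD Ch (dphi n)))); congr (_ + _); last first.
    by apply: eq_int => x /=; ring.
  have [_ [C hC] _] := Ch.
  have i1 := form_intg a_meas a_bdd (LQ n) (fun i => Lw (Some i)).
  have i2 := form_intg a_meas a_bdd (LSn n) (fun i => Lw (Some i)).
  have i3 : intg (fun x => h' (phi n None x) * (v None x * aform a x (grad w x) (grad w x))).
    apply: (intg_mul_bounded _ (fun x => hC _) iG).
    exact: (measurableT_comp (C11_measurable_der Ch) (Lphi n None).1).
  rewrite -(intD i1 i2) -(intD (intgD i1 i2) i3); apply: eq_int => x.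
  rewrite mulrA -formZ_l -[aform a x ((Q n)^~ x) _]mul1r -!form_lin_l.
  rewrite addrC -[aform a x (fun i => h' _ * _ * _) _]mul1r -form_lin_l.
  congr aform; apply/funext => i; rewrite /Q /grad /mul_jet /comp_jet /=; ring.
have := eq_cvg_limit _ (cvg_cst (0 : R) (F := \oo)) E.
move=> /(_ _ (cvgD (cvgD (cvgD c4 c3) c2) c1)) <-.
rewrite [X in X + _ + _ + _](_ : _ = 0) ?add0r//.
apply: etrans (int_cst mu 0); apply: eq_int => x.
by apply: big1 => i _; apply: big1 => j _; rewrite !mul0r.
Qed.

End ChainRule.

(** * The unit cube and the torus *)

Section CubeMeasure.
Context {R : realType}.
Local Notation mR := (measurableTypeR R).
Local Notation unif := (uniform_prob (@ltr01 R)).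

Lemma integral_cube_cons n (F : n.+1.-tuple mR -> R) M :
  measurable_fun setT F -> (forall t, `|F t| <= M) ->
  (\int[cube_measure R n.+1]_t (F t)%:E =
   \int[unif]_s \int[cube_measure R n]_t (F (cube_cons (s, t)))%:E)%E /\
  (\int[cube_measure R n.+1]_t (F t)%:E =
   \int[cube_measure R n]_t \int[unif]_s (F (cube_cons (s, t)))%:E)%E.
Proof.
move=> mF FM.
have mFc : measurable_fun setT (fun p => F (@cube_cons R n p)).
  exact: (measurableT_comp mF (@measurable_cube_cons R n)).
have iF : (unif \x cube_measure R n)%E.-integrable setT (EFin \o (fun p => F (@cube_cons R n p))).
  exact: (intg_bounded _ mFc (fun p => FM _)).
have E : (\int[cube_measure R n.+1]_t (F t)%:E =
    \int[(unif \x cube_measure R n)%E]_p (F (@cube_cons R n p))%:E)%E.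
  by rewrite integral_distribution//; exact/measurable_EFinP.
split; rewrite E.
  by rewrite -integral12_prod_meas1.
by rewrite -integral21_prod_meas1.
Qed.

Definition upd n (t : n.-tuple mR) (i : 'I_n) (s : mR) : n.-tuple mR :=
  [tuple if j == i then s else tnth t j | j < n].

(** Induction on the dimension: a coordinate other than the first is integrated inside the first
    one, and the first is reached by the other order in Fubini's theorem. *)
Lemma integral_cube_eq0 n (i : 'I_n) (F : n.-tuple mR -> R) M :
  measurable_fun setT F -> (forall t, `|F t| <= M) ->
  (forall t, (\int[unif]_s (F (upd t i s))%:E = 0)%E) ->
  (\int[cube_measure R n]_t (F t)%:E = 0)%E.
Proof.
elim: n i F => [[]//|n IH] i F mF FM F0.
have [E1 E2] := integral_cube_cons mF FM.
case: (unliftP ord0 i) => [j ij|i0].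
  rewrite E1 integral0_eq// => s _; apply: (IH j).
  - have mc : measurable_fun setT (fun t : n.-tuple mR => cube_cons (s, t)).
      exact: (@measurable_cons _ _ _ _ (fun=> s) n id).
    exact: (measurableT_comp mF mc).
  - by move=> t; exact: FM.
  - move=> t; rewrite -(F0 (cube_cons (s, t))); apply: eq_integral => r _.
    congr (F _)%:E; apply: eq_from_tnth => k; rewrite tnth_mktuple ij.
    case: (unliftP ord0 k) => [k' ->|->].
      by rewrite (inj_eq lift_inj) !tnthS tnth_mktuple.
    by rewrite (negbTE (neq_lift _ _)).
rewrite E2 integral0_eq// => t _.
rewrite -(F0 (cube_cons (0, t))); apply: eq_integral => r _.
congr (F _)%:E; apply: eq_from_tnth => k; rewrite tnth_mktuple i0.
case: (unliftP ord0 k) => [k' ->|->].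
  by rewrite eq_sym (negbTE (neq_lift _ _)) !tnthS.
by rewrite eqxx.
Qed.

(** Fundamental theorem of calculus on [[0, 1]]. The shift by [M] makes the integrand nonnegative,
    as [integral_uniform] requires. *)
Lemma integral_unif_derive_eq0 (G G' : R -> R) M : (forall s, is_derive s (1 : R) G (G' s)) ->
  continuous G' -> (forall s, `|G' s| <= M) -> G 1 = G 0 ->
  (\int[unif]_s (G' s)%:E = 0)%E.
Proof.
move=> dG cG' GM G10.
have mG' : measurable_fun setT G' by exact: continuous_measurable_fun.
have mM : measurable_fun setT (fun s => (G' s + M)%:E).
  by apply/measurable_EFinP; exact: measurable_funD.
have iG' := intg_bounded unif mG' GM.
have G'M s : (0 <= (G' s + M)%:E)%E.
  by rewrite lee_fin; have := GM s; rewrite ler_norml => /andP[? ?]; lra.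
have E : (\int[unif]_s (G' s + M)%:E = M%:E)%E.
  rewrite integral_uniform// subr0 invr1 mul1e.
  have dGM s : is_derive s (1 : R) (fun x => G x + (0 + M * (x - 0))) (G' s + M).
    by apply: is_deriveD => //; exact: is_derive_affine.
  have cGM s := is_derive_continuous (dGM s).
  rewrite (@continuous_FTC2 _ _ (fun x => G x + (0 + M * (x - 0))))//.
  - by rewrite G10 -EFinB; congr EFin; ring.
  - apply: continuous_subspaceT => s; apply: cvgD; [exact: cG'|exact: cvg_cst].
  - split; first by move=> x _; have [] := dGM x.
      exact/cvg_at_right_filter/cGM.
    exact/cvg_at_left_filter/cGM.
  - by move=> x _; rewrite derive1E; have [_ ->] := dGM x.
have := intD iG' (intg_cst unif M).
have -> : Rintegral unif setT (fun x => G' x + M) = M by rewrite /Rintegral E.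
rewrite int_cst => h0.
have h : Rintegral unif setT G' = 0 by lra.
by rewrite -(fineK (integrable_fin_num measurableT iG')) -[fine _]/(Rintegral unif setT G') h.
Qed.

Lemma cube_measure_cylinder n (i : 'I_n) (A : set mR) : measurable A ->
  unif A = 0%E -> cube_measure R n [set t | A (tnth t i)] = 0%E.
Proof.
move=> mA A0; elim: n i => [[]//|n IH] i.
rewrite /= /distribution /pushforward.
case: (unliftP ord0 i) => [j ->|->].
  rewrite (_ : _ @^-1` _ = setT `*` [set t | A (tnth t j)]); last first.
    by apply/seteqP; split => -[s t] /=; rewrite tnthS => //; tauto.
  rewrite product_measure1E//; last first.
    by rewrite -[X in measurable X]setTI; exact: measurable_tnth.
  by rewrite [X in (_ * X)%E]IH mule0.
rewrite (_ : _ @^-1` _ = A `*` setT); last first.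
  by apply/seteqP; split => -[s t] /=; tauto.
by rewrite product_measure1E// [X in (X * _)%E]A0 mul0e.
Qed.

(** The uniform law lives on the closed interval, so only the endpoint 1 has to be discarded. On the
    half-open cube [torus_frac] inverts [cube_point]. *)
Lemma unif_unit : unif (~` `[0, 1[%classic) = 0%E.
Proof.
rewrite /uniform_prob integral_uniform_pdf.
rewrite (_ : _ `&` _ = [set (1 : R)]) ?integral_set1//.
apply/seteqP; split => x /=; rewrite !in_itv/=.
  move=> [h /andP[x0 x1]]; apply/eqP; rewrite eq_le x1 leNgt.
  by apply/negP => xlt1; apply: h; rewrite x0.
by move=> ->; rewrite ler01 lexx ltxx; split.
Qed.

Lemma ae_cube_unit n : {ae cube_measure R n, forall t, forall i, 0 <= tnth t i < 1}.
Proof.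
apply: filter_forall => i; exists [set t | (~` `[0, 1[%classic) (tnth t i)]; split.
- rewrite -[X in measurable X]setTI; apply: measurable_tnth => //.
  exact: measurableC.
- by apply: cube_measure_cylinder unif_unit; exact: measurableC.
- by move=> t /=; rewrite in_itv.
Qed.

End CubeMeasure.

(** * Measurability by discretisation *)

Section DiscreteMeasurability.

(** A preimage is a countable union of fibres of [k], whatever [G] is. *)
Lemma measurable_fun_countable {d1 d2} {T1 : measurableType d1} {T2 : measurableType d2}
  {C : countType} (k : T1 -> C) (G : C -> T2) :
  (forall z, measurable [set t | k t = z]) -> measurable_fun setT (G \o k).
Proof.
move=> mk _ B mB; rewrite setTI.
rewrite (_ : _ @^-1` _ = \bigcup_n [set t | exists2 z, unpickle n = Some z & k t = z /\ B (G z)]).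
  apply: bigcupT_measurable => n.
  case E : (unpickle n) => [z|]; last first.
    by rewrite (_ : [set _ | _] = set0)//; apply/seteqP; split => // t [].
  have [Bz|Bz] := pselect (B (G z)).
    rewrite (_ : [set _ | _] = [set t | k t = z])//.
    by apply/seteqP; split => [t [_ [<-] []]//|t /= tz]; exists z.
  rewrite (_ : [set _ | _] = set0)//.
  by apply/seteqP; split => // t [_ [<-] []].
apply/seteqP; split => [t Bt|t [n _ [z _ [<-]]]//].
by exists (pickle (k t)) => //=; exists (k t); rewrite ?pickleK.
Qed.

Context {R : realType}.
Local Notation mR := (measurableTypeR R).

Lemma measurable_floor_fiber (z : int) : measurable [set s : mR | Num.floor s = z].
Proof.
rewrite (_ : [set _ | _] = `[z%:~R, (z + 1)%:~R[%classic)//.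
apply/seteqP; split => s /=; rewrite in_itv/=.
  by move=> /eqP; rewrite Num.Theory.floor_eq.
by move=> h; apply/eqP; rewrite Num.Theory.floor_eq.
Qed.

Lemma measurable_floor : measurable_fun setT (fun s : mR => (Num.floor s)%:~R : mR).
Proof.
exact: (measurable_fun_countable (fun z : int => z%:~R : mR) measurable_floor_fiber).
Qed.

(** The sigma-algebra on tuples is the product one, while [f] is continuous for the topology of row
    vectors. Rather than comparing the two, [f] is written as the pointwise limit of its values on
    grids of mesh [1 / n.+1], which factor through a countable type. *)
Lemma measurable_continuous_cube d (f : 'rV[R]_d -> R) : continuous f ->
  measurable_fun setT (f \o @cube_point R d).
Proof.
move=> cf.
pose k (n : nat) (t : d.-tuple mR) := [ffun i : 'I_d => Num.floor (tnth t i * n.+1%:R)].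
pose G (n : nat) (z : {ffun 'I_d -> int}) : mR := f (\row_i ((z i)%:~R / n.+1%:R)).
apply: (@measurable_fun_cvg _ _ _ _ (fun n => G n \o k n)).
  move=> n; apply: measurable_fun_countable => z.
  rewrite (_ : [set _ | _] = \bigcap_(i in [set: 'I_d])
    [set t | Num.floor (tnth t i * n.+1%:R) = z i]); last first.
    apply/seteqP; split => [t <- i _|t h] /=; first by rewrite ffunE.
    by apply/ffunP => i; rewrite ffunE h.
  apply: fin_bigcap_measurable => // i _.
  rewrite -[X in measurable X]setTI.
  have m1 : measurable_fun setT (fun t : d.-tuple mR => tnth t i * n.+1%:R : mR).
    by apply: measurable_funM => //; exact: measurable_tnth.
  exact: (m1 measurableT _ (measurable_floor_fiber (z i))).
move=> t _; pose q (n : nat) : 'rV[R]_d := \row_i ((k n t i)%:~R / n.+1%:R).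
suff cv : q @ \oo --> cube_point t.
  have h := cvg_comp _ _ cv (cf (cube_point t)).
  exact: h.
apply/cvg_ballP => e e0.
near=> n; split => // a i; rewrite !mxE /ball/= ffunE.
have n0 : 0 < n.+1%:R :> R by rewrite ltr0n.
have := Num.Theory.floor_itv (tnth t i * n.+1%:R).
rewrite intrD => /andP[h1 h2].
have -> : tnth t i - (Num.floor (tnth t i * n.+1%:R))%:~R / n.+1%:R =
  (tnth t i * n.+1%:R - (Num.floor (tnth t i * n.+1%:R))%:~R) / n.+1%:R.
  by rewrite mulrBl mulfK// gt_eqF.
rewrite normrM ger0_norm ?subr_ge0// ger0_norm ?invr_ge0 ?(ltW n0)//.
apply: lt_trans (_ : n.+1%:R^-1 < e).
  by rewrite ltr_pdivrMr// mulVf ?gt_eqF// ltrBlDl.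
near: n; exact: near_infty_natSinv_lt (PosNum e0).
Unshelve. all: by end_near. Qed.

End DiscreteMeasurability.

Section Periodic.
Context {R : realType} {d : nat}.
Implicit Types (f : 'rV[R]_d -> R) (x : 'rV[R]_d).

Lemma torus_periodic_int f i (z : int) x : torus_periodic f ->
  f (x + z%:~R *: delta_mx 0 i) = f x.
Proof.
move=> pf; elim/int_rec: z x => [|n IH|n IH] x.
- by rewrite scale0r addr0.
- have -> : n.+1%:~R = n%:~R + 1 :> R by rewrite intS intrD addrC.
  by rewrite scalerDl scale1r addrA pf IH.
- rewrite -(pf i) -addrA -[X in _ *: _ + X]scale1r -scalerDl.
  rewrite (_ : (- n.+1%:Z)%:~R + 1 = (- n%:Z)%:~R :> R) ?IH//.
  by rewrite intS opprD intrD rmorphN1 addrC addrA subrr add0r.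
Qed.

Lemma torus_periodic_sum f (z : 'I_d -> int) x : torus_periodic f ->
  f (x + \sum_i (z i)%:~R *: delta_mx 0 i) = f x.
Proof.
move=> pf; rewrite unlock; elim: (index_enum _) x => [|i s IH] x /=.
  by rewrite addr0.
by rewrite addrCA addrC torus_periodic_int// IH.
Qed.

(** Integer translations bring every point into the compact unit cube. *)
Lemma torus_periodic_bounded f : torus_periodic f -> continuous f ->
  exists M, forall x, `|f x| <= M.
Proof.
move=> pf cf.
have cK : compact [set v : 'rV[R]_d | forall i, `[0 : R, 1]%classic (v ord0 i)].
  exact: (@rV_compact R d (fun=> `[0 : R, 1]%classic) (fun=> @segment_compact R 0 1)).
have := compact_bounded (continuous_compact (continuous_subspaceT cf) cK).
move=> [M [_ hM]]; exists (M + 1) => x.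
pose z i := - Num.floor (x 0 i).
rewrite -(torus_periodic_sum z x pf); apply: (hM (M + 1)); first by rewrite ltrDl.
exists (x + \sum_i (z i)%:~R *: delta_mx 0 i) => // i.
have -> : (x + \sum_i (z i)%:~R *: delta_mx 0 i) ord0 i = x 0 i - (Num.floor (x 0 i))%:~R.
  rewrite mxE summxE (bigD1 i)//= big1 => [|j ji].
    by rewrite !mxE !eqxx mulr1 addr0 /z intrN.
  by rewrite !mxE [i == j]eq_sym (negbTE ji) andbF mulr0.
have := Num.Theory.floor_itv (x 0 i); rewrite intrD /= in_itv => /andP[h1 h2] /=.
by apply/andP; split; lra.
Qed.

End Periodic.

Section DirectionalDerivative.
Context {R : realType} {V : normedModType R}.
Implicit Types (f : V -> R) (x v : V).

Lemma is_derive_line f x v (s : R) df : is_derive (x + s *: v) v f df <->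
  is_derive s (1 : R) (fun r => f (x + r *: v)) df.
Proof.
have E : (fun h : R => h^-1 *: ((f \o shift (x + s *: v)) (h *: v) - f (x + s *: v))) =
    (fun h : R => h^-1 *: (((fun r : R => f (x + r *: v)) \o shift s) (h *: (1 : R)) - f (x + s *: v))).
  apply/funext => h /=; congr (_ *: (f _ - _)).
  by rewrite [_%:A]mulr1 scalerDl addrCA.
split=> -[dv ev]; split.
- by rewrite /derivable -E.
- by rewrite -ev /derive -E.
- by rewrite /derivable E.
- by rewrite -ev /derive E.
Qed.

(** [f] is only assumed to have a derivative in the direction [v], not to be differentiable; after
    restriction to the line, the Caratheodory slopes of [h] and [f] multiply. *)
Lemma is_derive_chain f x v (h : R -> R) (df dh : R) : is_derive x v f df ->
  is_derive (f x) (1 : R) h dh -> is_derive x v (h \o f) (dh * df).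
Proof.
move=> dfx; have x0 : x + 0 *: v = x by rewrite scale0r addr0.
have df0 : is_derive (x + 0 *: v) v f df by rewrite x0.
have {}df0 := (is_derive_line f x v 0 df).1 df0.
move/is_derive1_caratheodory => [k [k1 k2 k3]].
suff : is_derive (x + 0 *: v) v (h \o f) (dh * df) by rewrite x0.
apply/is_derive_line.
have c0 := is_derive_continuous df0.
move/is_derive1_caratheodory : df0 => [g [g1 g2 g3]].
apply/is_derive1_caratheodory; exists (fun z => k (f (x + z *: v)) * g z); split.
- by move=> z; rewrite /= -mulrA -g1 x0 -k1.
- apply: cvgM => //; apply: (cvg_comp _ _ c0).
  by rewrite x0; exact: k2.
- by rewrite x0 k3 g3.
Qed.

End DirectionalDerivative.

(** * Periodic C^1 functions as test functions *)

Section TorusC1.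
Context {R : realType} {d : nat}.
Local Notation mR := (measurableTypeR R).
Local Notation T := (d.-tuple mR).
Local Notation mu := (cube_measure R d).
Implicit Types (f g : 'rV[R]_d -> R) (x : 'rV[R]_d).

(** C^1 rather than smooth, since a test space must be stable under composition with C^{1,1}
    functions. *)
Definition torus_C1 f := [/\ torus_periodic f, continuous f &
  forall i, (forall x, derivable f x (delta_mx 0 i)) /\ continuous (partial i f)].

Lemma torus_smooth_C1 f : torus_smooth f -> torus_C1 f.
Proof.
move=> [pf sf]; have [d0 c0] := sf [::]; split=> // i; split=> //.
by have [_] := sf [:: i].
Qed.

Lemma partialP f i x : torus_C1 f -> is_derive x (delta_mx 0 i) f (partial i f x).
Proof. by move=> [_ _ /(_ i)[df _]]; exact: derivableP. Qed.

Lemma partial_periodic f i : torus_periodic f -> torus_periodic (partial i f).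
Proof.
move=> pf j x; rewrite /partial /derive; congr (lim (_ @ 0^')).
by apply/funext => h /=; rewrite addrA !pf.
Qed.

Lemma torus_C1_of_is_derive f (f' : 'I_d -> 'rV[R]_d -> R) : torus_periodic f ->
  continuous f -> (forall i x, is_derive x (delta_mx 0 i) f (f' i x)) ->
  (forall i, continuous (f' i)) -> torus_C1 f /\ forall i, partial i f = f' i.
Proof.
move=> pf cf df cf'.
have E i : partial i f = f' i by apply/funext => x; exact: derive_val.
by split => //; split => // i; split => [x|]; [have [] := df i x|rewrite E].
Qed.

Definition torus_jet f : @jet _ T R 'I_d := fun k t =>
  if k is Some i then partial i f (cube_point t) else f (cube_point t).

Definition torus_jets (u : @jet _ T R 'I_d) := exists2 f, torus_C1 f & u = torus_jet f.

Lemma torus_jet_eq f (u : @jet _ T R 'I_d) (f' : 'I_d -> 'rV[R]_d -> R) : torus_C1 f /\ (forall i, partial i f = f' i) ->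
  (u = fun k t => if k is Some i then f' i (cube_point t) else f (cube_point t)) -> torus_jets u.
Proof.
move=> [cf E] ->; exists f => //.
by apply/funext => -[i|]; apply/funext => t //=; rewrite E.
Qed.

Lemma torus_C1_mul f g : torus_C1 f -> torus_C1 g ->
  torus_C1 (f * g) /\ forall i, partial i (f * g) = fun x => f x * partial i g x + partial i f x * g x.
Proof.
move=> hf hg; have [pf cf df] := hf; have [pg cg dg] := hg.
apply: torus_C1_of_is_derive.
- by move=> i x; rewrite !fctE pf pg.
- by move=> x; exact: (cvgM (cf x) (cg x)).
- move=> i x; apply: is_derive_eq.
    by apply: is_deriveM; exact: partialP.
  by rewrite /GRing.scale/= [g x * _]mulrC.
- move=> i x; have [_ cdf] := df i; have [_ cdg] := dg i.
  exact: (cvgD (cvgM (cf x) (cdg x)) (cvgM (cdf x) (cg x))).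
Qed.

Lemma torus_C1_test_space : test_space torus_jets.
Proof.
split.
- move=> a _ _ [f hf ->] [g hg ->]; have [pf cf df] := hf; have [pg cg dg] := hg.
  apply: (@torus_jet_eq (a \*: f + g) _ (fun i x => a * partial i f x + partial i g x)) => //.
  apply: torus_C1_of_is_derive.
  + by move=> i x; rewrite -[LHS]/(a * f _ + g _) pf pg.
  + by move=> x; exact: (cvgD (cvgZl_tmp (cf x)) (cg x)).
  + by move=> i x; apply: is_deriveD; [apply: is_deriveZ|]; exact: partialP.
  + move=> i x; have [_ cdf] := df i; have [_ cdg] := dg i.
    exact: (cvgD (cvgMl_tmp (cdf x)) (cdg x)).
  + by apply/funext => -[i|]; apply/funext.
- move=> c; apply: (@torus_jet_eq (cst c) _ (fun _ => cst 0)) => //.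
  apply: torus_C1_of_is_derive => //.
  + exact: cst_continuous.
  + by move=> _; exact: cst_continuous.
  + by apply/funext => -[i|]; apply/funext.
- move=> _ [f [pf cf df] ->] [i|]; last exact: measurable_continuous_cube.
  by apply: measurable_continuous_cube; exact: (df i).2.
- move=> _ [f [pf cf df] ->] [i|] /=.
    have [M hM] := torus_periodic_bounded (partial_periodic i pf) (df i).2.
    by exists M => t; exact: hM.
  have [M hM] := torus_periodic_bounded pf cf.
  by exists M => t; exact: hM.
- move=> _ _ [f hf ->] [g hg ->]; apply: torus_jet_eq; first exact: (torus_C1_mul hf hg).
  by apply/funext => -[i|]; apply/funext.
- move=> h h' _ Ch [f hf ->]; have [pf cf df] := hf.
  have ch := C11_continuous Ch; have ch' := C11_continuous_der Ch.
  apply: (@torus_jet_eq (h \o f) _ (fun i x => h' (f x) * partial i f x)) => //.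
  apply: torus_C1_of_is_derive.
  + by move=> i x /=; rewrite pf.
  + by move=> x; exact: (continuous_comp (cf x) (ch (f x))).
  + move=> i x; apply: is_derive_chain; first exact: partialP.
    exact: C11_derive.
  + have c1 : continuous (h' \o f) by move=> y; exact: (continuous_comp (cf y) (ch' (f y))).
    by move=> i x; have [_ cdf] := df i; exact: (cvgM (c1 x) (cdf x)).
Qed.

Lemma cube_point_upd (t : T) i (s : R) :
  cube_point (upd t i s) = cube_point (upd t i 0) + s *: delta_mx 0 i.
Proof.
apply/rowP => j; rewrite !mxE !tnth_mktuple eqxx andTb.
by case: eqP => _; rewrite ?add0r ?mulr1 // mulr0 addr0.
Qed.

(** Integration in the coordinate [i] alone gives the difference of [f] between opposite faces,
    which vanishes by periodicity. *)
Lemma torus_int_partial f i : torus_C1 f ->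
  Rintegral mu setT (fun t => partial i f (cube_point t)) = 0.
Proof.
move=> hf; have [pf cf df] := hf; have [_ cdf] := df i.
have [M hM] := torus_periodic_bounded (partial_periodic i pf) cdf.
rewrite /Rintegral (integral_cube_eq0 (i := i) (M := M))//.
- exact: (measurable_continuous_cube cdf).
- move=> t; pose y : 'rV[R]_d := cube_point (upd t i 0).
  under eq_integral do rewrite cube_point_upd -/y.
  apply: (@integral_unif_derive_eq0 _ (fun s => f (y + s *: delta_mx 0 i))
    (fun s => partial i f (y + s *: delta_mx 0 i)) M) => //.
  + move=> s; have h := partialP i (y + s *: delta_mx 0 i) hf.
    exact: ((is_derive_line f y (delta_mx 0 i) s _).1 h).
  + move=> s; have c1 : {for s, continuous (fun r : R => y + r *: delta_mx 0 i)}.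
      by apply: cvgD; [exact: cvg_cst|apply: cvgZr_tmp; exact: cvg_id].
    exact: (continuous_comp c1 (cdf _)).
  + by rewrite scale1r scale0r pf addr0.
Qed.

Lemma torus_ibp f g i : torus_C1 f -> torus_C1 g ->
  Rintegral mu setT (fun t => torus_jet f None t * torus_jet g (Some i) t) =
  - Rintegral mu setT (fun t => torus_jet f (Some i) t * torus_jet g None t).
Proof.
move=> hf hg; have [hfg E] := torus_C1_mul hf hg.
have L k : L2 mu (torus_jet f k) by apply: (ts_jL2 mu torus_C1_test_space); exists f.
have L' k : L2 mu (torus_jet g k) by apply: (ts_jL2 mu torus_C1_test_space); exists g.
apply/eqP; rewrite -addr_eq0 -intD; [|exact: L2_intgM|exact: L2_intgM].
by rewrite -(torus_int_partial i hfg) E.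
Qed.

(** An a.e. left inverse of [cube_point]; composing with it turns any function on the cube into a
    periodic one. *)
Definition torus_frac x : T := [tuple x 0 i - (Num.floor (x 0 i))%:~R | i < d].

Lemma torus_frac_periodic : torus_periodic torus_frac.
Proof.
move=> i x; apply: eq_from_tnth => j; rewrite !tnth_mktuple !mxE eqxx andTb.
case: eqP => _; last by rewrite addr0.
rewrite Num.Theory.floorDrz ?Num.Theory.int_num1// intrD Num.Theory.floor1.
by rewrite opprD addrACA subrr addr0.
Qed.

Lemma measurable_torus_frac : measurable_fun setT (torus_frac \o cube_point).
Proof.
apply/measurable_fun_tnthP => i.
rewrite (_ : _ \o _ = fun t : T => tnth t i - (Num.floor (tnth t i))%:~R : mR).
  apply: measurable_funB; first exact: measurable_tnth.
  exact: (measurableT_comp measurable_floor (measurable_tnth i)).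
by apply/funext => t /=; rewrite tnth_mktuple mxE.
Qed.

Lemma ae_torus_frac : {ae mu, forall t, torus_frac (cube_point t) = t}.
Proof.
have [N [mN N0 sN]] := @ae_cube_unit R d; exists N; split => // t nt; apply: sN => h.
apply: nt; apply: eq_from_tnth => i.
rewrite tnth_mktuple mxE (_ : Num.floor _ = 0) ?subr0//.
by apply/eqP; rewrite Num.Theory.floor_eq add0r h.
Qed.

End TorusC1.

(** * The Hopf-Cole transform *)

Section HopfCole.
Context {d} {T : measurableType d} {R : realType} {I : finType}.
Variable mu : probability T R.

Local Notation int f := (Rintegral mu setT f).
Local Notation L2 := (L2 mu).
Local Notation jet := (@jet d T R I).

Variable D : jet -> Prop.
Hypothesis TD : test_space D.
Local Notation H1 := (H1 mu D).

(** Integrals ignore null sets, so the same approximating test functions serve. This permits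
    modifying a solution so that its bounds hold everywhere. *)
Lemma H1_ae_eq (u v : jet) : H1 u -> (forall k, measurable_fun setT (v k)) ->
  (forall k, {ae mu, forall x, u k x = v k x}) -> H1 v.
Proof.
move=> [hu au] mv uv.
have hv k : L2 (v k) by exact: L2_ae_eq (hu k) (mv k) (uv k).
split => // e e0; have [p dp ep] := au e e0; exists p => //.
have hp k := ts_jL2 mu TD dp k.
rewrite (_ : jdot mu (v - p) (v - p) = jdot mu (u - p) (u - p))//.
apply: eq_bigr => k _; apply: ae_eq_int.
- exact: (intg_measurable (L2_intgM (L2B (hv k) (hp k)) (L2B (hv k) (hp k)))).
- exact: (intg_measurable (L2_intgM (L2B (hu k) (hp k)) (L2B (hu k) (hp k)))).
- by apply: filterS (uv k) => x; rewrite -[(u - p) k x]/(u k x - p k x) => ->.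
Qed.

Definition clamp (m M s : R) := Num.max m (Num.min M s).

Lemma clamp_bounds m M s : m <= M -> m <= clamp m M s <= M.
Proof. by move=> mM; rewrite /clamp le_max lexx/= ge_max mM ge_min lexx. Qed.

Lemma clamp_id m M s : m <= s <= M -> clamp m M s = s.
Proof. by move=> /andP[ms sM]; rewrite /clamp min_r// max_r. Qed.

Lemma clamp_homo m M s t : s <= t -> clamp m M s <= clamp m M t.
Proof.
move=> st; have h : Num.min M s <= Num.min M t by rewrite le_min !ge_min lexx st orbT.
by rewrite /clamp ge_max !le_max lexx h orbT.
Qed.

Lemma clamp_lipschitz m M s t : `|clamp m M s - clamp m M t| <= `|s - t|.
Proof.
have h (x y : R) : x <= y -> clamp m M y - clamp m M x <= y - x.
  by move=> xy; rewrite /clamp; case: (leP M x) => ?; case: (leP M y) => ?;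
    case: (leP m x) => ?; case: (leP m y) => ?; case: (leP m M) => ?; lra.
have [st|/ltW ts] := leP s t.
  by rewrite distrC [leRHS]distrC !ger0_norm ?subr_ge0 ?clamp_homo// h.
by rewrite !ger0_norm ?subr_ge0 ?clamp_homo// h.
Qed.

Variables (a : I -> I -> T -> R) (Ma theta : R).
Hypothesis a_meas : forall i j, measurable_fun setT (a i j).
Hypothesis a_bdd : forall i j x, `|a i j x| <= Ma.
Hypothesis theta_gt0 : 0 < theta.
Hypothesis a_ell : forall x (z : I -> R), theta * (\sum_i z i ^+ 2) <= aform a x z z.

Variables (W : T -> R) (K : R) (g : R -> R) (Cg : R).
Hypothesis W_meas : measurable_fun setT W.
Hypothesis W_bdd : forall x, `|W x| <= K.
Hypothesis g_lip : locally_lipschitz g.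
Hypothesis Cg_gt0 : 0 < Cg.
Hypothesis g_growth : forall s, Cg * `|s| - Cg^-1 <= g s * Num.sg s.

Definition reaction (x : T) (s : R) := 2^-1 * s * (g (2 * ln s) - W x).

Lemma measurable_reaction f : measurable_fun setT f ->
  measurable_fun setT (fun x => reaction x (f x)).
Proof.
move=> mf; apply: measurable_funM; first exact: measurable_funM.
apply: measurable_funB => //.
have mg : measurable_fun setT g.
  by apply: continuous_measurable_fun; exact: locally_lipschitz_continuous.
apply: (measurableT_comp mg); apply: measurable_funM => //.
exact: measurableT_comp.
Qed.

(* The equation for [w = exp (- u / 2)], from which the quadratic gradient
   term has disappeared. *)
Lemma hopf_cole_solution : exists m M (w : jet), [/\ 0 < m,
  H1 w, forall x, m <= w None x <= M, L2 (fun x => reaction x (w None x)) &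
  forall v, D v -> int (fun x => aform a x (grad v x) (grad w x)) +
                   int (fun x => reaction x (w None x) * v None x) = 0].
Proof.
have K0 : 0 <= K by exact: le_trans (normr_ge0 _) (W_bdd point).
have [m [M [lam [m0 mM lam0 hF]]]] := barriers g_lip Cg_gt0 K0 g_growth.
have mM' := ltW mM.
pose c := clamp m M.
have cb s : m <= c s <= M by exact: clamp_bounds.
(* The shift by [lam] makes [Phi] nondecreasing, since [lam] is a Lipschitz constant of the reaction
   on [[m, M]]; the clamp extends this to all real [s]. *)
pose Phi x s := lam * c s - reaction x (c s).
have mc : measurable_fun setT c.
  by apply: measurable_maxr => //; apply: measurable_minr.
have Phi_meas f : measurable_fun setT f -> measurable_fun setT (fun x => Phi x (f x)).
  move=> mf; have mcf := measurableT_comp mc mf.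
  apply: measurable_funB; first exact: measurable_funM.
  exact: (measurable_reaction mcf).
have lipF x s t : `|reaction x (c s) - reaction x (c t)| <= lam * `|c s - c t|.
  by have [_ _ h] := hF (W x) (W_bdd x); apply: h.
have Phi_mono x s t : s <= t -> Phi x s <= Phi x t.
  move=> st; have ct : c s <= c t by exact: clamp_homo.
  have := lipF x t s; rewrite (@ger0_norm _ (c t - c s)) ?subr_ge0//.
  by rewrite ler_norml /Phi => /andP[? ?]; lra.
have Phi_lip x s t : `|Phi x s - Phi x t| <= (2 * lam) * `|s - t|.
  have h1 := lipF x s t.
  have h2 : lam * `|c s - c t| <= lam * `|s - t| by rewrite ler_pM2l// clamp_lipschitz.
  have -> : Phi x s - Phi x t = lam * (c s - c t) - (reaction x (c s) - reaction x (c t)).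
    by rewrite /Phi; ring.
  apply: le_trans (ler_normB _ _) _; rewrite normrM gtr0_norm//; lra.
have cm : c m = m by rewrite /c clamp_id// lexx.
have cM : c M = M by rewrite /c clamp_id// lexx andbT.
have cc s : c (c s) = c s by rewrite {1}/c clamp_id.
(* By monotonicity only the barriers matter, where the sign of the reaction gives
   [Phi x m >= lam * m] and [Phi x M <= lam * M]. *)
have Phi_bounds x s : lam * m <= Phi x s <= lam * M.
  have [Fm FM _] := hF (W x) (W_bdd x).
  have -> : Phi x s = Phi x (c s) by rewrite /Phi cc.
  have /andP[h1 h2] := cb s.
  have := Phi_mono x _ _ h1; have := Phi_mono x _ _ h2.
  move: Fm FM; rewrite -!/(reaction x _) /Phi cm cM => *; apply/andP; split; lra.
have [w [hw w_bd sw]] := semilinear_exists mu TD a_meas a_bdd theta_gt0 a_ell lam0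
  Phi_meas Phi_mono Phi_lip Phi_bounds.
have Lw k := H1_L2 k hw.
(* Clamping changes [w] on a null set only and makes its bounds hold everywhere, so that the
   logarithm and the inverse can be used pointwise. *)
pose w' : jet := fun k => if k is Some i then w (Some i) else c \o w None.
have ww' : {ae mu, forall x, w None x = w' None x}.
  by apply: filterS w_bd => x wx; rewrite /w' /= /c clamp_id.
have mw' k : measurable_fun setT (w' k).
  by case: k => [i|]; [exact: (Lw (Some i)).1|exact: (measurableT_comp mc (Lw None).1)].
have hw' : H1 w'.
  by apply: (H1_ae_eq hw mw') => -[i|]; [exact: aeW|exact: ww'].
have Lw' k := H1_L2 k hw'.
have LF : L2 (fun x => reaction x (w' None x)).
  have := L2B (L2Z lam (Lw' None)) (_ : L2 (fun x => Phi x (w None x))).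
  have LPhi : L2 (fun x => Phi x (w None x)).
    apply: (@L2_bounded _ _ _ _ _ (`|lam * m| + `|lam * M|)).
      exact: (Phi_meas _ (Lw None).1).
    move=> x; have /andP[p1 p2] := Phi_bounds x (w None x).
    have := ler_norm (lam * M); have := ler_norm (- (lam * m)); rewrite normrN.
    have := normr_ge0 (lam * m); have := normr_ge0 (lam * M).
    by rewrite ler_norml => *; apply/andP; split; lra.
  move=> /(_ LPhi); congr L2; apply/funext => x; rewrite /Phi /w' /=; ring.
exists m, M, w'; split => // [x|v dv]; first exact: cb.
have hv := ts_H1 mu TD dv; have Lv k := H1_L2 k hv.
have := sw v hv; rewrite /bform.
have iwv := L2_intgM (Lw' None) (Lv None).
have iFv := L2_intgM LF (Lv None).
have -> : int (fun x => w None x * v None x) = int (fun x => w' None x * v None x).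
  apply: ae_eq_int; [exact: (intg_measurable (L2_intgM (Lw None) (Lv None)))|..].
    exact: (intg_measurable iwv).
  by apply: filterS ww' => x ->.
have -> : int (fun x => Phi x (w None x) * v None x) =
    lam * int (fun x => w' None x * v None x) -
    int (fun x => reaction x (w' None x) * v None x).
  rewrite -intZ// -intB//; last exact: intgZ.
  by apply: eq_int => x; rewrite /Phi /w' /=; ring.
move: (int _) (lam * _) (int _) => p q r; lra.
Qed.

End HopfCole.

Section LebesgueSpaces.
Context {d} {T : measurableType d} {R : realType}.
Variable mu : probability T R.

Lemma L2_Lfun f : L2 mu f -> f \in Lfun mu 2%:E.
Proof.
move=> [mf /integrableP[_ hf]]; rewrite inE; apply/andP; split; rewrite inE//=.
rewrite /finite_norm unlock poweR_lty//; apply: le_lt_trans hf.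
rewrite le_eqVlt; apply/orP; left; apply/eqP; apply: eq_integral => x _ /=.
by rewrite powR_mulrn// normrX.
Qed.

Lemma bounded_Lfun_infty (f : T -> R) (M : R) : measurable_fun setT f -> (forall x, `|f x| <= M) ->
  f \in Lfun mu +oo%E.
Proof.
move=> mf fM; rewrite inE; apply/andP; split; rewrite inE//=.
rewrite /finite_norm unlock; case: ifP => _; last exact: ltry.
apply: (@le_lt_trans _ _ M%:E); last exact: ltry.
by apply/ess_supP; apply: aeW => x /=; rewrite lee_fin.
Qed.

End LebesgueSpaces.

(** * Transfer from the cube to the torus *)

Section Torus.
Context {R : realType} {d : nat}.
Local Notation mR := (measurableTypeR R).
Local Notation T := (d.-tuple mR).
Local Notation mu := (cube_measure R d).

Lemma mxform_aform (M : 'I_d -> 'I_d -> T -> R) (N : 'M[R]_d) (t : T) z w :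
  (forall i j, M i j t = N i j) ->
  mxform N z w = aform M t (fun i => z 0 i) (fun i => w 0 i).
Proof.
move=> MN; rewrite /mxform /aform mxE exchange_big/=; apply: eq_bigr => j _.
by rewrite !mxE mulr_suml; apply: eq_bigr => i _; rewrite MN.
Qed.

Lemma dot_sum_sqr (z : 'rV[R]_d) : (z *m z^T) 0 0 = \sum_i z 0 i ^+ 2.
Proof. by rewrite mxE; apply: eq_bigr => i _; rewrite mxE expr2. Qed.

(* Agrees with [f] only on the half-open cube, hence a.e. on the closed one. *)
Definition periodize (f : T -> R) (x : 'rV[R]_d) : R := f (torus_frac x).

Lemma periodize_periodic f : torus_periodic (periodize f).
Proof. by move=> i x; rewrite /periodize torus_frac_periodic. Qed.

Lemma measurable_periodize f : measurable_fun setT f ->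
  measurable_fun setT (periodize f \o cube_point).
Proof. by move=> mf; exact: (measurableT_comp mf measurable_torus_frac). Qed.

Lemma ae_periodize f : {ae mu, forall t, f t = periodize f (cube_point t)}.
Proof.
have [N [mN N0 sN]] := @ae_torus_frac R d; exists N; split => // t nt; apply: sN => h.
by apply: nt => /=; rewrite /periodize h.
Qed.

Lemma periodize_L2 f : L2 mu f -> L2 mu (periodize f \o cube_point).
Proof.
by move=> hf; exact: (L2_ae_eq hf (measurable_periodize hf.1) (ae_periodize f)).
Qed.

End Torus.

Theorem theorem3p5 (R : realType) (d : nat)
  (A : 'rV[R]_d -> 'M[R]_d) (V : 'rV[R]_d -> R) (g : R -> R)
  (Hbar theta0 theta1 Cg : R)
  (hA_meas : forall i j, torus_measurable (fun x => A x i j))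
  (hA_bdd : exists M : R, forall x i j, `|A x i j| <= M)
  (hV_per : torus_periodic V) (hV_cont : continuous V)
  (h_theta0 : 0 < theta0) (h_theta1 : 0 < theta1)
  (hA_ell : forall (x z : 'rV[R]_d),
     theta0 * (z *m z^T) 0 0 <= mxform (A x) z z <= theta1 * (z *m z^T) 0 0)
  (hg_lip : locally_lipschitz g)
  (h_Cg : 0 < Cg)
  (hg_growth : forall s : R, Cg * `|s| - Cg^-1 <= g s * Num.sg s) :
  exists u : 'rV[R]_d -> R,
    [/\ sobolev_H1 u, torus_Lp +oo%E u &
        distributional_solution A (fun x => V x - Hbar) g u].
Proof.
have TD := @torus_C1_test_space R d.
pose mu := cube_measure R d.
pose a i j (t : d.-tuple (measurableTypeR R)) := A (cube_point t) i j.
have a_meas i j : measurable_fun setT (a i j) := (hA_meas i j).2.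
have [Ma hMa] := hA_bdd.
have a_bdd i j t : `|a i j t| <= Ma by exact: hMa.
have a_ell t (z : 'I_d -> R) : theta0 * (\sum_i z i ^+ 2) <= aform a t z z.
  have /andP[h _] := hA_ell (cube_point t) (\row_i z i).
  rewrite dot_sum_sqr (mxform_aform (M := a) (t := t))// in h.
  have zE : (fun i => (\row_i z i) 0 i) = z by apply/funext => i; rewrite mxE.
  by under eq_bigr do rewrite -{1}zE; rewrite zE in h.
pose W (t : d.-tuple (measurableTypeR R)) := V (cube_point t) - Hbar.
have [KV hKV] := torus_periodic_bounded hV_per hV_cont.
have W_meas : measurable_fun setT W.
  by apply: measurable_funB => //; exact: (measurable_continuous_cube hV_cont).
have W_bdd t : `|W t| <= KV + `|Hbar|.
  by apply: le_trans (ler_normB _ _) _; rewrite lerD2r.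
have [m [M [w [m0 hw wb LF weq]]]] := hopf_cole_solution mu TD a_meas a_bdd h_theta0
  a_ell W_meas W_bdd hg_lip h_Cg hg_growth.
have Lw k := H1_L2 k hw.
have w0 t : 0 < w None t by have /andP[+ _] := wb t; exact: lt_le_trans.
(* Since [w >= m] everywhere, the extended functions coincide with [ln] and the inverse on the
   values of [w]. *)
have maxw t : Num.max (w None t) m = w None t.
  by rewrite max_l//; have /andP[] := wb t.
have lnw t : lnx m (w None t) = ln (w None t).
  rewrite /lnx; case: ifP => // wm; have -> : w None t = m.
    by apply/eqP; rewrite eq_le wm; have /andP[] := wb t.
  by rewrite subrr mulr0 addr0.
have invw t : invx m (w None t) = (w None t)^-1.
  rewrite /invx; case: ifP => // wm; have -> : w None t = m.
    by apply/eqP; rewrite eq_le wm; have /andP[] := wb t.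
  by rewrite subrr mulr0 subr0.
pose u' t := - 2 * ln (w None t).
pose p' i t := - 2 * ((w None t)^-1 * w (Some i) t).
have inv_bdd t : `|(w None t)^-1| <= m^-1.
  rewrite ger0_norm ?invr_ge0 ?(ltW (w0 t))// lef_pV2 ?posrE//.
  by have /andP[] := wb t.
have minv : measurable_fun setT (fun t => (w None t)^-1).
  rewrite (_ : (fun _ => _) = invx m \o w None); last by apply/funext => t /=; rewrite invw.
  exact: (measurableT_comp (C11_measurable (C11_invx m0)) (Lw None).1).
have Lp' i : L2 mu (p' i) := L2Z (- 2) (L2_mul_bounded minv inv_bdd (Lw (Some i))).
have mln : measurable_fun setT (fun t => ln (w None t)).
  exact: (measurableT_comp _ (Lw None).1).
have mu' : measurable_fun setT u' by exact: measurable_funM.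
have u'_bdd t : `|u' t| <= 2 * (`|ln m| + `|ln M|).
  rewrite /u' normrM normrN normr_nat ler_pM2l//.
  have /andP[mw wM] := wb t; have M0 := lt_le_trans (w0 t) wM.
  have : ln m <= ln (w None t) by rewrite ler_ln ?posrE.
  have : ln (w None t) <= ln M by rewrite ler_ln ?posrE.
  have := ler_norm (ln M); have := ler_norm (- ln m); rewrite normrN.
  have := normr_ge0 (ln M); have := normr_ge0 (ln m).
  by rewrite ler_norml => *; apply/andP; split; lra.
have Lu' : L2 mu u' := L2_bounded mu mu' u'_bdd.
pose u := periodize u'.
pose p (x : 'rV[R]_d) : 'rV[R]_d := \row_i periodize (p' i) x.
have pE i x : p x 0 i = periodize (p' i) x by rewrite mxE.
have per_p : torus_periodic p.
  by move=> i x; apply/rowP => j; rewrite !pE periodize_periodic.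
have Lp2 i : torus_Lp 2%:E (fun x => p x 0 i).
  split; first by move=> j x; rewrite !pE periodize_periodic.
  rewrite (_ : _ \o _ = periodize (p' i) \o cube_point).
    by apply: L2_Lfun; exact: periodize_L2.
  by apply/funext => t /=; rewrite pE.
have Lu2 : torus_Lp 2%:E u.
  split; first exact: periodize_periodic.
  by apply: L2_Lfun; exact: periodize_L2.
have wg : weak_gradient u p.
  split => // phi sphi i.
  have cphi := torus_smooth_C1 sphi.
  pose jphi := torus_jet phi.
  have dphi : torus_jets jphi by exists phi.
  have Lphi k := ts_jL2 mu TD dphi k.
  have iu := L2_intgM (periodize_L2 Lu') (Lphi (Some i)).
  have ip := L2_intgM (periodize_L2 (Lp' i)) (Lphi None).
  have -> : torus_int (fun x => u x * partial i phi x) =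
      Rintegral mu setT (fun t => u' t * jphi (Some i) t).
    apply: ae_eq_int; [exact: intg_measurable iu|exact: (intg_measurable (L2_intgM Lu' (Lphi _)))|].
    by apply: filterS (ae_periodize u') => t ut; rewrite ut.
  have -> : torus_int (fun x => p x 0 i * phi x) =
      Rintegral mu setT (fun t => p' i t * jphi None t).
    under [LHS]eq_int do rewrite pE.
    apply: ae_eq_int; [exact: intg_measurable ip|exact: (intg_measurable (L2_intgM (Lp' i) (Lphi _)))|].
    by apply: filterS (ae_periodize (p' i)) => t ut; rewrite ut.
  (* Chain rule for [lnx m]; the identity it requires of C^1 functions is integration by parts on
     the torus against [phi]. *)
  have cr : Rintegral mu setT (fun t => lnx m (w None t) * jphi (Some i) t) =
      - Rintegral mu setT (fun t => (Num.max (w None t) m)^-1 * w (Some i) t * jphi None t).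
    apply: (H1_chain_rule TD (C11_lnx m0) hw dphi) => _ [f cf ->].
    exact: (torus_ibp i cf cphi).
  have i1 := L2_intgM (C11_L2 (C11_lnx m0) (Lw None)) (Lphi (Some i)).
  have i2 := L2_intgM (L2_mul_bounded minv inv_bdd (Lw (Some i))) (Lphi None).
  have -> : Rintegral mu setT (fun t => u' t * jphi (Some i) t) =
      - 2 * Rintegral mu setT (fun t => lnx m (w None t) * jphi (Some i) t).
    by rewrite -(intZ _ i1); apply: eq_int => t; rewrite /u' /= lnw mulrA.
  rewrite cr.
  have -> : Rintegral mu setT (fun t => (Num.max (w None t) m)^-1 * w (Some i) t * jphi None t) =
      Rintegral mu setT (fun t => (w None t)^-1 * w (Some i) t * jphi None t).
    by apply: eq_int => t; rewrite maxw.
  rewrite mulrN -(intZ _ i2); congr (- _); apply: eq_int => t.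
  by rewrite /p' mulrA.
exists u; split; first by split => //; exists p.
  split; first exact: periodize_periodic.
  apply: (bounded_Lfun_infty _ (M := 2 * (`|ln m| + `|ln M|))).
    exact: measurable_periodize.
  by move=> t; exact: u'_bdd.
exists p => // v sv.
have cv := torus_smooth_C1 sv.
pose jv := torus_jet v.
have dv : torus_jets jv by exists v.
have Lv k := ts_jL2 mu TD dv k.
have key := weak_eq_mul_comp TD (C11_invx m0) a_meas a_bdd hw LF weq dv.
pose q i t := periodize (p' i) (cube_point t).
have Lq i : L2 mu (q i) := periodize_L2 (Lp' i).
have [Mv hMv] := ts_bdd TD dv None.
have iww := form_intg a_meas a_bdd (fun i => Lw (Some i)) (fun i => Lw (Some i)).
(* The three terms of the equation tested with [v / w]. Multiplied by [- 2] they become [Dv A Du^T],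
   [1/2 Du A Du^T v] and [(W - g(- u)) v], because [Du = - 2 Dw / w] and [- u = 2 ln w]. *)
pose G1 t := aform a t (fun i => invx m (w None t) * jv (Some i) t) (grad w t).
pose G2 t := - (Num.max (w None t) m)^-1 ^+ 2 * (jv None t * aform a t (grad w t) (grad w t)).
pose G3 t := invx m (w None t) * (reaction W g t (w None t) * jv None t).
have i1 : intg mu G1.
  apply: (form_intg (P := fun i t => invx m (w None t) * jv (Some i) t) a_meas a_bdd)
    (fun i => Lw (Some i)) => i.
  by under eq_fun do rewrite invw; exact: L2_mul_bounded minv inv_bdd (Lv (Some i)).
have i2 : intg mu G2.
  apply: (@intg_mul_bounded _ _ _ mu _ _ (m^-1 ^+ 2)).
  - by under eq_fun do rewrite maxw; apply: measurableT_comp => //; exact: measurable_funX.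
  - by move=> t; rewrite maxw normrN normrX lerXn2r ?nnegrE// invr_ge0 ltW.
  - exact: (intg_mul_bounded (ts_meas TD dv None) hMv iww).
have i3 : intg mu G3.
  rewrite (_ : G3 = fun t => (w None t)^-1 * (reaction W g t (w None t) * jv None t)).
    exact: (intg_mul_bounded minv inv_bdd (L2_intgM LF (Lv None))).
  by apply/funext => t; rewrite /G3 invw.
have iG := intgZ (- 2) (intgD (intgD i1 i2) i3).
have <- : Rintegral mu setT (fun t => - 2 * (G1 t + G2 t + G3 t)) = 0.
  by rewrite (intZ _ (intgD (intgD i1 i2) i3)) (intD (intgD i1 i2) i3) (intD i1 i2) key mulr0.
have E t : mxform (A (cube_point t)) (gradient v (cube_point t)) (p (cube_point t)) +
    (2^-1 * mxform (A (cube_point t)) (p (cube_point t)) (p (cube_point t)) +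
     (V (cube_point t) - Hbar) - g (- u (cube_point t))) * v (cube_point t) =
    aform a t (fun i => jv (Some i) t) (fun i => q i t) +
    (2^-1 * aform a t (fun i => q i t) (fun i => q i t) + W t - g (- u (cube_point t))) * jv None t.
  rewrite !(mxform_aform (M := a) (t := t))//.
  have -> : (fun i => p (cube_point t) 0 i) = fun i => q i t.
    by apply/funext => i; rewrite pE.
  by have -> : (fun i => gradient v (cube_point t) 0 i) = fun i => jv (Some i) t
    by apply/funext => i; rewrite mxE.
rewrite /torus_int; under [LHS]eq_int do rewrite E.
apply: ae_eq_int.
- have mq := intg_measurable (form_intg a_meas a_bdd Lq Lq).
  have mvq := intg_measurable (form_intg a_meas a_bdd (fun i => Lv (Some i)) Lq).
  have mg : measurable_fun setT g.
    by apply: continuous_measurable_fun; exact: locally_lipschitz_continuous.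
  apply: measurable_funD => //; apply: measurable_funM; last exact: (Lv None).1.
  apply: measurable_funB; first by apply: measurable_funD => //; exact: measurable_funM.
  apply: (measurableT_comp mg); apply: measurableT_comp => //.
  exact: measurable_periodize.
- exact: (intg_measurable iG).
have ae_q : {ae mu, forall t, forall i, p' i t = q i t}.
  by apply: filter_forall => i; exact: ae_periodize.
apply: filterS2 ae_q (ae_periodize u') => t qt ut.
have -> : (fun i => q i t) = fun i => - 2 * (w None t)^-1 * grad w t i.
  by apply/funext => i; rewrite -qt /p' mulrA.
rewrite -[u _]ut /u' /G1 /G2 /G3 /reaction maxw invw !formZ_r !formZ_l.
have -> : - (- 2 * ln (w None t)) = 2 * ln (w None t) by ring.
have w_neq0 : w None t != 0 by rewrite gt_eqF.
by move: (aform _ _ _ _) (aform _ _ _ _) (g _) => x y z; field.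
Qed.
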